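(* Let $\mathbb{K}$ be a field of characteristic zero, let $\mathfrak{s}$ be a simple Lie algebra over $\mathbb{K}$ and let $m_1,\dots,m_t$ be irreducible finite-dimensional $\mathfrak{s}$-modules with representations $\rho_i\colon\mathfrak{s}\to\mathfrak{gl}(m_i)$, $i=1,\dots,t$, where $\rho_1$ is faithful. Suppose we are given $\mathfrak{s}$-module homomorphisms $$p_{ijk}\colon m_i\otimes m_j\to m_k,\qquad 1\le i\le j\le k\le t,\ i+j\le k,$$ such that (i) $p_{iik}$ is skew-symmetric (i.e. $p_{iik}(u,v)=-p_{iik}(v,u)$); (ii) $p_{1,j,j+1}\neq 0$ for every $j=1,\dots,t-1$; (iii) for all $i\le j\le k$ with $i+j+k\le t$ and all $u\in m_i$, $v\in m_j$, $w\in m_k$, $$\sum_{l=j+k}^{t-i}\sum_{r=i+l}^{t}p_{ilr}\big(u,p_{jkl}(v,w)\big)-\sum_{l=i+k}^{t-j}\sum_{r=j+l}^{t}p_{jlr}\big(v,p_{ikl}(u,w)\big)+\sum_{l=i+j}^{t-k}\sum_{r=k+l}^{t}\hat p_{klr}\big(w,p_{ijl}(u,v)\big)=0,$$ where $\hat p_{klr}(w,x)=p_{klr}(w,x)$ if $k\le l$ and $\hat p_{klr}(w,x)=-p_{lkr}(x,w)$ if $k>l$ (empty sums are zero). On the vector space $\mathfrak{g}=\mathfrak{s}\oplus m_1\oplus\cdots\oplus m_t$ define a skew-symmetric bilinear bracket by $[s,s']_{\mathfrak{g}}=[s,s']_{\mathfrak{s}}$, $[s,u]_{\mathfrak{g}}=-[u,s]_{\mathfrak{g}}=\rho_i(s)(u)$,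 and $[u,v]_{\mathfrak{g}}=-[v,u]_{\mathfrak{g}}=\sum_{k=i+j}^{t}p_{ijk}(u,v)$ for $s,s'\in\mathfrak{s}$, $u\in m_i$, $v\in m_j$, $i\le j$ (the sum being zero if $i+j>t$). Then $\mathfrak{g}$ is a Lie algebra whose lattice of ideals is the $(t+2)$-element chain $$0< m_t< m_{t-1}\oplus m_t<\cdots< m_1\oplus m_2\oplus\cdots\oplus m_t<\mathfrak{g}.$$ Moreover, every mixed Lie algebra over $\mathbb{K}$ whose lattice of ideals is a $(t+2)$-element chain is of this form.
   Context: All Lie algebras are finite-dimensional. A mixed Lie algebra is a Lie algebra that is neither solvable nor semisimple. The lattice of ideals of a Lie algebra is the set of its ideals ordered by inclusion; it is an $n$-element chain if it consists of $n$ ideals totally ordered by inclusion. *)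

(* Defs.v *)
From HB Require Import structures.
From mathcomp Require Import all_boot all_order all_algebra.
Set Implicit Arguments. Unset Strict Implicit. Unset Printing Implicit Defensive.
Import GRing.Theory.
Local Open Scope ring_scope.

Section Lie.
Variables (K : fieldType) (V : vectType K).
Implicit Types (br b r f : V -> V -> V) (U A B S M : {vspace V}).

Definition bilin_on A B f :=
  (forall a x x' y, x \in A -> x' \in A -> y \in B ->
      f (a *: x + x') y = a *: f x y + f x' y) /\
  (forall a x y y', x \in A -> y \in B -> y' \in B ->
      f x (a *: y + y') = a *: f x y + f x y').

Definition lie_bracket br :=
  [/\ bilin_on fullv fullv br, (forall x, br x x = 0) &
      (forall x y z, br x (br y z) + br y (br z x) + br z (br x y) = 0)].

(* two-sided ideal (for an alternating bracket) *)
Definition is_ideal br U := forall x y, y \in U -> br x y \in U.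

Definition derived br U : {vspace V} :=
  <<[seq br x y | x <- vbasis U, y <- vbasis U]>>%VS.

Definition solvable_sub br U := exists n, iter n (derived br) U = 0%VS.
Definition solvable br := solvable_sub br fullv.
Definition semisimple br :=
  forall I, is_ideal br I -> solvable_sub br I -> I = 0%VS.
Definition mixed br := ~ solvable br /\ ~ semisimple br.

Definition vproper A B := (A <= B)%VS && (A != B).

Definition ideal_lattice_chain br (n : nat) :=
  exists f : nat -> {vspace V},
    [/\ (forall i, (i < n)%N -> is_ideal br (f i)),
        (forall U, is_ideal br U -> exists2 i, (i < n)%N & U = f i) &
        (forall i j, (i < j < n)%N -> vproper (f i) (f j))].

Definition lie_on S b :=
  [/\ (forall x y, x \in S -> y \in S -> b x y \in S), bilin_on S S b,
      (forall x, x \in S -> b x x = 0) &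
      (forall x y z, x \in S -> y \in S -> z \in S ->
         b x (b y z) + b y (b z x) + b z (b x y) = 0)].

Definition simple_on S b :=
  [/\ lie_on S b,
      (exists x y, [/\ x \in S, y \in S & b x y != 0]) &
      (forall U, (U <= S)%VS ->
         (forall x y, x \in S -> y \in U -> b x y \in U) ->
         U = 0%VS \/ U = S)].

Definition rep_on S b M r :=
  [/\ (forall s u, s \in S -> u \in M -> r s u \in M), bilin_on S M r &
      (forall s s' u, s \in S -> s' \in S -> u \in M ->
         r (b s s') u = r s (r s' u) - r s' (r s u))].

Definition irreducible_rep S M r :=
  M != 0%VS /\
  (forall U, (U <= M)%VS -> (forall s u, s \in S -> u \in U -> r s u \in U) ->
     U = 0%VS \/ U = M).

Definition faithful_rep S M r :=
  forall s, s \in S -> (forall u, u \in M -> r s u = 0) -> s = 0.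

(* f : Mi (x) Mj -> Mk is a homomorphism of S-modules, given as the
   corresponding bilinear S-equivariant map Mi x Mj -> Mk *)
Definition module_hom2 S (Mi Mj Mk : {vspace V}) (ri rj rk : V -> V -> V) f :=
  [/\ (forall u v, u \in Mi -> v \in Mj -> f u v \in Mk), bilin_on Mi Mj f &
      (forall s u v, s \in S -> u \in Mi -> v \in Mj ->
         rk s (f u v) = f (ri s u) v + f u (rj s v))].

Definition phat (p : nat -> nat -> nat -> V -> V -> V) (k l r : nat) (w x : V) :=
  if (k <= l)%N then p k l r w x else - p l k r x w.

Definition chain_data (t : nat) S (M : nat -> {vspace V}) (bS : V -> V -> V)
    (rho : nat -> V -> V -> V) (p : nat -> nat -> nat -> V -> V -> V) :=
  [/\ (0 < t)%N,
      simple_on S bS,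
      (forall i, (1 <= i <= t)%N ->
          rep_on S bS (M i) (rho i) /\ irreducible_rep S (M i) (rho i)),
      faithful_rep S (M 1%N) (rho 1%N) &
      (forall i j k, [&& 1 <= i, i <= j, j <= k, k <= t & i + j <= k]%N ->
          module_hom2 S (M i) (M j) (M k) (rho i) (rho j) (rho k) (p i j k))].

Definition chain_conditions (t : nat) (M : nat -> {vspace V})
    (p : nat -> nat -> nat -> V -> V -> V) :=
  [/\
      (forall i k, [&& 1 <= i, k <= t & i + i <= k]%N ->
         forall u v, u \in M i -> v \in M i -> p i i k u v = - p i i k v u),
      (forall j, (1 <= j <= t.-1)%N ->
         exists u v, [/\ u \in M 1%N, v \in M j & p 1%N j j.+1 u v != 0]) &
      (forall i j k, [&& 1 <= i, i <= j, j <= k & i + j + k <= t]%N ->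
         forall u v w, u \in M i -> v \in M j -> w \in M k ->
           \sum_(j + k <= l < (t - i).+1) \sum_(i + l <= r < t.+1)
               p i l r u (p j k l v w)
         - \sum_(i + k <= l < (t - j).+1) \sum_(j + l <= r < t.+1)
               p j l r v (p i k l u w)
         + \sum_(i + j <= l < (t - k).+1) \sum_(k + l <= r < t.+1)
               phat p k l r w (p i j l u v) = 0)].

Definition chain_bracket (t : nat) S (M : nat -> {vspace V}) (bS : V -> V -> V)
    (rho : nat -> V -> V -> V) (p : nat -> nat -> nat -> V -> V -> V) br :=
  [/\ (S + \sum_(1 <= i < t.+1) M i)%VS = fullv /\
        directv (S + \sum_(1 <= i < t.+1) M i),
      bilin_on fullv fullv br /\ (forall x y, br x y = - br y x),
      (forall s s', s \in S -> s' \in S -> br s s' = bS s s'),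
      (forall i s u, (1 <= i <= t)%N -> s \in S -> u \in M i ->
          br s u = rho i s u) &
      (forall i j u v, (1 <= i)%N -> (i <= j <= t)%N -> u \in M i -> v \in M j ->
          br u v = \sum_(i + j <= k < t.+1) p i j k u v)].

Definition of_chain_form (t : nat) S (M : nat -> {vspace V}) (bS : V -> V -> V)
    (rho : nat -> V -> V -> V) (p : nat -> nat -> nat -> V -> V -> V) br :=
  [/\ chain_data t S M bS rho p, chain_conditions t M p &
      chain_bracket t S M bS rho p br].

(* m_k (+) ... (+) m_t ; tail_sum (t+1) = 0 *)
Definition tail_sum (t : nat) (M : nat -> {vspace V}) k :=
  (\sum_(k <= i < t.+1) M i)%VS.

End Lie.

(* Main.v *)
(* For the converse, the radical R of a mixed Lie algebra whose ideals form a chain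
   has simple quotient: the trace form on the ideal just above R is nondegenerate modulo R,
   and its orthogonal is an ideal, which the chain condition forces to be R. Levi's theorem
   and Weyl's theorem then give g = S + m_1 + ... + m_t with S-submodules m_i. Since g is
   perfect, R acts trivially on the irreducible quotients of the chain, and since two
   incomparable ideals cannot occur, the chain is the lower central series of R; hence
   [m_i, m_j] lies in m_(i+j) + ... + m_t and [m_1, m_j] is not contained in
   m_(j+2) + ... + m_t. Cartan's criterion, from which everything starts, needs one
   splitting field: if the trace form vanishes on L, the eigenvalues l_i of x in [L, L] with
   multiplicities n_i satisfy sum_i n_i c_i l_i = 0 for every rational weight c respecting
   the additive relations between the l_i, which forces l = 0 by positivity.
   Conversely, an ideal of the constructed algebra is compared with the filtration by
   tails, and irreducibility together with p_(1,j,j+1) <> 0 propagates a containment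
   modulo one tail to the next. *)
Require Import Defs.
From HB Require Import structures.
From mathcomp Require Import all_boot all_order all_algebra all_field.
From mathcomp Require Import ring zify.
From Stdlib Require Import Classical.
Set Implicit Arguments. Unset Strict Implicit. Unset Printing Implicit Defensive.
Import Order.TTheory GRing.Theory Num.Theory.
Local Open Scope ring_scope.

(** * Nilpotent matrices and traces *)

Section Nilpotent.
Variable K : fieldType.

(** The quotient algebra g / R is never constructed: its place is taken by the perfect algebra g
    together with a maximal ideal R that the representations kill. One vanishing statement, for
    cocycles that are zero on R, then serves both decompositions. The obstruction in Levi's theorem
    is a 2-cocycle; currying turns it into a 1-cocycle with values in linear maps modulo inner ones,
    so first cohomology suffices. The vanishing itself does not presuppose complete reducibility: it
    comes from a Casimir matrix and induction on its generalised kernel. As K is an arbitrary field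
    of characteristic zero, nilpotency is reached through traces of powers and rank factorisations,
    and positivity is used only over the rationals. Modules are spaces of row vectors with matrices
    acting on the right, in line with the right adjoint action. In the direct part the Jacobi
    identity splits by degree: on sorted homogeneous triples it is the Jacobi identity of S, the
    module axiom, equivariance of the [p i j k], or condition (iii). *)

Lemma mulmx_expmxC n r (C : 'M[K]_(n, r)) (B : 'M[K]_(r, n)) k :
  (C *m B) ^+ k.+1 = C *m (B *m C) ^+ k *m B.
Proof.
elim: k => [|k IHk]; first by rewrite expr1 expr0 mulmx1.
by rewrite exprSr IHk (exprSr (B *m C)) -!mulmxE !mulmxA.
Qed.

Lemma nilp_rank_lt n (A : 'M[K]_n) N : (0 < n)%N -> A ^+ N = 0 -> (\rank A < n)%N.
Proof.
move=> n_gt0 AN0; rewrite ltn_neqAle rank_leq_row andbT.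
apply/negP => Afree; suff A0: (1%:M : 'M[K]_n) = 0.
  by move: n_gt0; rewrite -[n](mxrank1 K) A0 mxrank0.
elim: N AN0 => [|N IHN]; first by [].
by rewrite exprSr => /(canRL (mulmxK _)); rewrite mul0mx -row_free_unit => /(_ Afree).
Qed.

(** Induction on the size through the rank factorisation A = C B: the matrix B C has size [\rank A],
    which is smaller, has the same trace and is still nilpotent. *)
Lemma mxtrace_nilp n (A : 'M[K]_n) N : A ^+ N = 0 -> \tr A = 0.
Proof.
have [m] := ubnP n; elim: m n A N => // m IHm [|n] A N lt_n AN0.
  by rewrite /mxtrace big_ord0.
rewrite -[A in \tr A]mulmx_base mxtrace_mulC.
apply: (IHm _ _ N.+1); first by rewrite (leq_trans (nilp_rank_lt _ AN0)).
by rewrite mulmx_expmxC mulmx_base AN0 mulmx0 mul0mx.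
Qed.

Hypothesis charK0 : [pchar K] =i pred0.

(** No eigenvalues are needed. If A were invertible, the trace of the Cayley-Hamilton identity would
    retain only the constant coefficient times the size, both nonzero in characteristic 0. A
    singular A passes to the smaller matrix B C of its rank factorisation. *)
Lemma trace_exp_nilp n (A : 'M[K]_n) :
  (forall k, \tr (A ^+ k.+1) = 0) -> exists N, A ^+ N = 0.
Proof.
have [m] := ubnP n; elim: m n A => // m IHm [|n] A lt_n trA.
  by exists 0; apply/matrixP => -[].
have [Afree|Anfree] := boolP (row_free A).
  have := Cayley_Hamilton A; rewrite /horner_mx.
  have p0: (char_poly A)`_0 != 0.
    rewrite char_poly_det mulf_neq0 ?signr_eq0 //.
    by rewrite row_free_unit unitmxE unitfE in Afree.
  move/(congr1 mxtrace); rewrite mxtrace0 -/(horner_mx A _).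
  rewrite -[char_poly A]coefK poly_def raddf_sum /= raddf_sum /=.
  rewrite size_char_poly big_ord_recl /= big1 => [|i _]; last first.
    by rewrite horner_mxZ rmorphXn /= horner_mx_X mxtraceZ trA mulr0.
  rewrite horner_mxZ expr0 rmorph1 mxtraceZ addr0 mxtrace1 => /eqP.
  by rewrite mulf_eq0 (negPf p0) (proj1 (pcharf0P K) charK0).
pose C := col_base A; pose B := row_base A.
have defA: A = C *m B by rewrite mulmx_base.
have lt_rk: (\rank A < n.+1)%N by rewrite ltn_neqAle rank_leq_row andbT.
have [//||N BN0] := IHm _ (B *m C); first exact: leq_trans lt_rk _.
  move=> k; rewrite exprSr -mulmxE mulmxA -mxtrace_mulC mulmxA -mulmx_expmxC -defA.
  exact: trA.
by exists N.+1; rewrite defA mulmx_expmxC BN0 mulmx0 mul0mx.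
Qed.

Lemma mxtrace_idem n (E : 'M[K]_n) : E *m E = E -> \tr E = (\rank E)%:R.
Proof.
move=> EE; rewrite -[in LHS](mulmx_base E) mxtrace_mulC.
suff ->: row_base E *m col_base E = 1%:M by rewrite mxtrace1.
apply: (row_free_inj (row_base_free E)); apply: (row_full_inj (col_base_full E)).
by rewrite mul1mx mulmxA [_ *m (_ *m col_base E)]mulmxA mulmx_base -mulmxA mulmx_base.
Qed.

End Nilpotent.

(** * Rational numbers in characteristic zero, splitting fields and interpolation *)

Section RatEmbedding.
Variables (F : fieldType) (charF0 : [pchar F] =i pred0).

Lemma intr_eq0_pchar0 (a : int) : (a%:~R == 0 :> F) = (a == 0).
Proof.
have natF := proj1 (pcharf0P F) charF0.
by case: a => n; rewrite ?NegzE ?mulrNz ?oppr_eq0 -pmulrn natF.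
Qed.

Lemma ratr_fracE (a b : int) : b != 0 -> ratr (a%:Q / b%:Q) = a%:~R / b%:~R :> F.
Proof.
move=> b0; set x := _ / _.
have bF: b%:~R != 0 :> F by rewrite intr_eq0_pchar0.
have dF: (denq x)%:~R != 0 :> F by rewrite intr_eq0_pchar0 denq_eq0.
have bQ: b%:Q != 0 by rewrite intr_eq0.
have dQ: (denq x)%:Q != 0 by rewrite intr_eq0 denq_eq0.
rewrite /ratr; apply/eqP; rewrite eqr_div // -!intrM; apply/eqP; congr _%:~R.
apply: (@intr_inj rat); rewrite !intrM; apply/eqP.
by rewrite -eqr_div // divq_num_den.
Qed.

Lemma ratr_zmod_morphism_pchar0 : zmod_morphism (@ratr F).
Proof.
move=> x y; rewrite -[x in LHS]divq_num_den -[y in LHS]divq_num_den.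
have d0 z : (denq z) != 0 := denq_neq0 z.
have dQ z : (denq z)%:Q != 0 by rewrite intr_eq0.
have dF z : (denq z)%:~R != 0 :> F by rewrite intr_eq0_pchar0.
rewrite -mulNr addf_div // -!rmorphM -rmorphN -rmorphM -rmorphD ratr_fracE ?mulf_neq0 ?d0 //.
by rewrite /ratr -mulNr addf_div // !rmorphD !rmorphM rmorphN.
Qed.

Lemma ratr_monoid_morphism_pchar0 : monoid_morphism (@ratr F).
Proof.
split=> [|x y]; first by rewrite -[1]/(1%:~R) ratr_int.
rewrite -[x in LHS]divq_num_den -[y in LHS]divq_num_den.
have d0 z : (denq z) != 0 := denq_neq0 z.
have dF z : (denq z)%:~R != 0 :> F by rewrite intr_eq0_pchar0.
by rewrite mulf_div -!rmorphM ratr_fracE ?mulf_neq0 ?d0 // /ratr mulf_div !rmorphM.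
Qed.

Lemma rat_embedding : exists f : {rmorphism rat -> F}, True.
Proof.
pose zM := GRing.isZmodMorphism.Build _ _ (@ratr F) ratr_zmod_morphism_pchar0.
pose rM := GRing.isMonoidMorphism.Build _ _ (@ratr F) ratr_monoid_morphism_pchar0.
by exists (HB.pack_for {rmorphism rat -> F} (@ratr F) zM rM).
Qed.

End RatEmbedding.

(** Roots are adjoined one at a time, by induction on the degree; the leading coefficient is
    absorbed by [%=]. *)
Lemma splitting_field_exists (F : fieldType) (p : {poly F}) : p != 0 ->
  exists (L : fieldType) (f : {rmorphism F -> L}) (rs : seq L),
    map_poly f p %= \prod_(z <- rs) ('X - z%:P).
Proof.
have [m] := ubnP (size p); elim: m F p => // m IHm F p lt_p p0.
have [p1|p_gt1] := leqP (size p) 1.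
  exists F, idfun, [::]; rewrite big_nil map_poly_id // -size_poly_eq1.
  by rewrite eqn_leq p1 size_poly_gt0.
(* Irreducibility over an arbitrary field is not decidable, so the descent through proper divisors
   is classical. *)
have [q irr_q qp] : exists2 q, irreducible_poly q & q %| p.
  have [r lt_r] := ubnP (size p); elim: r p {lt_p p0} p_gt1 lt_r => // r IHr p p_gt1 lt_p.
  have [irr_p|nirr] := classic (irreducible_poly p); first by exists p.
  have [[q [q1 qp nqp]]|nq] :=
    classic (exists q : {poly F}, [/\ size q != 1, q %| p & ~~ (q %= p)]).
    have p0: p != 0 by rewrite -size_poly_gt0 ltnW.
    have q_gt1: (1 < size q)%N.
      by rewrite ltn_neqAle eq_sym q1 size_poly_gt0 (dvdpN0 qp).
    have lt_qp: (size q < size p)%N.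
      by rewrite ltn_neqAle dvdp_leq // andbT dvdp_size_eqp.
    have [||s irr_s sq] := IHr q; [by []|exact: leq_trans lt_qp _|].
    by exists s => //; apply: dvdp_trans qp.
  case: nirr; split=> // q q1 qp; apply/idPn => nqp.
  by apply: nq; exists q.
have [L _ [z rz _]] := irredp_FAdjoin irr_q.
pose g : {rmorphism F -> L} := in_alg L.
have /factor_theorem[s ps]: root (map_poly g p) z.
  by rewrite -(divpK qp) rmorphM rootM rz orbT.
have s0: s != 0 by apply: contraNneq p0 => s0; rewrite -(map_poly_eq0 g) ps s0 mul0r.
have [|L' [f [rs rsE]]] := IHm _ s _ s0.
  move/(congr1 (fun q : {poly L} => size q)): ps.
  rewrite size_map_poly size_Mmonic ?monicXsubC // size_XsubC addn2 /= => sz.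
  by rewrite -ltnS -sz.
exists L', (f \o g : {rmorphism _ -> _}), (f z :: rs).
rewrite map_poly_comp /= ps rmorphM rmorphB /= map_polyX map_polyC big_cons mulrC.
by rewrite eqp_mull.
Qed.

(** Chinese remainder theorem for powers of linear factors. The values [d] are arbitrary: Kronecker
    deltas produce the primary idempotents, differences of weights produce the polynomial in ad x of
    Cartan's lemma. *)
Lemma poly_interpolation (F : fieldType) (s : seq F) N (d : F -> F) :
  exists q : {poly F}, forall a, a \in s -> ('X - a%:P) ^+ N %| q - (d a)%:P.
Proof.
elim: s => [|a s [q qP]]; first by exists 0.
have [sa|nsa] := boolP (a \in s).
  by exists q => b; rewrite inE => /predU1P[->|]; apply: qP.
pose Q := \prod_(b <- s) ('X - b%:P) ^+ N.
have cQ: coprimep Q (('X - a%:P) ^+ N).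
  rewrite /Q big_seq; elim/big_ind: _ => [|p r cp cr|b sb]; first exact: coprime1p.
    by rewrite coprimepMl cp.
  rewrite coprimep_expl // coprimep_expr // coprimep_XsubC root_XsubC.
  by apply: contraNneq nsa => ->.
have /Bezout_eq1_coprimepP[u uP] := cQ.
exists (q + u.1 * ((d a)%:P - q) * Q) => b; rewrite inE => /predU1P[->|sb].
  have ->: q + u.1 * ((d a)%:P - q) * Q - (d a)%:P
           = ((d a)%:P - q) * (u.1 * Q - 1) by ring.
  by rewrite -uP opprD addNKr dvdp_mull // dvdpNr dvdp_mull.
rewrite addrAC dvdp_addr ?qP // dvdp_mull // /Q (perm_big _ (perm_to_rem sb)) big_cons.
exact: dvdp_mulr.
Qed.

(** * Primary decomposition of a matrix *)

Section Idempotents.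
Variables (F : fieldType) (n m N : nat) (x : 'M[F]_n.+1) (l : 'I_m -> F).
Hypotheses (l_inj : injective l)
  (x_root : horner_mx x (\prod_i ('X - (l i)%:P) ^+ N) = 0).

Lemma primary_idempotents : exists E : 'I_m -> 'M[F]_n.+1,
  [/\ \sum_i E i = 1%:M, (forall i j, E i *m E j = if i == j then E i else 0),
      (forall i, E i *m x = x *m E i) &
      forall i, (x - (l i)%:M) ^+ N *m E i = 0].
Proof.
pose P i := ('X - (l i)%:P) ^+ N; pose PP := \prod_i P i.
have cP i j : i != j -> coprimep (P i) (P j).
  move=> ij; rewrite coprimep_expl // coprimep_expr // coprimep_XsubC root_XsubC.
  by apply: contraNneq ij => /l_inj->.
(* Equalities between polynomials in x may be checked modulo each [P i] separately, since these are
   pairwise coprime and their product kills x. *)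
have PPx q : (forall i, P i %| q) -> horner_mx x q = 0.
  move=> Pq; suff /dvdpP[r ->]: PP %| q by rewrite rmorphM /= x_root mulr0.
  rewrite /PP -big_enum /=; have := enum_uniq 'I_m; elim: (enum _) => [|i s IHs] /=.
    by rewrite big_nil dvd1p.
  case/andP=> si /IHs Ps; rewrite big_cons Gauss_dvdp ?Pq // big_seq.
  elim/big_rec: _ => [|j p js cp]; first exact: coprimep1.
  by rewrite coprimepMr cp cP // (contraNneq _ si) // => ->.
have /fin_all_exists[e eP] (i : 'I_m) : exists e : {poly F},
    forall j, P j %| e - (i == j)%:R%:P.
  have [e eP] := poly_interpolation (codom l) N (fun a => (a == l i)%:R).
  by exists e => j; have := eP (l j) (codom_f l j); rewrite (inj_eq l_inj) eq_sym.
exists (fun i => horner_mx x (e i)); split=> [|i j|i|i].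
- rewrite -rmorph_sum /= -[1%:M](rmorph1 (horner_mx x)); apply/eqP.
  rewrite -subr_eq0 -rmorphB /= PPx // => j.
  have ->: \sum_i e i - 1 = \sum_i (e i - (i == j)%:R%:P).
    rewrite sumrB (bigD1 j) //= [in RHS](bigD1 j (F := fun i => (i == j)%:R%:P)) //= eqxx.
    by rewrite [X in _ - (1%:P + X)]big1 ?addr0 // => i /negPf->; rewrite polyC0.
  by elim/big_rec: _ => [|i p _]; rewrite ?dvdp0 // => Pp; rewrite dvdp_add.
- rewrite mulmxE -rmorphM /=; apply/eqP.
  pose r := (i == j)%:R * e i.
  have ->: (if i == j then horner_mx x (e i) else 0) = horner_mx x ((i == j)%:R%:P * e i).
    by case: eqP; rewrite ?mul1r // polyC0 mul0r rmorph0.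
  rewrite -subr_eq0 -rmorphB /= PPx // => k.
  (* Modulo [P k] each [e i] reduces to a Kronecker delta; the constant term left over vanishes. *)
  have ->: e i * e j - (i == j)%:R%:P * e i
     = e i * (e j - (j == k)%:R%:P) + (e i - (i == k)%:R%:P) * ((j == k)%:R%:P - (i == j)%:R%:P)
       + ((i == k)%:R%:P * ((j == k)%:R%:P - (i == j)%:R%:P)) by ring.
  have ->: (i == k)%:R%:P * ((j == k)%:R%:P - (i == j)%:R%:P) = 0 :> {poly F}.
    have [->|_] := eqVneq i k; last by rewrite mul0r.
    by rewrite eq_sym subrr mulr0.
  by rewrite addr0; apply: dvdp_add; [apply: dvdp_mull | apply: dvdp_mulr]; apply: eP.
- suff: horner_mx x (e i * 'X) = horner_mx x ('X * e i).
    by rewrite !rmorphM /= horner_mx_X.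
  by rewrite mulrC.
- have ->: (x - (l i)%:M) ^+ N = horner_mx x (P i).
    by rewrite rmorphXn rmorphB /= horner_mx_X horner_mx_C.
  rewrite mulmxE -rmorphM /= PPx // => j.
  have [->|ij] := eqVneq j i; first exact: dvdp_mulr.
  by have := eP i j; rewrite eq_sym (negPf ij) subr0; apply: dvdp_mull.
Qed.

End Idempotents.

(** * Polynomials in a linear endomorphism *)

Section PolyAction.
Variables (F : fieldType) (W : lmodType F) (f : {linear W -> W}).
Implicit Types (p q : {poly F}) (w : W).

(** This is q(f) w, written without a matrix for f: it is meant for f = ad x on a space of
    matrices. *)
Definition poly_act (q : {poly F}) (w : W) := \sum_(k < size q) q`_k *: iter k f w.

Lemma poly_act_wide q M w : (size q <= M)%N ->
  poly_act q w = \sum_(k < M) q`_k *: iter k f w.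
Proof.
move=> leM; rewrite /poly_act (big_ord_widen _ (fun k => q`_k *: iter k f w) leM).
rewrite [RHS](bigID (fun k : 'I_M => (k < size q)%N)) /= [X in _ + X]big1 ?addr0 // => i.
by rewrite -leqNgt => /leq_sizeP->; rewrite ?scale0r.
Qed.

Lemma poly_actD p q w : poly_act (p + q) w = poly_act p w + poly_act q w.
Proof.
rewrite (poly_act_wide _ (size_polyD _ _)) (poly_act_wide _ (leq_maxl _ (size q))).
rewrite (poly_act_wide _ (leq_maxr (size p) _)) -big_split /=.
by apply: eq_bigr => k _; rewrite coefD scalerDl.
Qed.

Lemma poly_actC c w : poly_act c%:P w = c *: w.
Proof. by rewrite (poly_act_wide _ (size_polyC_leq1 _)) big_ord1 coefC. Qed.

Lemma poly_actMX q w : poly_act (q * 'X) w = f (poly_act q w).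
Proof.
rewrite (poly_act_wide (M := (size q).+1)); last first.
  by rewrite (leq_trans (size_polyMleq _ _)) // size_polyX addn2.
rewrite big_ord_recl coefMX scale0r add0r linear_sum.
by apply: eq_bigr => k _; rewrite coefMX linearZ.
Qed.

Lemma poly_act_linear q : linear (poly_act q).
Proof.
move=> a u v; rewrite /poly_act scaler_sumr -big_split /=.
apply: eq_bigr => k _; have ->: iter k f (a *: u + v) = a *: iter k f u + iter k f v.
  by elim: (nat_of_ord k) => //= j ->; rewrite linearP.
by rewrite scalerDr !scalerA mulrC.
Qed.

Lemma poly_act0 q : poly_act q 0 = 0.
Proof. by have := poly_act_linear q (-1) 0 0; rewrite scaler0 addr0 scaleN1r addNr. Qed.

Lemma poly_actM p q w : poly_act (p * q) w = poly_act p (poly_act q w).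
Proof.
elim/poly_ind: p w => [|p c IHp] w; first by rewrite mul0r -polyC0 !poly_actC !scale0r.
rewrite mulrDl poly_actD mulrAC poly_actMX IHp poly_actD poly_actMX poly_actC.
congr (_ + _); elim/poly_ind: q {IHp} => [|q d IHq].
  by rewrite mulr0 -polyC0 !poly_actC !scale0r scaler0.
rewrite mulrDr mulrA !poly_actD !poly_actMX IHq linearZ scalerDr.
by rewrite -polyCM !poly_actC scalerA.
Qed.

Lemma poly_act_eigen q a d M w : ('X - a%:P) ^+ M %| q - d%:P ->
  iter M (fun v => f v - a *: v) w = 0 -> poly_act q w = d *: w.
Proof.
case/dvdpP=> r /(canRL (subrK _)) -> w0; rewrite poly_actD poly_actC poly_actM.
suff ->: poly_act (('X - a%:P) ^+ M) w = 0 by rewrite poly_act0 add0r.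
rewrite -{}w0; elim: M => [|M IHM]; first by rewrite expr0 poly_actC scale1r.
rewrite exprSr; move: (_ ^+ M) IHM => s IHM; rewrite mulrBr -mulrN -polyCN poly_actD poly_actMX IHM.
by rewrite [_ * (- a)%:P]mulrC poly_actM poly_actC IHM scaleNr.
Qed.

End PolyAction.

(** * Cartan's lemma *)

Section RationalWeights.
Variables (F : fieldType) (charF0 : [pchar F] =i pred0).

(** Positivity is available over the rationals only, while the [l i] live in F. The conclusion is
    therefore proved as a rational statement on row spaces, which then transfers along the embedding
    [f]. *)
Lemma additive_weights_eq0 m (l : 'I_m -> F) (w : 'I_m -> nat) :
  (forall c : 'I_m -> F,
     (forall i j k h, l i - l j = l k - l h -> c i - c j = c k - c h) ->
     \sum_i c i * ((w i)%:R * l i) = 0) ->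
  forall i, (w i)%:R * l i = 0.
Proof.
move=> wl i; have [f _] := rat_embedding charF0.
pose T := ('I_m * 'I_m * ('I_m * 'I_m))%type.
(* One row for each quadruple of indices, and zero unless the quadruple is an additive relation
   between the [l i]; the rows of [C] are then the rational weights respecting all of them. *)
pose ok (u : T) := l u.1.1 - l u.1.2 == l u.2.1 - l u.2.2.
pose rel (u : T) (s : 'I_m) : rat :=
  (ok u)%:R * ((u.1.1 == s)%:R - (u.1.2 == s)%:R - ((u.2.1 == s)%:R - (u.2.2 == s)%:R)).
pose R := \matrix_(u < #|{: T}|, s < m) rel (enum_val u) s.
pose C := kermx R^T; pose D := diag_mx (\row_s (w s)%:R) : 'M[rat]_m.
pose lc := \col_s l s.
have dotE (G : fieldType) (u v : 'I_m) (p q : 'I_m) (g : 'I_m -> G) :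
  \sum_s ((u == s)%:R - (v == s)%:R - ((p == s)%:R - (q == s)%:R)) * g s
    = g u - g v - (g p - g q).
  have E (z : 'I_m) : \sum_s (z == s)%:R * g s = g z.
    rewrite (bigD1 z) //= eqxx mul1r big1 ?addr0 // => s /negPf sz.
    by rewrite eq_sym sz mul0r.
  by rewrite -!E -!sumrB; apply: eq_bigr => s _; ring.
have Rl : map_mx f R *m lc = 0.
  apply/matrixP => u z; rewrite !mxE; set e := enum_val u.
  transitivity (\sum_s (ok e)%:R * (((e.1.1 == s)%:R - (e.1.2 == s)%:R -
            ((e.2.1 == s)%:R - (e.2.2 == s)%:R)) * l s)).
    by apply: eq_bigr => s _; rewrite !mxE /rel rmorphM !rmorphB !rmorph_nat mulrA.
  rewrite -mulr_sumr dotE; have [/eqP->|_] := boolP (ok e); last by rewrite mul0r.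
  by rewrite subrr mulr0.
have CDl : map_mx f (C *m D) *m lc = 0.
  apply/matrixP => u z; rewrite !mxE.
  have CR s : \sum_v C u v * R s v = 0.
    have /matrixP/(_ u s) := mulmx_ker R^T.
    by rewrite !mxE => RC; rewrite -[RHS]RC; apply: eq_bigr => v _; rewrite !mxE.
  rewrite -[RHS](wl (fun s => f (C u s))) => [|p q k h lE].
    by apply: eq_bigr => s _; rewrite mul_mx_diag !mxE rmorphM rmorph_nat mulrA.
  have := CR (enum_rank ((p, q), (k, h))).
  have <- : \sum_v ((p == v)%:R - (q == v)%:R - ((k == v)%:R - (h == v)%:R)) * C u v
      = \sum_v C u v * R (enum_rank ((p, q), (k, h))) v.
    by apply: eq_bigr => v _; rewrite [R _ _]mxE enum_rankK /rel /ok lE eqxx mul1r mulrC.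
  rewrite dotE => /(congr1 f); rewrite rmorph0 !rmorphB => /eqP.
  by rewrite subr_eq0 => /eqP.
(* A column q of X killed by [R] is the transpose of a combination of rows of [C]. If [C *m D] kills
   X too, then the sum of the (w s) (X s q)^2 is 0, so [D] kills X. Both blocks kill the column of
   the [l s], hence so does [D]. *)
have: (D <= col_mx R (C *m D))%MS.
  set B := col_mx _ _; rewrite submxE; apply/eqP; set X := cokermx B.
  have /eqP := mulmx_coker B; rewrite -/X mul_col_mx col_mx_eq0 => /andP[/eqP RX /eqP CX].
  have /submxP[Y XY] : (X^T <= C)%MS.
    by apply/sub_kermxP; rewrite -trmx_mul RX trmx0.
  have XDX : X^T *m D *m X = 0 by rewrite XY -(mulmxA Y) -(mulmxA Y) CX mulmx0.
  apply/matrixP => p q; rewrite mul_diag_mx !mxE; apply/eqP.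
  have /matrixP/(_ q q) := XDX; rewrite !mxE => /eqP.
  rewrite psumr_eq0 => [/allP/(_ p)|s _].
    rewrite mem_index_enum mul_mx_diag !mxE mulrAC mulf_eq0 -expr2 sqrf_eq0 => /(_ isT).
    by rewrite mulf_eq0 orbC.
  by rewrite mul_mx_diag !mxE mulrAC -expr2 mulr_ge0 ?sqr_ge0 ?ler0n.
case/submxP=> Y /(congr1 (fun M => (map_mx f M *m lc) i 0)).
rewrite map_mxM -mulmxA map_col_mx mul_col_mx Rl CDl col_mx0 mulmx0 map_diag_mx mul_diag_mx !mxE.
by rewrite rmorph_nat.
Qed.

End RationalWeights.

Section CartanLemma.

Definition ad_mx (R : comNzRingType) n (x y : 'M[R]_n) := x *m y - y *m x.

Lemma ad_mx_is_linear (R : comNzRingType) n (x : 'M[R]_n) : linear (ad_mx x).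
Proof.
move=> c u v; rewrite /ad_mx mulmxDr mulmxDl -scalemxAr -scalemxAl scalerBr.
by rewrite opprD addrACA.
Qed.

HB.instance Definition _ (R : comNzRingType) n (x : 'M[R]_n) :=
  GRing.isLinear.Build R _ _ _ (ad_mx x) (ad_mx_is_linear x).

(** The operator ad x - (a - b) is left multiplication by x - a minus right multiplication by x - b,
    and these commute: after p + q - 1 steps each term contains p left factors or q right ones. *)
Lemma ad_mx_shift_nilp (R : comNzRingType) n (x z : 'M[R]_n) (a b : R) p q M :
  (p + q <= M.+1)%N -> (x - a%:M) ^+ p *m z = 0 -> z *m (x - b%:M) ^+ q = 0 ->
  iter M (fun y => ad_mx x y - (a - b) *: y) z = 0.
Proof.
set g := fun y => _.
have gE y : g y = (x - a%:M) *m y - y *m (x - b%:M).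
  rewrite mulmxBl mulmxBr mul_scalar_mx mul_mx_scalar /g scalerBl /ad_mx.
  by rewrite !opprB [b *: y - _]addrC addrACA; congr (_ + _); rewrite addrC.
have it0 k : iter k g 0 = 0.
  by elim: k => //= k ->; rewrite gE mulmx0 mul0mx subr0.
have itB k u v : iter k g (u - v) = iter k g u - iter k g v.
  elim: k => //= k ->; rewrite !gE; move: (x - a%:M) (x - b%:M) => X Y.
  rewrite mulmxBr mulmxBl !opprB [_ - _ *m Y]addrC addrACA; congr (_ + _).
  by rewrite addrC.
elim: M p q z => [|M IHM] [|p] [|q] z le_pq; rewrite ?expr0 ?mul1mx ?mulmx1.
all: try by move=> -> _; rewrite it0.
all: try by move=> _ ->; rewrite it0.
  by rewrite addSn addnS in le_pq.
move=> zp zq; rewrite iterSr gE itB (IHM p q.+1) ?(IHM p.+1 q) ?subr0 //.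
- by rewrite addSnnS.
- by rewrite mulmxA zp mul0mx.
- by rewrite -mulmxA mulmxE -exprS -mulmxE zq.
- by rewrite mulmxA mulmxE -exprSr -mulmxE zp.
- by rewrite -mulmxA zq mulmx0.
Qed.

Section SplitCartan.
Variables (F : fieldType) (charF0 : [pchar F] =i pred0).
Variables (n m N r : nat) (x : 'M[F]_n.+1) (l : 'I_m -> F) (a b : 'I_r -> 'M[F]_n.+1).
Hypotheses (l_inj : injective l)
  (x_root : horner_mx x (\prod_i ('X - (l i)%:P) ^+ N) = 0)
  (x_comm : x = \sum_k (a k *m b k - b k *m a k))
  (trab0 : forall k j, \tr (a k *m iter j (ad_mx x) (b k)) = 0).

(** On [E i] the trace of x is rank times [l i], and by x = sum of commutators it is also the sum of
    the [T j i - T i j]. Weighted by an additive c these add up to the sum of the (c j - c i)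
    [T i j], which is the sum of the traces of a_k q(ad x)(b_k) for a polynomial q, hence 0 by
    hypothesis. *)
Lemma split_cartan_nilp : x ^+ N = 0.
Proof.
have [E [E1 EE Ex xE]] := primary_idempotents l_inj x_root.
have E_x i k (s : F) : E i *m (x - s%:M) ^+ k = (x - s%:M) ^+ k *m E i.
  rewrite !mulmxE; apply: commrX; apply: commrB; first by rewrite /GRing.comm -!mulmxE Ex.
  by rewrite /GRing.comm -mulmxE scalar_mxC.
have trxE i : \tr (x *m E i) = (\rank (E i))%:R * l i.
  rewrite -mxtrace_idem ?EE ?eqxx // mulrC -mxtraceZ; apply/eqP; rewrite -subr_eq0 -raddfB /=.
  rewrite -mul_scalar_mx -mulmxBl; apply/eqP; apply: (@mxtrace_nilp _ _ _ N.+1).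
  rewrite mulmxE exprMn_comm; last by have := E_x i 1 (l i); rewrite !expr1 => /esym.
  by rewrite !exprS -!mulmxE mulmxA -(mulmxA (x - _)) xE mulmx0 mul0mx.
pose T i j := \sum_k \tr (a k *m (E i *m b k *m E j)).
have trT i : \tr (x *m E i) = \sum_j (T j i - T i j).
  rewrite [x in LHS]x_comm mulmx_suml raddf_sum /= sumrB /T.
  rewrite [X in X - _]exchange_big [X in _ - X]exchange_big /=.
  rewrite -sumrB; apply: eq_bigr => k _.
  rewrite mulmxBl raddfB /=; congr (_ - _).
    rewrite -mulmxA -[b k in LHS]mul1mx -E1 mulmx_suml mulmx_suml mulmx_sumr raddf_sum /=.
    by apply: eq_bigr => j _.
  rewrite -mulmxA mxtrace_mulC -mulmxA -[E i *m b k in LHS]mulmx1 -E1 !mulmx_sumr raddf_sum /=.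
  by apply: eq_bigr => j _.
have lw : forall i, (\rank (E i))%:R * l i = 0.
  apply: (additive_weights_eq0 charF0) => c cP.
  (* The choice of the pair is immaterial because c respects the additive relations; values that are
     not differences of eigenvalues get the default 0. *)
  pose d (t : F) := if [pick p : 'I_m * 'I_m | l p.1 - l p.2 == t] is Some p
                    then c p.2 - c p.1 else 0.
  have dE i j : d (l i - l j) = c j - c i.
    rewrite /d; case: pickP => [p /eqP pE|/(_ (i, j))]; last by rewrite eqxx.
    by rewrite -[LHS]opprB -[RHS]opprB (cP _ _ _ _ pE).
  (* On the block E_i y E_j the operator ad x has generalised eigenvalue [l i - l j]; N factors on
     either side make [N + N] a sufficient exponent. *)
  have [q qP] := poly_interpolation [seq l p.1 - l p.2 | p : 'I_m * 'I_m] (N + N) d.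
  have qE y : poly_act (ad_mx x) q y = \sum_i \sum_j (c j - c i) *: (E i *m y *m E j).
    have qlin := poly_act_linear (ad_mx x) q.
    pose L := GRing.isLinear.Build _ _ _ _ _ qlin.
    pose Q : {linear 'M[F]_n.+1 -> 'M[F]_n.+1} := HB.pack (poly_act (ad_mx x) q) L.
    rewrite -[y in LHS]mul1mx -[1%:M *m y]mulmx1 -E1 mulmx_suml mulmx_suml.
    rewrite -[LHS]/(Q _) linear_sum; apply: eq_bigr => i _.
    rewrite mulmx_sumr linear_sum; apply: eq_bigr => j _ /=; rewrite -dE.
    apply: (@poly_act_eigen _ _ _ _ (l i - l j) _ (N + N)).
      by apply: qP; apply/mapP; exists (i, j); rewrite ?mem_enum.
    apply: (@ad_mx_shift_nilp _ _ _ _ _ _ N N) => //.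
      by rewrite !mulmxA xE !mul0mx.
    by rewrite -!mulmxA E_x xE !mulmx0.
  have: \sum_k \tr (a k *m poly_act (ad_mx x) q (b k)) = 0.
    rewrite big1 // => k _; rewrite mulmx_sumr raddf_sum big1 //= => j _.
    by rewrite -scalemxAr mxtraceZ trab0 mulr0.
  move=> S0; rewrite -[RHS]S0.
  transitivity (\sum_i \sum_j c i * (T j i - T i j)).
    by apply: eq_bigr => i _; rewrite -trxE trT mulr_sumr.
  transitivity (\sum_i \sum_j (c j - c i) * T i j).
    under eq_bigr => i _ do under eq_bigr => j _ do rewrite mulrBr.
    under eq_bigr => i _ do rewrite sumrB.
    rewrite sumrB exchange_big /= -sumrB; apply: eq_bigr => i _.
    by rewrite -sumrB; apply: eq_bigr => j _; rewrite mulrBl.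
  under [RHS]eq_bigr => k _ do rewrite qE mulmx_sumr raddf_sum /=.
  rewrite [RHS]exchange_big; apply: eq_bigr => i _ /=.
  under [RHS]eq_bigr => k _ do rewrite mulmx_sumr raddf_sum /=.
  rewrite [RHS]exchange_big; apply: eq_bigr => j _ /=.
  rewrite mulr_sumr; apply: eq_bigr => k _.
  by rewrite -scalemxAr mxtraceZ.
rewrite -[x ^+ N]mulmx1 -E1 mulmx_sumr big1 // => i _.
have /eqP := lw i; rewrite mulf_eq0 (proj1 (pcharf0P F) charF0) mxrank_eq0.
case/orP=> /eqP E0; first by rewrite E0 mulmx0.
by have := xE i; rewrite E0 raddf0 subr0.
Qed.

End SplitCartan.

Theorem cartan_nilp (F : fieldType) (charF0 : [pchar F] =i pred0) n r
    (x : 'M[F]_n) (a b : 'I_r -> 'M[F]_n) :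
  x = \sum_k (a k *m b k - b k *m a k) ->
  (forall k j, \tr (a k *m iter j (ad_mx x) (b k)) = 0) ->
  exists N, x ^+ N = 0.
Proof.
case: n x a b => [|n] x a b x_comm trab0; first by exists 0; apply/matrixP => -[].
have p0 : char_poly x != 0 by rewrite monic_neq0 ?char_poly_monic.
have [L [f [rs rsE]]] := splitting_field_exists p0.
have charL0 : [pchar L] =i pred0 by move=> p; rewrite (fmorph_pchar f).
(* The number of all roots is a crude bound for every multiplicity, so the characteristic polynomial
   divides the product of the N-th powers over the distinct roots. *)
pose s := undup rs; pose l (i : 'I_(size s)) := s`_i; pose N := size rs.
have l_inj : injective l.
  by move=> i j /eqP; rewrite nth_uniq ?undup_uniq // => /eqP/val_inj.
exists N; apply: (@map_mx_inj _ _ f); rewrite rmorphXn /= map_mx0.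
apply: (@split_cartan_nilp _ charL0 _ _ _ r (map_mx f x) l (map_mx f \o a) (map_mx f \o b)) => //.
- have /eqP : horner_mx (map_mx f x) (map_poly f (char_poly x)) = 0.
    by rewrite map_char_poly Cayley_Hamilton.
  suff /dvdpP[q ->] : map_poly f (char_poly x) %| \prod_i ('X - (l i)%:P) ^+ N.
    by rewrite rmorphM /= => /eqP->; rewrite mulr0.
  rewrite (eqp_dvdl _ rsE).
  have -> : \prod_(i < size s) ('X - (l i)%:P) ^+ N = (\prod_(z <- s) ('X - z%:P)) ^+ N.
    by rewrite prodrXl (big_nth 0) big_mkord.
  rewrite /N; have : {subset rs <= s} by move=> z; rewrite mem_undup.
  elim: (rs) => [|z t IHt] st /=; first by rewrite big_nil dvd1p.
  rewrite big_cons exprS dvdp_mul ?IHt // => [|y yt]; last by rewrite st // inE yt orbT.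
  by rewrite dvdp_XsubCl root_prod_XsubC st ?mem_head.
- by rewrite [x in LHS]x_comm raddf_sum; apply: eq_bigr => k _; rewrite /= map_mxB !map_mxM.
move=> k j; have -> : iter j (ad_mx (map_mx f x)) ((map_mx f \o b) k)
  = map_mx f (iter j (ad_mx x) (b k)).
  by elim: j => //= j ->; rewrite /ad_mx map_mxB !map_mxM.
by rewrite /= -map_mxM trace_map_mx trab0 rmorph0.
Qed.

End CartanLemma.

(** * Subspaces, bilinear maps and quotients *)

Section Subspaces.
Variables (K : fieldType).

(** Comprehension for subspaces, with a possibly undecidable linear condition P: a subspace inside P
    is enlarged by one vector at a time, which must stop at the dimension of W. It yields the
    kernels, stabilisers and orthogonals used below. *)
Lemma exists_vspace (W : vectType K) (P : W -> Prop) :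
  P 0 -> (forall a u v, P u -> P v -> P (a *: u + v)) ->
  exists U : {vspace W}, forall w, w \in U <-> P w.
Proof.
move=> P0 PP.
suff: forall k, exists U : {vspace W}, (forall w, w \in U -> P w) /\
    ((k <= \dim U)%N \/ (forall w, P w -> w \in U)).
  case/(_ (\dim {:W}).+1) => U [UP [/leq_trans/(_ (dimvS (subvf U)))|PU]].
    by rewrite ltnn.
  by exists U => w; split=> [/UP|/PU].
elim=> [|k [U [UP [le_kU|PU]]]].
- by exists 0%VS; split=> [w|]; [rewrite memv0 => /eqP-> | left].
- have [PU|nPU] := classic (forall w, P w -> w \in U).
    by exists U; split=> //; right.
  have [w /(imply_to_and (P w))[Pw /negP wU]] := not_all_ex_not _ _ nPU.
  exists (<[w]> + U)%VS; split=> [z /memv_addP[u /vlineP[a ->] [v /UP Pv ->]]|].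
    exact: PP.
  left; rewrite dimv_disjoint_sum ?dim_vline; last first.
    apply/eqP; rewrite -subv0; apply/subvP=> z /memv_capP[/vlineP[a ->]].
    have [->|a0] := eqVneq a 0; first by rewrite scale0r !mem0v.
    by move=> awU; have := memvZ a^-1 awU; rewrite scalerA mulVf // scale1r (negPf wU).
  have -> : w != 0 by apply: contraNneq wU => ->; apply: mem0v.
  by rewrite add1n ltnS.
- by exists U; split=> //; right.
Qed.

Definition bilin (A B C : lmodType K) (f : A -> B -> C) :=
  (forall y, linear (f^~ y)) /\ (forall x, linear (f x)).

(** With f = [br] and U = T this is convertible to [derived br U]; different source and target
    spaces let it serve for matrix commutators as well. *)
Definition bspan (A B C : vectType K) (f : A -> B -> C) (U : {vspace A}) (T : {vspace B}) :=
  <<[seq f x y | x <- vbasis U, y <- vbasis T]>>%VS.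

Section Bilin.
Variables (A B C : vectType K) (f : A -> B -> C).
Hypothesis f_bilin : bilin f.
Implicit Types (U : {vspace A}) (T : {vspace B}) (Z : {vspace C}).

Lemma bilin0l y : f 0 y = 0.
Proof. by have := f_bilin.1 y (-1) 0 0; rewrite scaler0 addr0 scaleN1r addNr. Qed.
Lemma bilin0r x : f x 0 = 0.
Proof. by have := f_bilin.2 x (-1) 0 0; rewrite scaler0 addr0 scaleN1r addNr. Qed.
Lemma bilinDl x x' y : f (x + x') y = f x y + f x' y.
Proof. by have := f_bilin.1 y 1 x x'; rewrite !scale1r. Qed.
Lemma bilinDr x y y' : f x (y + y') = f x y + f x y'.
Proof. by have := f_bilin.2 x 1 y y'; rewrite !scale1r. Qed.
Lemma bilinZl a x y : f (a *: x) y = a *: f x y.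
Proof. by have := f_bilin.1 y a x 0; rewrite !addr0 bilin0l addr0. Qed.
Lemma bilinZr a x y : f x (a *: y) = a *: f x y.
Proof. by have := f_bilin.2 x a y 0; rewrite !addr0 bilin0r addr0. Qed.
Lemma bilinNl x y : f (- x) y = - f x y.
Proof. by rewrite -scaleN1r bilinZl scaleN1r. Qed.
Lemma bilinNr x y : f x (- y) = - f x y.
Proof. by rewrite -scaleN1r bilinZr scaleN1r. Qed.
Lemma bilinBl x x' y : f (x - x') y = f x y - f x' y.
Proof. by rewrite bilinDl bilinNl. Qed.
Lemma bilinBr x y y' : f x (y - y') = f x y - f x y'.
Proof. by rewrite bilinDr bilinNr. Qed.
Lemma bilin_suml I r (P : pred I) (F : I -> A) y :
  f (\sum_(i <- r | P i) F i) y = \sum_(i <- r | P i) f (F i) y.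
Proof. by apply: (big_morph (f^~ y)) => [u v|]; [apply: bilinDl | apply: bilin0l]. Qed.
Lemma bilin_sumr I r (P : pred I) (F : I -> B) x :
  f x (\sum_(i <- r | P i) F i) = \sum_(i <- r | P i) f x (F i).
Proof. by apply: (big_morph (f x)) => [u v|]; [apply: bilinDr | apply: bilin0r]. Qed.

Lemma memv_bspan U T x y : x \in U -> y \in T -> f x y \in bspan f U T.
Proof.
move=> Ux Ty; rewrite (coord_vbasis Ux) (coord_vbasis Ty) bilin_suml memv_suml // => i _.
rewrite bilin_sumr memv_suml // => j _; rewrite bilinZl bilinZr !memvZ //.
by apply: memv_span; apply: allpairs_f; apply: mem_nth; rewrite size_tuple.
Qed.

Lemma bspanP U T Z : reflect (forall x y, x \in U -> y \in T -> f x y \in Z) (bspan f U T <= Z)%VS.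
Proof.
apply: (iffP idP) => [/subvP sZ x y Ux Ty|fZ]; first exact/sZ/memv_bspan.
by apply/span_subvP => _ /allpairsP[[x y] /= [/vbasis_mem xU /vbasis_mem yT ->]]; apply: fZ.
Qed.

Lemma bspanS U U' T T' : (U <= U')%VS -> (T <= T')%VS -> (bspan f U T <= bspan f U' T')%VS.
Proof. by move=> /subvP sU /subvP sT; apply/bspanP=> x y /sU xU /sT yT; apply: memv_bspan. Qed.

Lemma bspan_ind U T (P : C -> Prop) :
  P 0 -> (forall a u v, P u -> P v -> P (a *: u + v)) ->
  (forall x y, x \in U -> y \in T -> P (f x y)) ->
  forall z, z \in bspan f U T -> P z.
Proof.
move=> P0 PP Pf z; have [Z ZP] := exists_vspace P0 PP.
have /subvP sZ : (bspan f U T <= Z)%VS by apply/bspanP=> x y xU yT; apply/ZP/Pf.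
by move/sZ/ZP.
Qed.

End Bilin.

(* Quotient coordinates: [pi] identifies C / A with a space of row vectors, and
   [iota] is a linear section of it. *)
Lemma exists_quotient (W : vectType K) (A C : {vspace W}) : (A <= C)%VS ->
  exists n (pi : 'Hom(W, 'rV[K]_n)) (iota : 'Hom('rV[K]_n, W)),
  [/\ (forall r, iota r \in C), (forall r, pi (iota r) = r),
      (forall w, w \in C -> (pi w = 0 <-> w \in A)) &
      (forall w, w \in C -> w - iota (pi w) \in A)] /\ n = (\dim C - \dim A)%N.
Proof.
move=> sAC; pose D := (C :\: A)%VS; pose b := vbasis D.
have DA0 : (D :&: A = 0)%VS by apply: capv_diff.
have DA : (D + A = C)%VS by rewrite addv_diff; apply/addv_idPl.
pose pr := daddv_pi D A.
pose pf (w : W) : 'rV[K]_(\dim D) := \row_i coord b i (pr w).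
have pf_lin : linear pf by move=> a u v; apply/rowP => i; rewrite !mxE !linearP.
pose jf (r : 'rV[K]_(\dim D)) : W := \sum_i r 0 i *: b`_i.
have jf_lin : linear jf.
  move=> a u v; rewrite /jf scaler_sumr -big_split; apply: eq_bigr => i _ /=.
  by rewrite !mxE scalerA scalerDl.
pose pL := GRing.isLinear.Build _ _ _ _ _ pf_lin.
pose jL := GRing.isLinear.Build _ _ _ _ _ jf_lin.
pose p : {linear W -> 'rV[K]_(\dim D)} := HB.pack pf pL.
pose j : {linear 'rV[K]_(\dim D) -> W} := HB.pack jf jL.
have jD r : jf r \in D.
  by apply: memv_suml => i _; apply/memvZ/vbasis_mem/mem_nth; rewrite size_tuple.
have pj w : jf (pf w) = pr w.
  rewrite [RHS](coord_vbasis (memv_pi D A w)).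
  by apply: eq_bigr => i _; rewrite mxE.
have pA w : w \in C -> w - pr w \in A.
  rewrite -DA => wC; rewrite -{1}(daddv_pi_add DA0 wC) addrAC subrr add0r.
  exact: memv_pi.
exists (\dim D), (linfun p), (linfun j); split; last first.
  by have := dimv_disjoint_sum DA0; rewrite DA => ->; rewrite addnK.
split=> [r|r|w wC|w wC]; rewrite ?lfunE /=.
- by rewrite -DA; apply: (subvP (addvSl _ _)).
- rewrite ?lfunE; apply/rowP => i; rewrite mxE /pr daddv_pi_id ?jD //.
  by rewrite coord_sum_free // (basis_free (vbasisP D)).
- have prA : w \in A -> pr w = 0.
    move=> wA; apply/eqP; rewrite -memv0 -DA0 memv_cap memv_pi /=.
    by rewrite -[pr w](subKr w) memvB ?pA.
  split=> [p0|/prA w0]; last first.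
    by apply/rowP=> i; rewrite !mxE w0 linear0.
  by have := pA w wC; rewrite -pj p0 (linear0 j : jf 0 = 0) subr0.
- by rewrite ?lfunE pj pA.
Qed.

End Subspaces.

(** * Engel's theorem *)

Section Engel.
Variables (K : fieldType) (A : falgType K).
Implicit Types (H L U : {vspace A}) (x y h : A).

Definition lie_closed L := forall x y, x \in L -> y \in L -> x * y - y * x \in L.

(** Let D be the unital associative algebra generated by H and x. As x normalises H, the space H D
    is a two-sided ideal of D whose k-th power lies in H^k D, so its N-th power is 0. Modulo H D,
    the k-th power of H + K x is spanned by x^k, so its n-th power lies in H D. *)
Lemma engel_step H x N n : lie_closed H -> (forall h, h \in H -> x * h - h * x \in H) ->
  (H ^+ N = 0)%VS -> x ^+ n = 0 -> ((H + <[x]>) ^+ (n * N) = 0)%VS.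
Proof.
move=> Hcl xH HN0 xn0; set H' := (H + <[x]>)%VS; pose D := agenv H'.
have sHD : (H <= D)%VS by apply: subv_trans (sub_agenv _); apply: addvSl.
have xD : x \in D by apply: (subvP (sub_agenv _)); apply: (subvP (addvSr _ _)); apply: memv_line.
have DD : (D * D)%VS = D := agenvM _.
have sub1D : (1 <= D)%VS := sub1_agenv _.
have sH_HD : (H <= H * D)%VS by rewrite -[X in (X <= _)%VS]prodv1 prodvSr.
have DHD : (D * (H * D) <= H * D)%VS.
  apply: agenv_modl; rewrite prodvDl subv_add; apply/andP; split.
    by rewrite prodvSr // -[X in (_ <= X)%VS]DD prodvS.
  rewrite prodvA -{2}DD prodvA; apply: prodvSl; apply/prodvP=> _ h /vlineP[a ->] hH.
  rewrite -scalerAl memvZ // -[x * h](subrK (h * x)) memvD //.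
    exact/(subvP sH_HD)/xH.
  exact: memv_mul.
have xkD k : x ^+ k \in D.
  elim: k => [|k IHk]; first by rewrite expr0 memvE.
  by rewrite exprS -DD memv_mul.
have HDk k : ((H * D) ^+ k.+1 <= H ^+ k.+1 * D)%VS.
  elim: k => [|k IHk]; first by rewrite !expv1.
  rewrite expvSr (subv_trans (prodvSl _ IHk)) // [X in (_ <= X * _)%VS]expvSr -!prodvA.
  by apply: prodvSr.
have HD0 : ((H * D) ^+ N = 0)%VS.
  case: N HN0 => [|k] HN0; first by rewrite !expv0 in HN0 *.
  by apply/eqP; rewrite -subv0 -(prod0v D) -HN0.
have H'k k : (H' ^+ k <= <[x ^+ k]> + H * D)%VS.
  elim: k => [|k IHk].
    by rewrite expv0 expr0; apply: subv_trans (addvSl _ _); rewrite subvv.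
  rewrite expvSl (subv_trans (prodvSr _ IHk)) // prodvDl !prodvDr !subv_add -!andbA.
  apply/and4P; split.
  - apply: subv_trans (addvSr _ _); apply: prodvSr; rewrite -memvE.
    exact: xkD.
  - apply: subv_trans (addvSr _ _); apply: prodvSr.
    by rewrite -[X in (_ <= X)%VS]DD prodvSl.
  - by rewrite prodv_line -exprS addvSl.
  - apply: subv_trans (addvSr _ _); apply: subv_trans DHD; apply: prodvSl.
    by rewrite -memvE.
apply/eqP; rewrite -subv0 expvM -HD0; apply: expvS.
by have := H'k n; rewrite xn0 add0v.
Qed.

(** Nilpotency is that of associative powers. A Lie subalgebra H with vanishing power is enlarged by
    an element of L normalising it, until it is L; [d] counts the dimension reached. *)
Theorem engel L : lie_closed L -> (forall x, x \in L -> exists n, x ^+ n = 0) ->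
  exists N, (L ^+ N = 0)%VS.
Proof.
move=> Lcl Lnil.
suff: forall d, exists H N, [/\ (H <= L)%VS, lie_closed H, (H ^+ N = 0)%VS &
    (d <= \dim H)%N \/ H = L].
  case/(_ (\dim L).+1) => H [N [sHL _ HN0 [leLH|<-]]]; last by exists N.
  by have := leq_trans leLH (dimvS sHL); rewrite ltnn.
elim=> [|d [H [N [sHL Hcl HN0 [le_dH|HL]]]]].
- exists 0%VS, 1%N; split; rewrite ?sub0v ?expv1 //; last by left.
  by move=> x y; rewrite !memv0 => /eqP-> /eqP->; rewrite mulr0 subrr.
- have [HL|neHL] := eqVneq H L.
    by exists H, N; split=> //; right.
  pose br x y := x * y - y * x.
  have br_bilin : bilin br.
    split=> [y|x] a u v; rewrite /br.
      by rewrite mulrDl mulrDr -!scalerAl -scalerAr scalerBr opprD addrACA.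
    by rewrite mulrDl mulrDr -!scalerAl -scalerAr scalerBr opprD addrACA.
  (* The k-fold brackets of H with L lie in the sum of the H^i L H^(k-i), which is 0 for k = 2N
     because one exponent is at least N. An element of the last [M k] not inside H normalises H. *)
  pose M k := iter k (bspan br H) L.
  pose B k := (\sum_(i < k.+1) H ^+ i * L * H ^+ (k - i))%VS.
  have MB k : (M k <= B k)%VS.
    elim: k => [|k IHk]; first by rewrite /B big_ord1 /= subnn !expv0 prod1v prodv1.
    apply: (subv_trans (bspanS br_bilin (subvv H) IHk)).
    have HB : (H * B k <= B k.+1)%VS.
      rewrite /B big_distrr /=; apply/subv_sumP => i _.
      rewrite !prodvA -expvSl; apply: (sumv_sup (lift ord0 i)) => //.
    have BH : (B k * H <= B k.+1)%VS.
      rewrite /B big_distrl /=; apply/subv_sumP => i _.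
      rewrite -!prodvA -expvSr prodvA; apply: (sumv_sup (widen_ord (leqnSn _) i)) => //=.
      by rewrite subSn // -ltnS.
    apply/bspanP => // h b hH bB; rewrite memvB //.
      exact/(subvP HB)/memv_mul.
    exact/(subvP BH)/memv_mul.
  have B0 : B (N + N)%N = 0%VS.
    apply/eqP; rewrite -subv0; apply/subv_sumP => i _.
    have H0 k : (N <= k)%N -> (H ^+ k = 0)%VS.
      by move=> le_Nk; rewrite -(subnK le_Nk) expvD HN0 prodv0.
    have [leNi|ltiN] := leqP N i; first by rewrite H0 // !prod0v.
    by rewrite (H0 (N + N - i)%N) ?prodv0 //; lia.
  have [k [nMk MkH]] : exists k, ~~ (M k <= H)%VS /\ (M k.+1 <= H)%VS.
    have exM : exists k, (M k <= H)%VS.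
      by exists (N + N)%N; apply: subv_trans (MB _) _; rewrite B0 sub0v.
    have [[|k] MkH kmin] := ex_minnP exM.
      by case/eqP: neHL; apply: subv_anti; rewrite sHL; apply: MkH.
    by exists k; split=> //; apply/negP => /kmin; rewrite ltnn.
  have ML j : (M j <= L)%VS.
    elim: j => // j IHj; apply/bspanP => // h y /(subvP sHL) hL /(subvP IHj) yL.
    exact: Lcl.
  have /subvPn[x xM xH] := nMk; have xL := subvP (ML k) _ xM.
  have brHx h : h \in H -> br h x \in H.
    by move=> hH; apply/(subvP MkH)/memv_bspan.
  have xbrH h : h \in H -> x * h - h * x \in H.
    by move=> /brHx; rewrite -memvN opprB.
  have [n xn0] := Lnil x xL.
  exists (H + <[x]>)%VS, (n * N)%N; split.
  - by rewrite subv_add sHL -memvE.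
  - have sHH' : {subset H <= (H + <[x]>)%VS} by apply/subvP/addvSl.
    move=> _ _ /memv_addP[h hH [_ /vlineP[a ->] ->]] /memv_addP[h' hH' [_ /vlineP[a' ->] ->]].
    apply: sHH'; rewrite -/(br _ _) (bilinDl br_bilin) !(bilinDr br_bilin).
    rewrite !(bilinZl br_bilin) !(bilinZr br_bilin).
    rewrite [br x x]subrr !scaler0 addr0.
    by apply: memvD; [apply: memvD; [apply: Hcl | apply/memvZ/brHx] | apply/memvZ/xbrH].
  - exact: engel_step xn0.
  - left; rewrite dimv_disjoint_sum ?dim_vline.
      have -> : x != 0 by apply: contraNneq xH => ->; apply: mem0v.
      by rewrite addn1 ltnS.
    apply/eqP; rewrite -subv0; apply/subvP=> z /memv_capP[zH /vlineP[a za]].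
    move: zH; rewrite za; have [->|a0] := eqVneq a 0; first by rewrite scale0r !mem0v.
    by move=> axH; have := memvZ a^-1 axH; rewrite scalerA mulVf // scale1r (negPf xH).
- by exists H, N; split=> //; right.
Qed.

Lemma perfect_nil_eq0 L : lie_closed L -> (forall x, x \in L -> exists n, x ^+ n = 0) ->
  (L <= L * L)%VS -> L = 0%VS.
Proof.
move=> Lcl Lnil LL; have [N LN0] := engel Lcl Lnil; apply/eqP; rewrite -subv0 -LN0.
have Lk k : (L <= L ^+ k.+1)%VS.
  elim: k => // k IHk; apply: subv_trans LL _; rewrite expvSl.
  exact: prodvSr.
case: N LN0 => [|N] LN0; last exact: Lk.
by case/eqP: (vspace1_neq0 A).
Qed.

End Engel.

(** * Trace forms *)

Section MatrixLie.
Variables (K : fieldType) (charK0 : [pchar K] =i pred0).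

Lemma ad_mx_bilin n : bilin (@ad_mx K n).
Proof.
split=> [y|x] a u v; rewrite /ad_mx.
  by rewrite mulmxDl mulmxDr -!scalemxAl -scalemxAr scalerBr opprD addrACA.
by rewrite mulmxDl mulmxDr -!scalemxAl -scalemxAr scalerBr opprD addrACA.
Qed.

Lemma span_allpairs_sum (A B C : vectType K) (f : A -> B -> C) U T (z : C) :
  bilin f -> z \in bspan f U T ->
  exists r (a : 'I_r -> A) (b : 'I_r -> B),
    (forall i, a i \in U /\ b i \in T) /\ z = \sum_i f (a i) (b i).
Proof.
move=> f_bilin; move: z; apply: (bspan_ind f_bilin) => [|c u v|x y xU yT].
- exists 0%N, (fun _ => 0), (fun _ => 0); split; first by case.
  by rewrite big_ord0.
- move=> [r [a [b [ab ->]]]] [s [a' [b' [ab' ->]]]].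
  exists (r + s)%N, (fun i => match split i with inl j => c *: a j | inr j => a' j end),
    (fun i => match split i with inl j => b j | inr j => b' j end); split=> [i|].
    case: (split i) => j; last exact: ab'.
    by have [aU bT] := ab j; rewrite memvZ.
  rewrite big_split_ord /= scaler_sumr; congr (_ + _); apply: eq_bigr => i _.
    by rewrite (unsplitK (inl i)) (bilinZl f_bilin).
  by rewrite (unsplitK (inr i)).
- by exists 1%N, (fun=> x), (fun=> y); rewrite big_ord1.
Qed.

(** Perfectness is used twice: to write elements as sums of commutators for Cartan's lemma, and to
    get L inside L L, which contradicts the nilpotency given by Engel unless L = 0. *)
Lemma perfect_trace0 n (L : {vspace 'M[K]_n}) :
  (forall x y, x \in L -> y \in L -> ad_mx x y \in L) ->
  (L <= bspan (@ad_mx K n) L L)%VS ->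
  (forall x y, x \in L -> y \in L -> \tr (x *m y) = 0) -> L = 0%VS.
Proof.
case: n L => [|n] L Lcl Lperf Ltr0.
  apply/eqP; rewrite -subv0; apply/subvP=> x _.
  by rewrite memv0; apply/eqP/matrixP => -[].
apply: perfect_nil_eq0 => [x y|x xL|]; first exact: Lcl.
  have [r [a [b [abL xE]]]] := span_allpairs_sum (ad_mx_bilin _) (subvP Lperf _ xL).
  apply: (cartan_nilp charK0 (a := a) (b := b) xE) => k j; apply: Ltr0; first by case: (abL k).
  by elim: j => [|j IHj] /=; [case: (abL k) | apply: Lcl].
apply: subv_trans Lperf _; apply/bspanP; first exact: ad_mx_bilin.
by move=> x y xL yL; apply: memvB; apply: memv_mul.
Qed.

(** A nonzero row of a matrix in the last nonzero power of L. *)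
Lemma engel_row n (L : {vspace 'M[K]_n}) : (0 < n)%N ->
  (forall x y, x \in L -> y \in L -> ad_mx x y \in L) ->
  (forall x, x \in L -> exists N, x ^+ N = 0) ->
  exists2 r : 'rV[K]_n, r != 0 & forall x, x \in L -> r *m x = 0.
Proof.
case: n L => // n L _ Lcl Lnil; have [N LN0] := engel Lcl Lnil.
have exN : exists N, (L ^+ N == 0)%VS by exists N; rewrite LN0.
have [[|k] /eqP Lk0 kmin] := ex_minnP exN; first by case/eqP: (vspace1_neq0 'M[K]_n.+1).
have: (L ^+ k != 0)%VS by apply/negP => /kmin; rewrite ltnn.
rewrite -subv0 => /subvPn[w wL]; rewrite memv0 => w0.
have [i wi] : exists i, row i w != 0.
  apply/existsP; apply: contraNT w0; rewrite negb_exists => /forallP w0.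
  by apply/eqP/row_matrixP => i; rewrite row0; apply/eqP; rewrite -[_ == _]negbK.
exists (row i w) => // x xL; rewrite -row_mul.
have -> : w *m x = 0; last by rewrite row0.
by apply/eqP; rewrite -memv0 -Lk0 expvSr memv_mul.
Qed.

End MatrixLie.

(** * Lie algebras, their representations and trace forms *)

Section LieAlgebra.
Variables (K : fieldType) (charK0 : [pchar K] =i pred0).
Variables (V : vectType K) (br : V -> V -> V) (br_lie : lie_bracket br).
Implicit Types (I J U : {vspace V}).

Lemma lie_bilin : bilin br.
Proof.
have [[brl brr] _ _] := br_lie.
by split=> [y|x] a u v; [apply: brl | apply: brr]; apply: memvf.
Qed.

Lemma lie_xx x : br x x = 0. Proof. by have [_ ->] := br_lie. Qed.

Lemma lie_anti x y : br x y = - br y x.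
Proof.
apply/eqP; rewrite -addr_eq0; have := lie_xx (x + y).
by rewrite (bilinDl lie_bilin) !(bilinDr lie_bilin) !lie_xx add0r addr0 => ->.
Qed.

Lemma lie_jacobi x y z : br x (br y z) = br (br x y) z - br (br x z) y.
Proof.
have [_ _ jac] := br_lie; have /eqP := jac x y z.
rewrite -addrA addr_eq0 => /eqP->; rewrite opprD.
by rewrite (lie_anti y) (lie_anti z (br x y)) !opprK (lie_anti z x) (bilinNl lie_bilin) addrC.
Qed.

Lemma ideal_r I x y : is_ideal br I -> x \in I -> br x y \in I.
Proof. by move=> idI xI; rewrite lie_anti memvN; apply: idI. Qed.

Lemma ideal_bspan I J : is_ideal br I -> is_ideal br J -> is_ideal br (bspan br I J).
Proof.
move=> idI idJ x z; move: z.
apply: (bspan_ind lie_bilin) => [|a u v uI vI|u v uI vJ].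
- by rewrite (bilin0r lie_bilin) mem0v.
- by rewrite (bilinDr lie_bilin) (bilinZr lie_bilin) memvD ?memvZ.
- rewrite lie_jacobi memvB //; first exact: (memv_bspan lie_bilin) (idI _ _ uI) vJ.
  rewrite lie_anti memvN.
  exact: (memv_bspan lie_bilin) uI (idJ _ _ vJ).
Qed.

(** For row vectors with right multiplication this is the rule satisfied by the right adjoint action
    u |-> [br u x], as [lie_jacobi] shows. *)
Definition lie_rep n (rho : 'Hom(V, 'M[K]_n)) :=
  forall x y, rho (br x y) = ad_mx (rho x) (rho y).

(** Only the image of J has to be perfect: J itself may be perfect merely modulo an ideal killed by
    [rho]. *)
Lemma rep_trace0 n (rho : 'Hom(V, 'M[K]_n)) J : lie_rep rho ->
  (forall x y, x \in J -> y \in J -> br x y \in J) ->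
  (forall x, x \in J -> rho x \in (rho @: bspan br J J)%VS) ->
  (forall x y, x \in J -> y \in J -> \tr (rho x *m rho y) = 0) ->
  forall x, x \in J -> rho x = 0.
Proof.
move=> rhoM Jcl Jperf Jtr x xJ; pose L := (rho @: J)%VS.
suff L0 : L = 0%VS by apply/eqP; rewrite -memv0 -L0 memv_img.
apply: (perfect_trace0 charK0) => [_ _ /memv_imgP[u uJ ->] /memv_imgP[v vJ ->]||].
- by rewrite -rhoM memv_img ?Jcl.
- apply/subvP => _ /memv_imgP[u uJ ->]; move: (Jperf u uJ).
  case/memv_imgP => w wJ ->; move: w wJ; apply: (bspan_ind lie_bilin) => [|a y z|y z yJ zJ].
  + by rewrite linear0 mem0v.
  + by rewrite linearP => uL vL; rewrite memvD ?memvZ.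
  + by rewrite rhoM; apply: (memv_bspan (ad_mx_bilin K n)); apply: memv_img.
- by move=> _ _ /memv_imgP[u uJ ->] /memv_imgP[v vJ ->]; apply: Jtr.
Qed.

Lemma trace_form_inv n (rho : 'Hom(V, 'M[K]_n)) x y z : lie_rep rho ->
  \tr (rho (br x y) *m rho z) = \tr (rho x *m rho (br y z)).
Proof.
move=> rhoM; rewrite !rhoM /ad_mx mulmxBl mulmxBr !raddfB /= !mulmxA; congr (_ - _).
by rewrite -[in LHS]mulmxA mxtrace_mulC.
Qed.

Lemma trace_form_radical n (rho : 'Hom(V, 'M[K]_n)) J : lie_rep rho -> is_ideal br J ->
  exists2 U, is_ideal br U &
    forall x, x \in U <-> forall y, y \in J -> \tr (rho x *m rho y) = 0.
Proof.
move=> rhoM idJ.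
have [||U UP] := @exists_vspace K V (fun x => forall y, y \in J -> \tr (rho x *m rho y) = 0).
- by move=> y _; rewrite linear0 mul0mx mxtrace0.
- move=> a u v u0 v0 y yJ.
  by rewrite linearP mulmxDl -scalemxAl mxtraceD mxtraceZ u0 // v0 // mulr0 addr0.
exists U => // x y /UP y0; apply/UP=> z zJ.
by rewrite lie_anti linearN mulNmx raddfN /= trace_form_inv // y0 ?oppr0 ?idJ.
Qed.

End LieAlgebra.

(** * Vanishing of the first cohomology *)

Lemma exists_lfun (K : fieldType) (A B : vectType K) (f : A -> B) :
  linear f -> exists g : 'Hom(A, B), forall x, g x = f x.
Proof.
move=> f_lin; pose fL := GRing.isLinear.Build _ _ _ _ _ f_lin.
pose g : {linear A -> B} := HB.pack f fL.
by exists (linfun g) => x; rewrite lfunE.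
Qed.

(** * Representations on subquotients *)

Section Subquotient.
Variables (K : fieldType) (V : vectType K) (br : V -> V -> V).

(** [act] has to be a representation only on C and modulo A. This generality is needed for actions
    on End(V), which are multiplicative only up to such an error. *)
Lemma subquotient_rep (W : vectType K) (A C : {vspace W}) (act : W -> V -> W) :
  bilin act -> (A <= C)%VS ->
  (forall w x, w \in C -> act w x \in C) -> (forall w x, w \in A -> act w x \in A) ->
  (forall w x y, w \in C -> act w (br x y) - (act (act w x) y - act (act w y) x) \in A) ->
  exists n (pi : 'Hom(W, 'rV[K]_n)) (iota : 'Hom('rV[K]_n, W)) (rho : 'Hom(V, 'M[K]_n)),
  [/\ [/\ (forall r, iota r \in C), (forall r, pi (iota r) = r),
       (forall w, w \in C -> (pi w = 0 <-> w \in A)) &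
       (forall w, w \in C -> w - iota (pi w) \in A)],
      n = (\dim C - \dim A)%N, lie_rep br rho &
      forall w x, w \in C -> pi (act w x) = pi w *m rho x].
Proof.
move=> act_b sAC actC actA actM.
have [n [pi [iota [[iotaC piK piA iotaK] nE]]]] := exists_quotient sAC.
have [rho rhoE] : exists rho : 'Hom(V, 'M[K]_n), forall x,
    rho x = \matrix_i pi (act (iota (delta_mx 0 i)) x).
  apply: exists_lfun => a x y; apply/row_matrixP => i.
  by rewrite linearP /= !rowK act_b.2 linearP.
have piB w w' : w \in C -> w' \in C -> w - w' \in A -> pi w = pi w'.
  move=> wC w'C wA; apply/eqP; rewrite -subr_eq0 -linearB; apply/eqP/piA => //.
  exact: memvB.
have rhoP w x : w \in C -> pi (act w x) = pi w *m rho x.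
  move=> wC; transitivity (pi (act (iota (pi w)) x)).
    by apply: piB; rewrite ?actC // -(bilinBl act_b) actA // iotaK.
  rewrite {1}(row_sum_delta (pi w)) linear_sum (bilin_suml act_b) linear_sum.
  rewrite mulmx_sum_row; apply: eq_bigr => i _.
  by rewrite linearZ (bilinZl act_b) linearZ rhoE rowK.
exists n, pi, iota, rho; split=> // x y; apply/row_matrixP => i; rewrite !rowE.
set r := delta_mx 0 i; have rC : iota r \in C by [].
rewrite -(piK r) -rhoP // /ad_mx mulmxBr !mulmxA -!rhoP ?actC // -linearB.
by apply: piB; [apply: actC | apply: memvB; apply/actC/actC | apply: actM].
Qed.

End Subquotient.

Section Vanishing.
Variables (K : fieldType) (charK0 : [pchar K] =i pred0).
Variables (V : vectType K) (br : V -> V -> V) (br_lie : lie_bracket br).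
Variable R : {vspace V}.
Hypotheses (idR : is_ideal br R) (R_proper : R != fullv)
  (R_max : forall U, is_ideal br U -> (R <= U)%VS -> U = R \/ U = fullv)
  (br_perfect : bspan br fullv fullv = fullv).

(** The substitute for simplicity of g / R: the radical of the trace form is an ideal containing R,
    hence R or everything, and in the second case Cartan's criterion makes the perfect algebra g act
    by 0. *)
Lemma rep_radical n (rho : 'Hom(V, 'M[K]_n)) : lie_rep br rho ->
  (forall x, x \in R -> rho x = 0) ->
  (forall x, rho x = 0) \/
  (forall x, (forall y, \tr (rho x *m rho y) = 0) -> x \in R).
Proof.
move=> rhoM rhoR.
have idf : is_ideal br fullv by move=> *; apply: memvf.
have [U idU UP] := trace_form_radical br_lie rhoM idf.
have sRU : (R <= U)%VS.
  by apply/subvP=> x xR; apply/UP => y _; rewrite rhoR // mul0mx mxtrace0.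
case: (R_max idU sRU) => [defU|Uf]; [right => x x0|left => x].
  by rewrite -defU; apply/UP.
apply: (rep_trace0 charK0 br_lie rhoM (J := fullv)) => [u v _ _|u _|u v _ _|].
- exact: memvf.
- by rewrite br_perfect memv_img ?memvf.
- by have /UP u0 : u \in U; [rewrite Uf memvf | apply: u0; apply: memvf].
- exact: memvf.
Qed.

(** The Casimir matrix of the trace form on g / R, formed with the lifts [b i] of a basis. Its trace
    is the dimension d > 0 of g / R, nonzero in characteristic 0; it kills invariant columns because
    each of its terms ends in some [B j]. *)
Lemma casimir n (rho : 'Hom(V, 'M[K]_n)) : lie_rep br rho ->
  (forall x, x \in R -> rho x = 0) ->
  (forall x, (forall y, \tr (rho x *m rho y) = 0) -> x \in R) ->
  exists c : 'M[K]_n, [/\ (forall x, c *m rho x = rho x *m c), \tr c != 0 &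
    forall f : 'cV[K]_n, (forall x, rho x *m f = 0) -> c *m f = 0].
Proof.
move=> rhoM rhoR radR.
have [d [pi [iota [[_ piK piR iotaK] dE]]]] := exists_quotient (subvf R).
have d_gt0 : (0 < d)%N.
  rewrite dE subn_gt0 ltn_neqAle dimvS ?subvf // andbT.
  by apply: contraNneq R_proper => dR; rewrite eqEdim subvf dR leqnn.
pose b (i : 'I_d) := iota (delta_mx 0 i).
pose B i := rho (b i).
have rhoE x : rho x = \sum_i pi x 0 i *: B i.
  have : rho (x - iota (pi x)) = 0 by rewrite rhoR // iotaK ?memvf.
  rewrite linearB => /eqP; rewrite subr_eq0 => /eqP->.
  rewrite {1}(row_sum_delta (pi x)) !linear_sum; apply: eq_bigr => i _.
  by rewrite !linearZ.
pose G := \matrix_(i, j) \tr (B i *m B j).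
(* A row in the kernel of the Gram matrix lifts to an element orthogonal to all of g, hence in R, so
   the row is 0. *)
have Gunit : G \in unitmx.
  rewrite -row_free_unit; apply/row_freeP; exists (invmx G); apply: mulmxV.
  rewrite -row_free_unit -kermx_eq0; apply/eqP/row_matrixP => i; rewrite row0.
  set r := row i _; have rG : r *m G = 0 by apply/sub_kermxP; apply: row_sub.
  rewrite -(piK r); apply/piR; rewrite ?memvf //; apply: radR => y.
  have -> : rho (iota r) = \sum_i r 0 i *: B i by rewrite rhoE piK.
  rewrite (rhoE y) mulmx_sumr raddf_sum big1 //= => j _.
  rewrite -scalemxAr mxtraceZ mulmx_suml raddf_sum /=.
  have /matrixP/(_ 0 j) := rG; rewrite !mxE => rG0.
  apply/eqP; rewrite mulf_eq0; apply/orP; right; apply/eqP; rewrite -[RHS]rG0.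
  by apply: eq_bigr => k _; rewrite -scalemxAl mxtraceZ [G _ _]mxE.
pose H := invmx G.
pose S (M : 'M[K]_d) := \sum_i \sum_j M i j *: (B i *m B j).
exists (S H); split=> [x||f rf].
- apply/eqP; rewrite -subr_eq0; apply/eqP.
  pose X := \matrix_(i, k) pi (br (b i) x) 0 k.
  have BX i : ad_mx (B i) (rho x) = \sum_k X i k *: B k.
    by rewrite -rhoM rhoE; apply: eq_bigr => k _; rewrite mxE.
  (* X is the matrix of the bracket with x on g / R, and this identity is the invariance of the
     trace form. With H inverse to G it becomes X^T H + H X = 0, and the commutator of the Casimir
     matrix with [rho x] is S(X^T H + H X). *)
  have GX : G *m X^T = - (X *m G).
    apply/matrixP => i j; rewrite !mxE.
    transitivity (\tr (B i *m rho (br (b j) x))).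
      rewrite rhoM BX mulmx_sumr raddf_sum; apply: eq_bigr => k _ /=.
      by rewrite -scalemxAr mxtraceZ !mxE mulrC.
    rewrite (lie_anti br_lie) linearN mulmxN raddfN /= -trace_form_inv //; congr (- _).
    rewrite rhoM BX mulmx_suml raddf_sum; apply: eq_bigr => k _ /=.
    by rewrite -scalemxAl mxtraceZ !mxE.
  have HX : X^T *m H + H *m X = 0.
    rewrite -[X^T](mulKmx Gunit) -/H GX mulmxN mulNmx -!mulmxA mulmxV // mulmx1.
    exact: addNr.
  transitivity (S (X^T *m H + H *m X)); last first.
    by rewrite HX /S big1 // => i _; rewrite big1 // => j _; rewrite mxE scale0r.
  rewrite /S mulmx_suml mulmx_sumr -sumrB.
  transitivity (\sum_i \sum_j (H i j *: (ad_mx (B i) (rho x) *m B j)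
                               + H i j *: (B i *m ad_mx (B j) (rho x)))).
    apply: eq_bigr => i _; rewrite mulmx_suml mulmx_sumr -sumrB; apply: eq_bigr => j _.
    rewrite -scalemxAl -scalemxAr -scalerBr -scalerDr; congr (_ *: _).
    by rewrite /ad_mx mulmxBl mulmxBr !mulmxA [RHS]addrC addrA subrK.
  under eq_bigr => i _ do rewrite big_split /=.
  rewrite big_split /=.
  under [RHS]eq_bigr => i _ do under eq_bigr => j _ do rewrite mxE scalerDl.
  under [RHS]eq_bigr => i _ do rewrite big_split /=.
  rewrite big_split /=; congr (_ + _).
    rewrite exchange_big [RHS]exchange_big /=; apply: eq_bigr => j _.
    under [RHS]eq_bigr => i _ do rewrite mxE scaler_suml.
    rewrite [RHS]exchange_big /=; apply: eq_bigr => i _.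
    rewrite BX mulmx_suml scaler_sumr; apply: eq_bigr => k _.
    by rewrite -scalemxAl scalerA !mxE mulrC.
  apply: eq_bigr => i _.
  under [RHS]eq_bigr => j _ do rewrite mxE scaler_suml.
  rewrite [RHS]exchange_big /=; apply: eq_bigr => j _.
  rewrite BX mulmx_sumr scaler_sumr; apply: eq_bigr => k _.
  by rewrite -scalemxAr scalerA.
- have -> : \tr (S H) = \tr (H *m G).
    rewrite /S raddf_sum; apply: eq_bigr => i _; rewrite raddf_sum mxE /=.
    by apply: eq_bigr => j _; rewrite mxtraceZ mxE mxtrace_mulC.
  by rewrite mulVmx // mxtrace1 (proj1 (pcharf0P K) charK0) -lt0n.
rewrite /S mulmx_suml big1 // => i _; rewrite mulmx_suml big1 // => j _.
by rewrite -scalemxAl -mulmxA rf mulmx0 scaler0.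
Qed.

(** Weyl's theorem in dual form: the invariant column f does not vanish on all invariant rows.
    Unless g acts by 0, the generalised kernel Z of the Casimir matrix is a proper submodule because
    the trace is nonzero, and f is still nonzero on Z because f is fixed by a projection onto Z. An
    invariant row found in Z by induction serves. *)
Lemma invariant_pairing n (rho : 'Hom(V, 'M[K]_n)) (f : 'cV[K]_n) : lie_rep br rho ->
  (forall x, x \in R -> rho x = 0) -> f != 0 -> (forall x, rho x *m f = 0) ->
  exists e : 'rV[K]_n, e *m f != 0 /\ forall x, e *m rho x = 0.
Proof.
have [m] := ubnP n; elim: m n rho f => // m IHm n rho f lt_n rhoM rhoR f0 rf.
case: (rep_radical rhoM rhoR) => [rho0|radR].
  have [i fi] : exists i, f i 0 != 0.
    apply/existsP; apply: contraNT f0; rewrite negb_exists => /forallP fi.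
    by apply/eqP/matrixP => i j; rewrite ord1 mxE; apply/eqP; rewrite -[_ == _]negbK.
  exists (delta_mx 0 i); split=> [|x]; last by rewrite rho0 mulmx0.
  apply: contraNneq fi => /matrixP/(_ 0 0); rewrite -rowE mxE [RHS]mxE => ->.
  by rewrite eqxx.
have [c [c_comm trc cf]] := casimir rhoM rhoR radR.
case: n => [|n] in rho f lt_n rhoM rhoR f0 rf radR c c_comm trc cf *.
  by case/eqP: f0; apply/matrixP => -[].
have cX0 : c *m f = 0 by apply: cf.
have [k [q q0 qE]] := multiplicity_XsubC (char_poly c) 0.
rewrite monic_neq0 ?char_poly_monic //= in q0; rewrite polyC0 subr0 in qE.
(* The exponent is one more than the multiplicity k, so that 1 - E has an explicit factor c, which
   kills f, without first proving k > 0. *)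
have : coprimep q ('X ^+ k.+1).
  by rewrite coprimep_expr // -[X in coprimep _ X]subr0 -polyC0 coprimep_XsubC.
case/Bezout_eq1_coprimepP=> -[v u] /= vu1; pose E := horner_mx c (v * q).
have Ef : E *m f = f.
  have -> : E = 1%:M - horner_mx c (u * 'X^k) *m c.
    rewrite /E (canRL (addrK _) vu1) rmorphB rmorph1; congr (_ - _).
    by rewrite exprSr mulrA !rmorphM /= horner_mx_X.
  by rewrite mulmxBl mul1mx -mulmxA cX0 mulmx0 subr0.
pose Z := kermx (c ^+ k.+1); pose Q := row_base Z.
have EZ : (E <= Z)%MS.
  apply/sub_kermxP.
  have <- : horner_mx c ('X ^+ k.+1) = c ^+ k.+1 by rewrite rmorphXn /= horner_mx_X.
  rewrite mulmxE -rmorphM /= exprSr mulrA -(mulrA v) -qE !rmorphM /= Cayley_Hamilton.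
  by rewrite mulr0 mul0r.
have ltZ : (\rank Z < n.+1)%N.
  rewrite ltn_neqAle rank_leq_row andbT; apply: contraNneq trc => rkZ.
  have Zu : Z \in unitmx by rewrite -row_free_unit /row_free rkZ.
  apply/eqP; apply: (@mxtrace_nilp _ _ _ k.+1); rewrite -[LHS](mulKmx Zu).
  by rewrite [Z *m _]mulmx_ker mulmx0.
have QZ : (Q :=: Z)%MS := eq_row_base Z.
have Qinj := row_free_inj (row_base_free Z : row_free Q); clearbody Q.
have Zc : Z *m c ^+ k.+1 = 0 := mulmx_ker _.
have Zrho x : (Q *m rho x <= Q)%MS.
  rewrite QZ; apply: submx_trans (submxMr _ _) _; first by rewrite QZ.
  apply/sub_kermxP; have -> : Z *m rho x *m c ^+ k.+1 = Z *m c ^+ k.+1 *m rho x.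
    have cm : GRing.comm (rho x) (c ^+ k.+1).
      by apply: commrX; rewrite /GRing.comm -!mulmxE c_comm.
    by rewrite -!(mulmxA Z); congr (Z *m _); apply: cm.
  by rewrite Zc mul0mx.
have [|rho' rho'E] := @exists_lfun _ _ _ (fun x => Q *m rho x *m pinvmx Q).
  by move=> a x y; rewrite linearP mulmxDr -scalemxAr mulmxDl -scalemxAl.
have rho'Q x : rho' x *m Q = Q *m rho x by rewrite rho'E mulmxKpV.
have [||x xR||x|e [ef e0]] := IHm _ rho' (Q *m f).
- by apply: leq_trans ltZ _.
- move=> x y; apply: Qinj; rewrite rho'Q rhoM /ad_mx mulmxBr mulmxBl.
  by rewrite -!mulmxA !rho'Q !mulmxA !rho'Q.
- by rewrite rho'E rhoR // mulmx0 mul0mx.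
- apply: contraNneq f0 => Qf0; rewrite -Ef.
  have /submxP[D ->] : (E <= Q)%MS by rewrite QZ.
  by rewrite -mulmxA Qf0 mulmx0.
- by rewrite mulmxA rho'Q -mulmxA rf mulmx0.
exists (e *m Q); split=> [|x]; first by rewrite -mulmxA.
by rewrite -mulmxA -rho'Q mulmxA e0 mul0mx.
Qed.

(** The cocycle condition says that the block matrices with rows (0, delta) and (0, rho) form a
    representation, on which the column (1, 0) is invariant. An invariant row (a, e') with a <> 0
    gives delta = - a^-1 e' rho. *)
Lemma cocycle_mx n (rho : 'Hom(V, 'M[K]_n)) (delta : 'Hom(V, 'rV[K]_n)) : lie_rep br rho ->
  (forall x, x \in R -> rho x = 0) -> (forall x, x \in R -> delta x = 0) ->
  (forall x y, delta (br x y) = delta x *m rho y - delta y *m rho x) ->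
  exists e, forall x, delta x = e *m rho x.
Proof.
move=> rhoM rhoR deltaR deltaM.
have [|rho' rho'E] := @exists_lfun _ _ _
  (fun x => block_mx 0 (delta x) 0 (rho x) : 'M[K]_(1 + n)).
  by move=> a x y; rewrite scale_block_mx add_block_mx !linearP !scaler0 !addr0.
have [x y|x xR||x|e [ef e0]] := @invariant_pairing _ rho' (col_mx 1 0).
- rewrite !rho'E /ad_mx !mulmx_block opp_block_mx add_block_mx.
  by rewrite !(mul0mx, mulmx0, add0r, subr0, oppr0) deltaM rhoM.
- by rewrite rho'E rhoR // deltaR // block_mx_const.
- by rewrite col_mx_eq0 negb_and oner_eq0.
- by rewrite rho'E mul_block_col !(mul0mx, mulmx0, addr0) col_mx0.
pose a := lsubmx e 0 0; pose e' := rsubmx e.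
have eE : e = row_mx a%:M e' by rewrite -[LHS]hsubmxK [lsubmx e]mx11_scalar.
have a0 : a != 0.
  apply: contraNneq ef => a0; rewrite eE a0 mul_row_col mulmx0 addr0 mulmx1.
  by rewrite raddf0.
exists (- a^-1 *: e') => x.
have /(congr1 rsubmx) := e0 x; rewrite eE rho'E mul_row_block row_mxKr linear0 => /eqP.
rewrite mul_scalar_mx addr_eq0 => /eqP /(congr1 ( *:%R a^-1)).
by rewrite scalerA mulVf // scale1r -scalemxAl scaleNr scalerN.
Qed.

(** The form in which vanishing is applied: the action, the cocycle identity and the triviality of R
    are all required modulo A only. *)
Lemma cocycle_subquotient (W : vectType K) (A C : {vspace W}) (act : W -> V -> W)
    (delta : V -> W) : bilin act -> linear delta -> (A <= C)%VS ->
  (forall w x, w \in C -> act w x \in C) -> (forall w x, w \in A -> act w x \in A) ->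
  (forall w x, w \in C -> x \in R -> act w x \in A) ->
  (forall w x y, w \in C -> act w (br x y) - (act (act w x) y - act (act w y) x) \in A) ->
  (forall x, delta x \in C) -> (forall x, x \in R -> delta x \in A) ->
  (forall x y, delta (br x y) - (act (delta x) y - act (delta y) x) \in A) ->
  exists2 e, e \in C & forall x, delta x - act e x \in A.
Proof.
move=> act_b delta_lin sAC actC actA actR actM deltaC deltaR deltaM.
have [n [pi [iota [rho [[iotaC piK piA _] _ rhoM rhoP]]]]] :=
  subquotient_rep act_b sAC actC actA actM.
have [delta' delta'E] : exists g : 'Hom(V, 'rV[K]_n), forall x, g x = pi (delta x).
  by apply: exists_lfun => a x y; rewrite delta_lin linearP.
have [x xR|x xR|x y|e eP] := @cocycle_mx _ rho delta' rhoM.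
- apply/row_matrixP => i; rewrite row0 rowE -(piK (delta_mx 0 i)) -rhoP //.
  by apply/piA; [apply: actC | apply: actR].
- by rewrite delta'E; apply/piA; [apply: deltaC | apply: deltaR].
- rewrite !delta'E -!rhoP // -linearB; apply/eqP; rewrite -subr_eq0 -linearB; apply/eqP.
  by apply/piA => //; do 2?[apply: memvB => //]; apply: actC.
exists (iota e) => // x; apply/piA; first by rewrite memvB ?actC.
by rewrite linearB /= -delta'E eP rhoP // piK subrr.
Qed.

End Vanishing.

(** * Levi and Weyl decompositions *)

Lemma eq_coord (K : fieldType) (V : vectType K) (u v : V) :
  (forall i, coord (vbasis fullv) i u = coord (vbasis fullv) i v) -> u = v.
Proof.
move=> uv; rewrite (coord_vbasis (memvf u)) (coord_vbasis (memvf v)).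
by apply: eq_bigr => i _; rewrite uv.
Qed.

(** Vector identities are checked coordinatewise, where they become ring identities in K with the
    coordinates of brackets as atoms. *)
Ltac vring := apply: eq_coord => ?; rewrite ?(linearD, linearN, linearZ, linear0) /=; ring.

Lemma linear_lfunE (K : fieldType) (A B : vectType K) (f : A -> B) :
  linear f -> forall x, linfun f x = f x.
Proof.
move=> f_lin x; pose fL := GRing.isLinear.Build _ _ _ _ _ f_lin.
pose g : {linear A -> B} := HB.pack f fL.
exact: (lfunE g x).
Qed.

Section LeviWeyl.
Variables (K : fieldType) (charK0 : [pchar K] =i pred0).
Variables (V : vectType K) (br : V -> V -> V) (br_lie : lie_bracket br).
Variable R : {vspace V}.
Hypotheses (idR : is_ideal br R) (R_proper : R != fullv)
  (R_max : forall U, is_ideal br U -> (R <= U)%VS -> U = R \/ U = fullv)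
  (br_perfect : bspan br fullv fullv = fullv).

Let brb := lie_bilin br_lie.

Lemma solvable_not_perfect I N : solvable_sub br I -> (N <= I)%VS -> N != 0%VS ->
  ~~ (N <= bspan br N N)%VS.
Proof.
move=> [n In0] sNI N0; apply: contraNN N0 => sNN; rewrite -subv0 -In0.
elim: n {In0} => //= n IHn; apply: subv_trans sNN _; exact: (bspanS brb).
Qed.

Definition adr (z : V) : 'End(V) := linfun (br^~ z).

Lemma adrE z u : adr z u = br u z.
Proof. exact: (linear_lfunE (brb.1 z)). Qed.

(** The map c is a linear section of g / R with values in h, in general not multiplicative. *)
Lemma exists_section (h : {vspace V}) : (h + R)%VS = fullv ->
  exists c : 'End(V), [/\ (forall x, c x \in h), (forall x, x - c x \in R) &
    forall x, x \in R -> c x = 0].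
Proof.
move=> hR; pose D := (h :\: R)%VS.
have DR0 : (D :&: R = 0)%VS by apply: capv_diff.
have DR : (D + R)%VS = fullv by rewrite addv_diff.
have cR x : x - daddv_pi D R x \in R.
  have xDR : x \in (D + R)%VS by rewrite DR memvf.
  by rewrite -{1}(daddv_pi_add DR0 xDR) addrAC subrr add0r memv_pi.
exists (daddv_pi D R); split=> // x => [|xR].
  by apply: (subvP (diffvSl _ _)); apply: memv_pi.
apply/eqP; rewrite -memv0 -DR0 memv_cap memv_pi /=.
by rewrite -[daddv_pi _ _ x](subKr x) memvB.
Qed.

(* A non-complementing supplement h of R contains a smaller one: with N = h :&: R, the
   obstruction to splitting h / [N, N] is a cocycle with values in maps h -> N, and a
   primitive of it yields phi : h -> N, the identity modulo [N, N] on N, whose stabiliser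
   or kernel is a proper supplement. *)
Lemma smaller_supplement (h : {vspace V}) : solvable_sub br R ->
  (forall x y, x \in h -> y \in h -> br x y \in h) -> (h + R)%VS = fullv ->
  (h :&: R != 0)%VS ->
  exists T, [/\ (T <= h)%VS, T != h, (forall x y, x \in T -> y \in T -> br x y \in T)
    & (T + R)%VS = fullv].
Proof.
move=> solR hcl hR; set N := (h :&: R)%VS => N0.
have [c [ch cR cR0]] := exists_section hR.
pose N' := bspan br N N.
have NN' := solvable_not_perfect solR (capvSr h R) N0; rewrite -/N' in NN'.
have Nh n x : n \in N -> x \in h -> br n x \in N.
  by case/memv_capP=> nh nR xh; rewrite memv_cap hcl // ideal_r.
have sN'N : (N' <= N)%VS.
  by apply/(bspanP brb) => x y xN /memv_capP[yh _]; apply: Nh.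
have N'N n : n \in N' -> n \in N by apply: subvP sN'N n.
have NR n : n \in N -> n \in R by case/memv_capP.
have nh n : n \in N -> n \in h by case/memv_capP.
have brNN n m : n \in N -> m \in N -> br n m \in N' by apply: memv_bspan.
have N'h n x : n \in N' -> x \in h -> br n x \in N'.
  move=> nN' xh; move: n nN'; apply: (bspan_ind brb) => [|a u v uN vN|u v uN vN].
  - by rewrite (bilin0l brb) mem0v.
  - by rewrite (bilinDl brb) (bilinZl brb) memvD ?memvZ.
  have -> : br (br u v) x = br u (br v x) + br (br u x) v.
    by rewrite (lie_jacobi br_lie) subrK.
  by rewrite memvD ?brNN ?Nh.
(* The failure of c to be a homomorphism: the 2-cocycle of the extension of g / R by N. *)
pose F y x := br (c y) (c x) - c (br y x).
have FN y x : F y x \in N.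
  rewrite memv_cap memvB ?hcl //=.
  have -> : F y x = (br y x - c (br y x)) - br (y - c y) (c x) - br y (x - c x).
    by rewrite !(bilinBl brb, bilinBr brb) /F; vring.
  by apply: memvB; [apply: memvB => //; apply: ideal_r | apply: idR].
(* Source and target are treated differently: x itself acts on arguments, c x on values. The defect
   of multiplicativity is a bracket of two elements of N, hence lies in N' = [N, N]. *)
pose act (w : 'End(V)) (x : V) : 'End(V) := (adr (c x) \o w)%VF - (w \o adr x)%VF.
have actE w x y : act w x y = br (w y) (c x) - w (br y x).
  by rewrite /act add_lfunE opp_lfunE !comp_lfunE !adrE.
clearbody act.
have Flin x : linear (F^~ x).
  move=> a u v; rewrite /F linearP (bilinDl brb) (bilinZl brb) (brb.1 x) linearP.
  by rewrite scalerBr opprD addrACA.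
pose delta x : 'End(V) := linfun (F^~ x).
have deltaE x y : delta x y = F y x by apply: (linear_lfunE (Flin x)).
clearbody delta.
(* [Cs] consists of maps to N that are 0 on R modulo N', and [As] of those that are inner modulo N'.
   On the quotient R acts by 0, as vanishing of cohomology requires. *)
have [||Cs CP] := @exists_vspace K 'End(V) (fun w => (forall y, w y \in N) /\
    forall r, r \in R -> w r \in N').
- by split=> y; rewrite zero_lfunE mem0v.
- move=> a u v [uN uR] [vN vR]; split=> [y|r rR]; rewrite add_lfunE scale_lfunE.
    by rewrite memvD ?memvZ.
  by rewrite memvD ?memvZ ?uR ?vR.
have [||As AP] := @exists_vspace K 'End(V) (fun w => exists2 v, v \in N &
    forall y, w y - br v (c y) \in N').
- by exists 0; rewrite ?mem0v // => y; rewrite (bilin0l brb) subr0 zero_lfunE mem0v.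
- move=> a u v [n nN un] [m mN vm]; exists (a *: n + m); first by rewrite memvD ?memvZ.
  move=> y; rewrite (bilinDl brb) (bilinZl brb) add_lfunE scale_lfunE opprD addrACA.
  by rewrite -scalerBr memvD ?memvZ.
have AsN' (w : 'End(V)) : (forall y, w y \in N') -> w \in As.
  move=> wN'; apply/AP; exists 0; first exact: mem0v.
  by move=> y; rewrite (bilin0l brb) subr0.
have [||||||||||psi psiC psiP] := @cocycle_subquotient _ charK0 _ _ br_lie _ R_proper R_max
    br_perfect _ As Cs act delta.
- split=> [y|x] a u v; apply/lfunP => z.
    rewrite !(add_lfunE, scale_lfunE) !actE !(add_lfunE, scale_lfunE).
    by rewrite (bilinDl brb) (bilinZl brb) scalerBr opprD addrACA.
  rewrite add_lfunE scale_lfunE !actE linearP (brb.2 z) (brb.2 (x z)) linearP.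
  by rewrite scalerBr opprD addrACA.
- move=> a u v; apply/lfunP => z; rewrite add_lfunE scale_lfunE !deltaE /F.
  rewrite linearP (brb.2 z) (brb.2 (c z)) linearP.
  by rewrite scalerBr opprD addrACA.
- apply/subvP=> w /AP[v vN wv]; apply/CP; split=> [y|r rR].
    by rewrite -[w y](subrK (br v (c y))) memvD ?Nh // N'N.
  by have := wv r; rewrite cR0 // (bilin0r brb) subr0.
- move=> w x /CP[wN wR]; apply/CP; split=> [y|r rR]; rewrite actE.
    by rewrite memvB ?Nh.
  by rewrite memvB ?N'h ?wR // (ideal_r br_lie).
- move=> w x /AP[v vN wv]; apply/AP; exists (br v (c x)); first exact: Nh.
  move=> y; rewrite actE.
  have -> : br (w y) (c x) - w (br y x) - br (br v (c x)) (c y)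
     = br (w y - br v (c y)) (c x) - (w (br y x) - br v (c (br y x))) + br v (F y x).
    rewrite (bilinBl brb) /F (bilinBr brb) (lie_jacobi br_lie); vring.
  apply: memvD; last exact: brNN.
  by apply: memvB; [apply: N'h | apply: wv].
- move=> w x /CP[wN wR] xR; apply: AsN' => y.
  by rewrite actE cR0 // (bilin0r brb) sub0r memvN wR ?idR.
- move=> w x y /CP[wN wR]; apply: AsN' => z.
  have -> : (act w (br x y) - (act (act w x) y - act (act w y) x)) z = - br (w z) (F x y).
    rewrite !(add_lfunE, opp_lfunE) !actE (lie_jacobi br_lie z) /F !linearB.
    by rewrite !(bilinBl brb, bilinBr brb) (lie_jacobi br_lie (w z)); vring.
  by rewrite memvN brNN.
- move=> x; apply/CP; split=> [y|r rR]; rewrite deltaE //.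
  have rxR : br r x \in R by apply: ideal_r.
  by rewrite /F (cR0 r rR) (cR0 _ rxR) (bilin0l brb) subr0 mem0v.
- move=> x xR; apply: AsN' => y.
  have yxR : br y x \in R by apply: idR.
  by rewrite deltaE /F (cR0 x xR) (cR0 _ yxR) (bilin0r brb) subr0 mem0v.
(* The coboundary of [delta] is the inner map given by [F x y]; this is why inner maps have to be
   divided out. *)
- move=> x y; apply/AP; exists (F x y) => // z.
  suff -> : (delta (br x y) - (act (delta x) y - act (delta y) x)) z = br (F x y) (c z).
    by rewrite subrr mem0v.
  rewrite !(add_lfunE, opp_lfunE) !actE !deltaE (lie_anti br_lie (F x y)) /F.
  rewrite (lie_jacobi br_lie z) !linearB.
  by rewrite !(bilinBl brb, bilinBr brb) (lie_jacobi br_lie (c z)); vring.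
have /CP[psiN psiR] := psiC.
pose phi u := u - c u + psi u.
have phiP a u v : phi (a *: u + v) = a *: phi u + phi v.
  by rewrite /phi !linearP !scalerDr scalerN; vring.
have phiB u v : phi (u - v) = phi u - phi v by rewrite /phi !linearB; vring.
have phiN u : u \in h -> phi u \in N.
  by move=> uh; rewrite memvD // memv_cap cR memvB.
have phiR n : n \in R -> phi n - n \in N'.
  by move=> nR; rewrite /phi cR0 // subr0 addrAC subrr add0r psiR.
have phiN' n : n \in N' -> phi n \in N'.
  move=> nN'; rewrite -[phi n](subrK n) memvD // phiR //.
  exact/NR/N'N.
(* The elements of h whose bracket commutes with [phi] modulo N'. *)
have [||T TP] := @exists_vspace K V (fun z => z \in h /\
    forall u, u \in h -> br (phi u) z - phi (br u z) \in N').
- split=> [|u uh]; rewrite ?mem0v // !(bilin0r brb) sub0r memvN.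
  by rewrite phiN' ?mem0v.
- move=> a u v [uh uP] [vh vP]; split=> [|w wh]; first by rewrite memvD ?memvZ.
  by rewrite (brb.2 (phi w)) (brb.2 w) phiP opprD addrACA -scalerBr memvD ?memvZ ?uP ?vP.
have sTh : (T <= h)%VS by apply/subvP => x /TP[].
have Tcl x y : x \in T -> y \in T -> br x y \in T.
  move=> /TP[xh xP] /TP[yh yP]; apply/TP; split=> [|u uh]; first exact: hcl.
  rewrite (lie_jacobi br_lie (phi u)) (lie_jacobi br_lie u) phiB.
  have E z w : br (br (phi u) z) w - phi (br (br u z) w)
    = br (br (phi u) z - phi (br u z)) w + (br (phi (br u z)) w - phi (br (br u z) w)).
    by rewrite (bilinBl brb); vring.
  have -> : br (br (phi u) x) y - br (br (phi u) y) x
     - (phi (br (br u x) y) - phi (br (br u y) x))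
     = (br (br (phi u) x) y - phi (br (br u x) y))
       - (br (br (phi u) y) x - phi (br (br u y) x)) by vring.
  rewrite !E; apply: memvB; apply: memvD.
  - by apply: N'h => //; apply: xP.
  - by apply/yP/hcl.
  - by apply: N'h => //; apply: yP.
  - by apply/xP/hcl.
(* The element c x need not stabilise [phi]; the v in N by which [psi] fails to be a primitive at x
   is exactly the correction needed. *)
have TR : (T + R)%VS = fullv.
  apply/eqP; rewrite eqEsubv subvf; apply/subvP=> x _.
  have /AP[v vN vP] := psiP x.
  have -> : x = (c x + v) + (x - c x - v) by vring.
  apply: memv_add; last by apply: memvB; [apply: cR | apply: NR].
  apply/TP; split=> [|u uh]; first by apply: memvD; [apply: ch | apply: nh].
  have := vP u; rewrite add_lfunE opp_lfunE deltaE actE.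
  set z := c x + v; have zxR : z - x \in R.
    have -> : z - x = v - (x - c x) by rewrite /z; vring.
    by apply: memvB; [apply: NR | apply: cR].
  have uzE : br u z = br u x + br u (z - x) by rewrite -(bilinDr brb) addrC subrK.
  have uzR : br u (z - x) \in R by apply: idR.
  have cuz : c (br u z) = c (br u x) by rewrite uzE linearD /= (cR0 _ uzR) addr0.
  move=> H.
  have -> : br (phi u) z - phi (br u z)
     = br (psi u) v - psi (br u (z - x)) + 
       - (F u x - (br (psi u) (c x) - psi (br u x)) - br v (c u)).
    have psiz : psi (br u z) = psi (br u x) + psi (br u (z - x)).
      by rewrite {1}uzE linearD.
    rewrite /phi cuz psiz /z /F.
    by rewrite !(bilinBl brb, bilinDl brb, bilinDr brb) (lie_anti br_lie v); vring.
  apply: memvD; last by rewrite memvN.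
  by apply: memvB; [apply: brNN | apply: psiR].
(* If T = h, then [phi] is h-equivariant modulo N' and the identity on N / N'. Its kernel T'
   supplements R, and T' <> h because N is not contained in N'. *)
have [Th|Th] := eqVneq T h; last by exists T.
have [||T' T'P] := @exists_vspace K V (fun u => u \in h /\ phi u \in N').
- by split; rewrite ?mem0v // phiN' ?mem0v.
- by move=> a u v [uh uP] [vh vP]; split; rewrite ?phiP memvD ?memvZ.
exists T'; split.
- by apply/subvP=> x /T'P[].
- have [n nN nN'] := subvPn NN'.
  apply: contraNneq nN' => T'h; have /T'P[_] : n \in T' by rewrite T'h nh.
  move=> phin; rewrite -[n](subKr (phi n)) memvB // phiR //; exact: NR.
- move=> x y /T'P[xh xP] /T'P[yh yP]; apply/T'P; split; first exact: hcl.
  rewrite -[phi _](subKr (br (phi x) y)); apply: memvB; first exact: N'h.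
  by have /TP[_] : y \in T; [rewrite Th | apply].
apply/eqP; rewrite eqEsubv subvf; apply/subvP=> x _.
have nN := phiN _ (ch x); set n := phi (c x) in nN.
have -> : x = (c x - n) + (x - c x + n) by vring.
apply: memv_add; last by apply: memvD; [apply: cR | apply: NR].
apply/T'P; split; first by apply: memvB; [apply: ch | apply: nh].
by rewrite phiB -/n -opprB memvN; apply/phiR/NR.
Qed.

(** Supplements of R, starting with g, shrink in dimension until one meets R in 0. *)
Theorem levi : solvable_sub br R ->
  exists S : {vspace V}, [/\ (forall x y, x \in S -> y \in S -> br x y \in S), (S + R)%VS = fullv &
    (S :&: R)%VS = 0%VS].
Proof.
move=> solR.
suff H m h : (\dim h < m)%N -> (forall x y, x \in h -> y \in h -> br x y \in h) ->
    (h + R)%VS = fullv -> exists S : {vspace V},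
      [/\ (forall x y, x \in S -> y \in S -> br x y \in S), (S + R)%VS = fullv & (S :&: R)%VS = 0%VS].
  apply: (H _ fullv (ltnSn _)) => [x y _ _|]; first exact: memvf.
  by apply/addv_idPl/subvf.
elim: m h => // m IHm h lt_h hcl hR.
have [hR0|hR0] := eqVneq (h :&: R)%VS 0%VS; first by exists h.
have [T [sTh neT Tcl TR]] := smaller_supplement solR hcl hR hR0.
apply: (IHm T) => //; apply: leq_trans (lt_h : (\dim h <= m)%N).
rewrite ltn_neqAle dimvS // andbT; apply: contraNneq neT => dimE.
by rewrite eqEdim sTh dimE leqnn.
Qed.

(** The coboundary of the linear projection onto B takes values in the maps A -> B that kill B. A
    primitive e in that space makes [projv B - e] an S-equivariant projection onto B, whose kernel
    in A is the complement. *)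
Theorem weyl_complement (S A B : {vspace V}) : (forall x y, x \in S -> y \in S -> br x y \in S) ->
  (S + R)%VS = fullv -> (S :&: R)%VS = 0%VS -> (B <= A)%VS ->
  (forall u s, u \in A -> s \in S -> br u s \in A) ->
  (forall u s, u \in B -> s \in S -> br u s \in B) ->
  exists M : {vspace V}, [/\ (M :&: B)%VS = 0%VS, (M + B)%VS = A &
    forall u s, u \in M -> s \in S -> br u s \in M].
Proof.
move=> Scl SR SR0 sBA AS BS.
have [c [cS cR cR0]] := exists_section SR.
have memSR x : x \in S -> x \in R -> x = 0.
  by move=> xS xR; apply/eqP; rewrite -memv0 -SR0 memv_cap xS.
have cid s : s \in S -> c s = s.
  move=> sS; apply/esym/eqP; rewrite -subr_eq0; apply/eqP/memSR => //.
  exact: memvB.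
(* Since R is an ideal complementing S, this section is a homomorphism. The action of S extends
   through it to an action of g that is 0 on R. *)
have cM x y : c (br x y) = br (c x) (c y).
  apply/eqP; rewrite -subr_eq0; apply/eqP/memSR; first by rewrite memvB ?Scl.
  have -> : c (br x y) - br (c x) (c y)
      = br (x - c x) (c y) + br x (y - c y) - (br x y - c (br x y)).
    by rewrite !(bilinBl brb, bilinBr brb); vring.
  by apply: memvB => //; apply: memvD; [apply: ideal_r | apply: idR].
pose act (w : 'End(V)) (x : V) : 'End(V) := (adr (c x) \o w)%VF - (w \o adr (c x))%VF.
have actE w x y : act w x y = br (w y) (c x) - w (br y (c x)).
  by rewrite /act add_lfunE opp_lfunE !comp_lfunE !adrE.
clearbody act.
have [||Cs CP] := @exists_vspace K 'End(V) (fun w => (forall u, u \in A -> w u \in B) /\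
    forall u, u \in B -> w u = 0).
- by split=> u uA; rewrite zero_lfunE ?mem0v.
- move=> a u v [uA uB] [vA vB]; split=> z zA; rewrite add_lfunE scale_lfunE.
    by rewrite memvD ?memvZ ?uA ?vA.
  by rewrite uB // vB // scaler0 addr0.
have [||As AP] := @exists_vspace K 'End(V) (fun w => forall u, u \in A -> w u = 0).
- by move=> u uA; rewrite zero_lfunE.
- by move=> a u v u0 v0 z zA; rewrite add_lfunE scale_lfunE u0 // v0 // scaler0 addr0.
have act_lin w : linear (act w).
  move=> a u v; apply/lfunP => z.
  rewrite add_lfunE scale_lfunE !actE linearP (brb.2 z) (brb.2 (w z)) linearP.
  by rewrite scalerBr opprD addrACA.
have actM w x y : act w (br x y) - (act (act w x) y - act (act w y) x) = 0.
  apply/lfunP => z; rewrite zero_lfunE !(add_lfunE, opp_lfunE) !actE cM.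
  rewrite (lie_jacobi br_lie z) !linearB !(bilinBl brb) (lie_jacobi br_lie (w z)).
  by vring.
have actC w x : w \in Cs -> act w x \in Cs.
  move=> /CP[wA wB]; apply/CP; split=> u uA; rewrite actE.
    by rewrite memvB ?BS ?wA ?AS.
  by rewrite wB // wB ?BS // (bilin0l brb) subr0.
have [||||||||||e eC eP] := @cocycle_subquotient _ charK0 _ _ br_lie _ R_proper R_max
    br_perfect _ As Cs act (act (projv B)).
- split=> [y|x]; last exact: act_lin.
  move=> a u v; apply/lfunP => z.
  rewrite !(add_lfunE, scale_lfunE) !actE !(add_lfunE, scale_lfunE).
  by rewrite (bilinDl brb) (bilinZl brb) scalerBr opprD addrACA.
- exact: act_lin.
- apply/subvP=> w /AP wA; apply/CP; split=> u uA; rewrite wA ?mem0v //.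
  exact: (subvP sBA).
- exact: actC.
- move=> w x /AP wA; apply/AP => u uA.
  by rewrite actE !wA ?AS // (bilin0l brb) subr0.
- move=> w x wC xR; apply/AP => u uA.
  by rewrite actE cR0 // !(bilin0r brb) linear0 subr0.
- by move=> w x y _; rewrite actM mem0v.
- move=> x; apply/CP; split=> u uA; rewrite actE.
    by rewrite memvB ?BS ?memv_proj.
  by rewrite !projv_id ?BS // subrr.
- move=> x xR; apply/AP => u uA.
  by rewrite actE cR0 // !(bilin0r brb) linear0 subr0.
- by move=> x y; rewrite actM mem0v.
have /CP[eA eB] := eC; pose phi := projv B - e.
have phiB u : u \in B -> phi u = u.
  by move=> uB; rewrite add_lfunE opp_lfunE eB // projv_id // subr0.
have phiA u : u \in A -> phi u \in B.
  by move=> uA; rewrite add_lfunE opp_lfunE memvB ?memv_proj ?eA.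
have phiS u s : u \in A -> s \in S -> phi (br u s) = br (phi u) s.
  move=> uA sS; have /AP/(_ u uA) := eP s.
  rewrite add_lfunE opp_lfunE !actE cid // => /eqP; rewrite !(add_lfunE, opp_lfunE).
  rewrite (bilinDl brb) (bilinNl brb) => /eqP E; apply/eqP; rewrite eq_sym -subr_eq0.
  by rewrite -E; apply/eqP; vring.
exists (A :&: lker phi)%VS; split=> [||u s].
- apply/eqP; rewrite -subv0; apply/subvP=> u /memv_capP[/memv_capP[_]].
  by rewrite memv_ker => /eqP u0 uB; rewrite -(phiB u uB) u0 mem0v.
- apply/eqP; rewrite eqEsubv subv_add capvSl sBA; apply/subvP=> u uA.
  rewrite -[u](subrK (phi u)) memv_add ?phiA // memv_cap memvB //=; last first.
    exact/(subvP sBA)/phiA.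
  by rewrite memv_ker linearB /= (phiB (phi u)) ?subrr ?phiA.
- rewrite !memv_cap !memv_ker => /andP[uA /eqP u0] sS; rewrite AS //= phiS // u0.
  by rewrite (bilin0l brb).
Qed.

End LeviWeyl.

(** * Ideals acting on irreducible modules *)

Section IdealActions.
Variables (K : fieldType) (charK0 : [pchar K] =i pred0).
Variables (V : vectType K) (br : V -> V -> V) (br_lie : lie_bracket br).
Let brb := lie_bilin br_lie.

Lemma solvable_derived I J : solvable_sub br I -> (bspan br J J <= I)%VS -> solvable_sub br J.
Proof.
move=> [n In0] sJI; exists n.+1; apply/eqP; rewrite -subv0 -In0 iterSr.
by elim: n {In0} => //= n IHn; apply: (bspanS brb).
Qed.

Lemma ideal_add I J : is_ideal br I -> is_ideal br J -> is_ideal br (I + J)%VS.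
Proof.
move=> idI idJ x _ /memv_addP[u uI [v vJ ->]].
by rewrite (bilinDr brb) memv_add ?idI ?idJ.
Qed.

Lemma ideal_subquotient_rep (A C : {vspace V}) : is_ideal br A -> is_ideal br C -> (A <= C)%VS ->
  exists n (pi : 'Hom(V, 'rV[K]_n)) (iota : 'Hom('rV[K]_n, V)) (rho : 'Hom(V, 'M[K]_n)),
  [/\ [/\ (forall r, iota r \in C), (forall r, pi (iota r) = r),
       (forall w, w \in C -> (pi w = 0 <-> w \in A)) &
       (forall w, w \in C -> w - iota (pi w) \in A)],
      n = (\dim C - \dim A)%N, lie_rep br rho &
      forall w x, w \in C -> pi (br w x) = pi w *m rho x].
Proof.
move=> idA idC sAC; apply: subquotient_rep => // [w x|w x|w x y _].
- exact: ideal_r.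
- exact: ideal_r.
- by rewrite (lie_jacobi br_lie) subrr mem0v.
Qed.

(** What remains after the orthogonal of J is identified with R is a dimension count: g / R embeds
    in the dual of J / R, so g is no larger than J. *)
Lemma radical_maximal R J : is_ideal br R -> is_ideal br J -> (R <= J)%VS ->
  solvable_sub br R -> ~ solvable_sub br J ->
  (forall U, is_ideal br U -> (R <= U)%VS -> (U <= J)%VS -> U = R \/ U = J) ->
  (forall U, is_ideal br U -> (U <= J)%VS \/ (J <= U)%VS) ->
  J = fullv.
Proof.
move=> idR idJ sRJ solR nsolJ RJ compJ.
have [n [pi [iota [rho [[iotaC piK piR iotaK] nE rhoM rhoP]]]]] :=
  ideal_subquotient_rep idR idJ sRJ.
have nDR : ~ (bspan br J J <= R)%VS by move/(solvable_derived solR).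
have rho0 x : (forall w, w \in J -> br w x \in R) -> rho x = 0.
  move=> Jx; apply/row_matrixP => i; rewrite row0 rowE -(piK (delta_mx 0 i)) -rhoP //.
  by apply/piR; [apply: ideal_r | apply: Jx].
have rhoR x : x \in R -> rho x = 0 by move=> xR; apply: rho0 => w _; apply: idR.
have [U idU UP] := trace_form_radical br_lie rhoM idJ.
have nJU : ~ (J <= U)%VS.
  move=> sJU; have rhoJ : forall x, x \in J -> rho x = 0.
    apply: (rep_trace0 charK0 br_lie rhoM) => [x y _ yJ|x xJ|x y xJ yJ].
    - exact: idJ.
    (* [J, J] + R is an ideal between R and J and is not R, so J is perfect modulo R. *)
    - have [|||DR|DR] := RJ (bspan br J J + R)%VS.
      + by apply: ideal_add => //; apply: ideal_bspan.
      + exact: addvSr.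
      + by rewrite subv_add sRJ andbT; apply/(bspanP brb) => u v _; apply: idJ.
      + by case: nDR; rewrite -DR addvSl.
      + move: xJ; rewrite -{1}DR => /memv_addP[u uD [r rR ->]].
        by rewrite linearD /= (rhoR r rR) addr0 memv_img.
    - by move/(subvP sJU)/UP: xJ; apply.
  apply: nDR; apply/(bspanP brb) => w x wJ xJ; apply/piR; first exact: idJ.
  by rewrite rhoP // rhoJ // mulmx0.
have sRU : (R <= U)%VS by apply/subvP=> x /rhoR xR; apply/UP => y _; rewrite xR mul0mx mxtrace0.
have sUJ : (U <= J)%VS by case: (compJ U idU).
have defU : U = R by case: (RJ U idU sRU sUJ) => // UJ; case: nJU; rewrite UJ subvv.
(* [Phi x] is the functional that x defines on J / R by the trace form; its target has dimension dim
   J - dim R and its kernel lies in R. *)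
have [Phi PhiE] : exists Phi : 'Hom(V, 'rV[K]_n), forall x,
    Phi x = \row_i \tr (rho x *m rho (iota (delta_mx 0 i))).
  apply: exists_lfun => a x y; apply/rowP => i.
  by rewrite !mxE linearP mulmxDl -scalemxAl mxtraceD mxtraceZ.
apply/eqP; rewrite eqEdim subvf -(limg_ker_dim Phi fullv) capfv.
have: (lker Phi <= R)%VS.
  apply/subvP=> x; rewrite memv_ker PhiE -defU => /eqP x0; apply/UP => y yJ.
  have : rho (y - iota (pi y)) = 0 by rewrite rhoR // iotaK.
  rewrite linearB => /eqP; rewrite subr_eq0 => /eqP->.
  rewrite {1}(row_sum_delta (pi y)) !linear_sum big1 //= => i _.
  by rewrite !linearZ /=; move/rowP: x0 => /(_ i); rewrite !mxE => ->; rewrite mulr0.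
move/dimvS => kerR; have := dimvS (subvf (limg Phi)); rewrite [X in (_ <= X)%N]dimvf dim_matrix.
have := dimvS sRJ; lia.
Qed.

Lemma mxtrace_ad_comm n (a b M : 'M[K]_n) : M *m a = a *m M -> \tr (ad_mx a b *m M) = 0.
Proof.
move=> Ma; rewrite /ad_mx mulmxBl raddfB /= -[b *m a *m M]mulmxA -Ma mulmxA.
by rewrite [\tr (b *m M *m a)]mxtrace_mulC mulmxA subrr.
Qed.

Definition irreducible_mx n (rho : 'Hom(V, 'M[K]_n)) := forall U : {vspace 'rV[K]_n},
  (forall r x, r \in U -> r *m rho x \in U) -> U = 0%VS \/ U = fullv.

(** The vectors killed by D form a submodule because D is an ideal, nonzero by Engel. *)
Lemma nil_ideal_acts_trivially n (rho : 'Hom(V, 'M[K]_n)) D : lie_rep br rho ->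
  irreducible_mx rho -> is_ideal br D ->
  (forall x, x \in D -> exists N, rho x ^+ N = 0) -> forall x, x \in D -> rho x = 0.
Proof.
move=> rhoM rho_irr idD Dnil.
have [n0|n_gt0] := posnP n.
  by move=> x _; apply/matrixP => i j; have : (i < 0)%N by rewrite -n0 ltn_ord.
have [||r r0 rD] := @engel_row _ n (rho @: D)%VS n_gt0.
- move=> _ _ /memv_imgP[u uD ->] /memv_imgP[v vD ->].
  by rewrite -rhoM memv_img // idD.
- by move=> _ /memv_imgP[u uD ->]; apply: Dnil.
have [||U UP] := @exists_vspace K 'rV[K]_n (fun r => forall x, x \in D -> r *m rho x = 0).
- by move=> x _; rewrite mul0mx.
- by move=> a u v u0 v0 x xD; rewrite mulmxDl -scalemxAl u0 // v0 // scaler0 addr0.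
have [u x /UP uD|U0|Uf] := rho_irr U.
- apply/UP => y yD; have E : rho x *m rho y = rho (br x y) + rho y *m rho x.
    by rewrite rhoM /ad_mx subrK.
  by rewrite -mulmxA E mulmxDr mulmxA !uD ?mul0mx ?addr0 // idD.
- by case/eqP: r0; apply/eqP; rewrite -memv0 -U0; apply/UP => x xD; rewrite rD ?memv_img.
move=> x xD; apply/row_matrixP => i; rewrite row0 rowE.
by have /UP : delta_mx 0 i \in U by [rewrite Uf memvf|]; apply.
Qed.

(** The trace of [a, b] M is 0 when a commutes with M. With a from D this makes [D, g] act by
    nilpotent matrices, hence by 0, so the image of D commutes with that of g. As g = [g, g], the
    same identity with a from g makes D act by nilpotent matrices. *)
Lemma commutative_ideal_acts_trivially n (rho : 'Hom(V, 'M[K]_n)) D : lie_rep br rho ->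
  irreducible_mx rho -> bspan br fullv fullv = fullv -> is_ideal br D ->
  (forall x y, x \in D -> y \in D -> rho x *m rho y = rho y *m rho x) ->
  forall x, x \in D -> rho x = 0.
Proof.
move=> rhoM rho_irr br_perfect idD Dcomm.
have idf : is_ideal br fullv by move=> *; apply: memvf.
have commX (a b : 'M[K]_n) k : a *m b = b *m a -> a ^+ k *m b = b *m a ^+ k.
  move=> ab; elim: k => [|k IHk]; first by rewrite expr0 mul1mx mulmx1.
  by rewrite exprS -mulmxE -mulmxA IHk !mulmxA ab.
pose D1 := bspan br D fullv.
have sD1D : (D1 <= D)%VS by apply/(bspanP brb) => u v uD _; apply: ideal_r.
have D10 : forall x, x \in D1 -> rho x = 0.
  apply: nil_ideal_acts_trivially => // [|w wD1]; first exact: ideal_bspan.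
  apply: (trace_exp_nilp charK0) => k; rewrite exprS -mulmxE.
  have wD := subvP sD1D _ wD1.
  suff P z : z \in D1 -> \tr (rho z *m rho w ^+ k) = 0 by apply: P.
  move: z; apply: (bspan_ind brb) => [|a u v u0 v0|u v uD _].
  - by rewrite linear0 mul0mx mxtrace0.
  - by rewrite linearP mulmxDl -scalemxAl mxtraceD mxtraceZ u0 v0 mulr0 addr0.
  - by rewrite rhoM mxtrace_ad_comm // commX // Dcomm.
apply: nil_ideal_acts_trivially => // w wD.
apply: (trace_exp_nilp charK0) => k; rewrite exprS -mulmxE.
have wf : w \in bspan br fullv fullv by rewrite br_perfect memvf.
suff P z : z \in bspan br fullv fullv -> \tr (rho z *m rho w ^+ k) = 0 by apply: P.
move: z; apply: (bspan_ind brb) => [|a u v u0 v0|u v _ _].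
- by rewrite linear0 mul0mx mxtrace0.
- by rewrite linearP mulmxDl -scalemxAl mxtraceD mxtraceZ u0 v0 mulr0 addr0.
- rewrite rhoM mxtrace_ad_comm // commX //.
  have := D10 (br w u); rewrite rhoM => E; apply/eqP; rewrite -subr_eq0; apply/eqP/E.
  by apply: memv_bspan => //; apply: memvf.
Qed.

End IdealActions.

(** * The chain of ideals of a mixed Lie algebra *)

Section Chain.
Variables (K : fieldType) (charK0 : [pchar K] =i pred0).
Variables (V : vectType K) (br : V -> V -> V) (br_lie : lie_bracket br).
Let brb := lie_bilin br_lie.

(* The chain is indexed downwards from I 0 = fullv, and padded by 0 after I t.+1. *)
Definition ideal_chain (t : nat) (I : nat -> {vspace V}) :=
  [/\ I 0%N = fullv, (forall k, (t < k)%N -> I k = 0%VS), (forall k, is_ideal br (I k)),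
      (forall k, (k <= t)%N -> vproper (I k.+1) (I k)) &
      (forall U, is_ideal br U -> exists2 k, (k <= t.+1)%N & U = I k)].

Lemma ideal0 : is_ideal br 0%VS.
Proof. by move=> x y; rewrite !memv0 => /eqP->; rewrite (bilin0r brb). Qed.

Lemma idealf : is_ideal br fullv.
Proof. by move=> *; apply: memvf. Qed.

Lemma exists_ideal_chain t : ideal_lattice_chain br (t + 2) -> exists I, ideal_chain t I.
Proof.
case=> f [idf surjf strf].
have nsub i j : (i < j < t + 2)%N -> ~ (f j <= f i)%VS.
  by move/strf/andP=> [sij /eqP neq] sji; apply: neq; apply: subv_anti; rewrite sij.
have f0 : f 0%N = 0%VS.
  have [[//|i] lt_i fi] := surjf _ ideal0.
  by case: (nsub 0%N i.+1); [lia | rewrite -fi sub0v].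
have ft : f t.+1 = fullv.
  have [i lt_i fi] := surjf _ idealf.
  have [lt_it|] := ltnP i t.+1; last by move=> ?; rewrite fi; congr f; lia.
  by case: (nsub i t.+1); [lia | rewrite -fi subvf].
(* Truncated subtraction provides the padding, since f 0 = 0. *)
exists (fun k => f (t.+1 - k)%N); split=> [|k lt_tk|k|k le_kt|U idU].
- by rewrite subn0.
- by rewrite (_ : t.+1 - k = 0)%N ?f0 //; lia.
- by apply: idf; lia.
- by apply: strf; lia.
have [i lt_i ->] := surjf U idU; exists (t.+1 - i)%N; first lia.
by congr f; lia.
Qed.

Section Fixed.
Variables (t : nat) (I : nat -> {vspace V}).
Hypothesis I_chain : ideal_chain t I.

Let I0 : I 0%N = fullv. Proof. by case: I_chain. Qed.
Let It k : (t < k)%N -> I k = 0%VS. Proof. by case: I_chain => _ H _ _ _; apply: H. Qed.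
Let idI k : is_ideal br (I k). Proof. by case: I_chain. Qed.
Let surjI U : is_ideal br U -> exists2 k, (k <= t.+1)%N & U = I k.
Proof. by case: I_chain => _ _ _ _; apply. Qed.

Lemma chain_succ k : (I k.+1 <= I k)%VS.
Proof.
have [le_kt|lt_tk] := leqP k t; last by rewrite It ?sub0v // (leq_trans lt_tk).
by case: I_chain => _ _ _ /(_ k le_kt)/andP[].
Qed.

Lemma chain_le i j : (i <= j)%N -> (I j <= I i)%VS.
Proof.
move=> /subnK <-; elim: (j - i)%N => [|k IHk] //=.
by apply: subv_trans IHk; rewrite addSn; apply: chain_succ.
Qed.

Lemma chain_lt i j : (i < j)%N -> (i <= t)%N -> ~ (I i <= I j)%VS.
Proof.
move=> lt_ij le_it sIij; case: I_chain => _ _ _ /(_ i le_it)/andP[sI /eqP neI] _.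
by apply: neI; apply: subv_anti; rewrite sI (subv_trans sIij) ?chain_le.
Qed.

Lemma chain_comparable U k : is_ideal br U -> (U <= I k.+1)%VS \/ (I k <= U)%VS.
Proof.
case/surjI=> j _ ->; have [lt_kj|le_jk] := ltnP k j; first by left; apply: chain_le.
by right; apply: chain_le.
Qed.

Lemma chain_between U k : is_ideal br U -> (I k.+1 <= U)%VS -> (U <= I k)%VS ->
  U = I k.+1 \/ U = I k.
Proof.
move=> /(chain_comparable k)[sU|sU] s1 s2; [left|right]; apply: subv_anti.
  by rewrite sU.
by rewrite s2.
Qed.

Hypothesis br_mixed : mixed br.

(** Somewhere in the chain a solvable ideal is followed by a non-solvable one, which is g by
    [radical_maximal]; so the solvable one is [I 1]. An ideal [g, g] other than g would lie in [I 1]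
    and make g solvable. *)
Lemma chain_radical : [/\ (0 < t)%N, solvable_sub br (I 1%N) & bspan br fullv fullv = fullv].
Proof.
have [nsol nss] := br_mixed.
have [k [k_gt0 le_kt solI nsolI]] : exists k, [/\ (0 < k)%N, (k <= t)%N,
    solvable_sub br (I k) & ~ solvable_sub br (I k.-1)].
  apply: NNPP => nex; apply: nss => U /surjI[k le_k ->] solk.
  apply/eqP; rewrite -subv0 -(It (ltnSn t)); apply: chain_le.
  rewrite leqNgt ltnS; apply/negP => le_kt; apply: nsol; rewrite /solvable -I0.
  elim: k le_kt {le_k} solk => // k IHk lt_kt solk; apply: IHk; first exact: ltnW.
  by apply: NNPP => nsolk; apply: nex; exists k.+1.
have k1 : k = 1%N.
  have Ik : I k.-1 = fullv.
    apply: (radical_maximal charK0 br_lie (R := I k)) => //.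
    - by apply: chain_le; lia.
    - by move=> U idU; rewrite -{1 3}(prednK k_gt0); apply: chain_between.
    - move=> U /(chain_comparable k.-1)[sU|]; [left|by right].
      exact: subv_trans sU (chain_succ _).
  case: k k_gt0 Ik le_kt {solI nsolI} => [|[|k]] //= _ Ik le_kt.
  by case: (@chain_lt 0%N k.+1) => //; rewrite Ik subvf.
rewrite {}k1 in k_gt0 le_kt solI nsolI *; split=> //.
have [sD|] := @chain_comparable (bspan br fullv fullv) 0%N (ideal_bspan br_lie idealf idealf).
  by case: nsol; apply: (solvable_derived br_lie solI).
by rewrite I0 => sD; apply/eqP; rewrite eqEsubv subvf.
Qed.

Let t_gt0 : (0 < t)%N. Proof. by case: chain_radical. Qed.
Let solR : solvable_sub br (I 1%N). Proof. by case: chain_radical. Qed.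
Let br_perfect : bspan br fullv fullv = fullv. Proof. by case: chain_radical. Qed.

Let R_proper : I 1%N != fullv.
Proof. by apply/eqP => R; apply: (@chain_lt 0 1) => //; rewrite R subvf. Qed.

Let R_max U : is_ideal br U -> (I 1%N <= U)%VS -> U = I 1%N \/ U = fullv.
Proof. by move=> idU sRU; rewrite -I0; apply: chain_between => //; rewrite I0 subvf. Qed.

Lemma chain_derived k : (0 < k)%N -> (bspan br (I k) (I k) <= I k.+1)%VS.
Proof.
move=> k_gt0; have [//|sID] := chain_comparable k (ideal_bspan br_lie (@idI k) (@idI k)).
have [Ik0|Ik0] := eqVneq (I k) 0%VS.
  by apply/(bspanP brb) => x y; rewrite Ik0 memv0 => /eqP->; rewrite (bilin0l brb) mem0v.
by have := solvable_not_perfect br_lie solR (chain_le k_gt0) Ik0; rewrite sID.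
Qed.

(* By downward induction on k, I k acts on the irreducible quotient I i / I i.+1 through
   commuting endomorphisms. *)
Lemma radical_acts_trivially i u x : u \in I i -> x \in I 1%N -> br u x \in I i.+1.
Proof.
have [n [pi [iota [rho [[iotaC piK piA iotaK] _ rhoM rhoP]]]]] :=
  ideal_subquotient_rep br_lie (@idI i.+1) (@idI i) (chain_succ i).
suff rho0 k : (0 < k)%N -> (forall x, x \in I k -> rho x = 0).
  by move=> ui xR; apply/piA; rewrite ?ideal_r // rhoP // (rho0 1%N) // mulmx0.
have rho_irr : irreducible_mx rho.
  move=> U Uinv.
  have [||W WP] := @exists_vspace K V (fun w => w \in I i /\ pi w \in U).
  - by rewrite linear0 !mem0v.
  - by move=> a w z [wi wU] [zi zU]; rewrite linearP !memvD ?memvZ.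
  have idW : is_ideal br W.
    move=> y w /WP[wi wU]; apply/WP; rewrite (lie_anti br_lie) linearN /= !memvN.
    by split; [apply: ideal_r | rewrite rhoP // Uinv].
  have [|||WE] := chain_between idW (_ : (I i.+1 <= W)%VS).
  - apply/subvP=> w wi; have wi' := subvP (chain_succ i) w wi.
    by apply/WP; rewrite wi' (proj2 (piA w wi') wi) mem0v.
  - by apply/subvP=> w /WP[].
  - move=> WE; left; apply/eqP; rewrite -subv0; apply/subvP=> r rU.
    have : iota r \in W by apply/WP; rewrite piK.
    by rewrite WE => /piA; rewrite piK => -> //; rewrite mem0v.
  right; apply/eqP; rewrite eqEsubv subvf; apply/subvP=> r _.
  by have /WP[_] : iota r \in W; [rewrite WE | rewrite piK].
have [m] := ubnP (t.+1 - k)%N; elim: m k => // m IHm k lt_m k_gt0.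
have [lt_tk|le_kt] := ltnP t k.
  by move=> y; rewrite It // memv0 => /eqP->; rewrite linear0.
apply: (commutative_ideal_acts_trivially charK0 br_lie rhoM) => // y z yk zk.
have : rho (br y z) = 0.
  apply: (IHm k.+1) => //; first by lia.
  by apply: (subvP (chain_derived k_gt0)); apply: memv_bspan.
by rewrite rhoM => /eqP; rewrite subr_eq0 => /eqP.
Qed.

End Fixed.
End Chain.

(** * Components along a split filtration *)

Section FilteredProjections.
Variables (K : fieldType) (V : vectType K) (t : nat) (I M : nat -> {vspace V}).
Hypotheses (I0 : I 0%N = fullv) (It : forall k, (t < k)%N -> I k = 0%VS)
  (MI0 : forall k, (M k :&: I k.+1)%VS = 0%VS) (MI : forall k, (M k + I k.+1)%VS = I k).

Let d k := daddv_pi (M k) (I k.+1).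

(** The projection [d k] is meaningful on [I k] only, so v is first brought into [I k] by removing
    its components of lower index. *)
Fixpoint residue k : 'End(V) :=
  if k is k'.+1 then residue k' - (d k' \o residue k')%VF else \1%VF.

Definition component k : 'End(V) := (d k \o residue k)%VF.

Lemma filt_le i j : (i <= j)%N -> (I j <= I i)%VS.
Proof.
move=> /subnK <-; elim: (j - i)%N => [|k IHk] //=.
by apply: subv_trans IHk; rewrite addSn -(MI (k + i)) addvSr.
Qed.

Let sMI k : (M k <= I k)%VS. Proof. by rewrite -(MI k) addvSl. Qed.

Let d_next k v : v \in I k.+1 -> d k v = 0.
Proof.
move=> vI; have vMI : v \in (M k + I k.+1)%VS by apply: (subvP (addvSr _ _)).
have := daddv_pi_add (MI0 k) vMI.
by rewrite (daddv_pi_id _ vI) 1?capvC ?MI0 // => /(canRL (addrK _)); rewrite subrr.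
Qed.

Let d_sub k v : v \in I k -> v - d k v \in I k.+1.
Proof.
rewrite -MI => vMI; rewrite -{1}(daddv_pi_add (MI0 k) vMI) addrAC subrr add0r.
exact: memv_pi.
Qed.

Lemma mem_component k v : component k v \in M k.
Proof. by rewrite comp_lfunE memv_pi. Qed.

Lemma mem_residue k v : residue k v \in I k.
Proof.
elim: k => [|k IHk] /=; first by rewrite I0 memvf.
by rewrite add_lfunE opp_lfunE comp_lfunE d_sub.
Qed.

Lemma residue_id j k v : v \in I j -> (k <= j)%N -> residue k v = v.
Proof.
move=> vI; elim: k => [|k IHk] le_kj /=; first by rewrite id_lfunE.
rewrite add_lfunE opp_lfunE comp_lfunE IHk ?(ltnW le_kj) //.
by rewrite d_next ?subr0 // (subvP (filt_le le_kj)).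
Qed.

Lemma component_low j k v : v \in I j -> (k < j)%N -> component k v = 0.
Proof.
move=> vI lt_kj; rewrite comp_lfunE (residue_id vI) ?(ltnW lt_kj) //.
by rewrite d_next // (subvP (filt_le lt_kj)).
Qed.

Lemma component_next k v : v \in I k -> component k v = 0 -> v \in I k.+1.
Proof.
move=> vI; rewrite comp_lfunE (residue_id vI) // => dv.
by have := d_sub vI; rewrite dv subr0.
Qed.

Lemma sum_component j v : v \in I j -> v = \sum_(j <= k < t.+1) component k v.
Proof.
move=> vI; have sum_res k : v = \sum_(0 <= i < k) component i v + residue k v.
  elim: k => [|k IHk] /=; first by rewrite big_nil id_lfunE add0r.
  by rewrite big_nat_recr //= -addrA add_lfunE opp_lfunE [component k v + _]addrC subrK.
have [le_jt|lt_tj] := leqP j t.+1; last first.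
  by rewrite big_geq 1?ltnW //; apply/eqP; rewrite -memv0 -(It (ltnW lt_tj)).
rewrite {1}(sum_res t.+1); have := mem_residue t.+1 v; rewrite It // memv0 => /eqP->.
rewrite addr0 (big_cat_nat (leq0n j) le_jt) /= [X in X + _]big_nat big1 ?add0r //.
move=> i /andP[_ lt_ij]; exact: component_low vI lt_ij.
Qed.

Lemma component_equivariant (f : 'End(V)) :
  (forall k v, v \in M k -> f v \in M k) -> (forall k v, v \in I k -> f v \in I k) ->
  forall k v, component k (f v) = f (component k v).
Proof.
move=> fM fI.
have fd k v : v \in I k -> d k (f v) = f (d k v).
  move=> vI; have wI := d_sub vI; rewrite -{1}[v](subrK (d k v)).
  move: (v - d k v) wI => w wI; rewrite !linearD /= d_next ?add0r; last exact: fI.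
  by rewrite /d daddv_pi_id ?MI0 ?fM ?memv_pi.
have fr k v : residue k (f v) = f (residue k v).
  elim: k => [|k IHk] /=; first by rewrite !id_lfunE.
  by rewrite !(add_lfunE, opp_lfunE, comp_lfunE) IHk linearB /= fd ?mem_residue.
by move=> k v; rewrite !comp_lfunE fr fd ?mem_residue.
Qed.

Lemma tail_sumE k : tail_sum t M k = I k.
Proof.
have [m] := ubnP (t.+1 - k)%N; elim: m k => // m IHm k lt_m.
have [lt_tk|le_kt] := ltnP t k; first by rewrite /tail_sum big_geq ?It.
by rewrite /tail_sum big_ltn // -/(tail_sum t M k.+1) IHm ?MI //; lia.
Qed.

Lemma dim_tail_sum k : \dim (I k) = (\sum_(k <= i < t.+1) \dim (M i))%N.
Proof.
have [m] := ubnP (t.+1 - k)%N; elim: m k => // m IHm k lt_m.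
have [lt_tk|le_kt] := ltnP t k; first by rewrite big_geq ?It ?dimv0.
by rewrite big_ltn // -IHm -?dimv_disjoint_sum ?MI //; lia.
Qed.

Lemma filt_direct : (M 0%N + \sum_(1 <= i < t.+1) M i)%VS = fullv /\
  directv (M 0%N + \sum_(1 <= i < t.+1) M i).
Proof.
have E : (M 0%N + \sum_(1 <= i < t.+1) M i)%VS = fullv.
  by rewrite -/(tail_sum t M 1) tail_sumE MI I0.
by split=> //; rewrite directvE /= E -I0 dim_tail_sum big_ltn.
Qed.

End FilteredProjections.

(** * The structure maps of a mixed Lie algebra with a chain of ideals *)

Section ChainForm.
Variables (K : fieldType) (charK0 : [pchar K] =i pred0).
Variables (V : vectType K) (br : V -> V -> V) (br_lie : lie_bracket br).
Variables (t : nat) (I : nat -> {vspace V}).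
Hypotheses (I_chain : ideal_chain br t I) (br_mixed : mixed br).
Let brb := lie_bilin br_lie.

Let I0 : I 0%N = fullv. Proof. by case: I_chain. Qed.
Let It k : (t < k)%N -> I k = 0%VS. Proof. by case: I_chain => _ H _ _ _; apply: H. Qed.
Let idI k : is_ideal br (I k). Proof. by case: I_chain. Qed.
Let t_gt0 : (0 < t)%N. Proof. by case: (chain_radical charK0 br_lie I_chain). Qed.
Let solR : solvable_sub br (I 1%N). Proof. by case: (chain_radical charK0 br_lie I_chain). Qed.
Let br_perfect : bspan br fullv fullv = fullv.
Proof. by case: (chain_radical charK0 br_lie I_chain). Qed.

Let R_proper : I 1%N != fullv.
Proof. by apply/eqP => R; apply: (chain_lt I_chain (ltnSn 0)) => //; rewrite R subvf. Qed.

Let R_max U : is_ideal br U -> (I 1%N <= U)%VS -> U = I 1%N \/ U = fullv.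
Proof.
by move=> idU sRU; rewrite -I0; apply: (chain_between I_chain) => //; rewrite I0 subvf.
Qed.

Lemma chain_decomposition : exists M : nat -> {vspace V},
  [/\ (forall k, (M k :&: I k.+1)%VS = 0%VS), (forall k, (M k + I k.+1)%VS = I k) &
      (forall k u s, u \in M k -> s \in M 0%N -> br u s \in M k)].
Proof.
have [S [Scl SR SR0]] := levi charK0 br_lie (@idI 1) R_proper R_max br_perfect solR.
have /fin_all_exists[M MP] (i : 'I_t.+1) : exists M : {vspace V},
    [/\ (M :&: I i.+1)%VS = 0%VS, (M + I i.+1)%VS = I i &
      forall u s, u \in M -> s \in S -> br u s \in M].
  apply: (weyl_complement charK0 br_lie (@idI 1) R_proper R_max br_perfect) => //.
  - exact: (chain_succ I_chain).
  - by move=> u s uI _; apply: ideal_r.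
  - by move=> u s uI _; apply: ideal_r.
exists (fun k => if k is 0%N then S else if (k <= t)%N then M (inord k) else 0%VS).
have MPk k : (k <= t)%N -> [/\ (M (inord k) :&: I k.+1)%VS = 0%VS,
    (M (inord k) + I k.+1)%VS = I k &
    forall u s, u \in M (inord k) -> s \in S -> br u s \in M (inord k)].
  by move=> le_kt; have := MP (inord k); rewrite inordK.
split=> [[|k]|[|k]|[|k] u s] //.
- by case: ifP => [lek|_]; [case: (MPk _ lek) | rewrite cap0v].
- by rewrite I0.
- case: ifP => [lek|lek]; first by case: (MPk _ lek).
  by rewrite add0v !It //; lia.
- exact: Scl.
- case: ifP => [lek|_]; first by case: (MPk _ lek) => _ _; apply.
  by rewrite !memv0 => /eqP-> _; rewrite (bilin0l brb).
Qed.

Section Decomposed.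
Variable M : nat -> {vspace V}.
Hypotheses (MI0 : forall k, (M k :&: I k.+1)%VS = 0%VS)
  (MI : forall k, (M k + I k.+1)%VS = I k)
  (MS : forall k u s, u \in M k -> s \in M 0%N -> br u s \in M k).

Let S := M 0%N.
Let pr := component I M.

Let SM k s u : s \in S -> u \in M k -> br s u \in M k.
Proof. by move=> sS uM; rewrite (lie_anti br_lie) memvN MS. Qed.

Let sMI k : (M k <= I k)%VS. Proof. by rewrite -(MI k) addvSl. Qed.

Let memMI k v : v \in M k -> v \in I k.+1 -> v = 0.
Proof. by move=> vM vI; apply/eqP; rewrite -memv0 -(MI0 k) memv_cap vM. Qed.

Let splitSR x : exists2 s, s \in S & exists2 r, r \in I 1%N & x = s + r.
Proof.
have : x \in (M 0%N + I 1%N)%VS by rewrite MI I0 memvf.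
by case/memv_addP=> s sS [r rR ->]; exists s => //; exists r.
Qed.

Let radical_triv i u x : u \in I i -> x \in I 1%N -> br u x \in I i.+1.
Proof. exact: (radical_acts_trivially charK0 br_lie I_chain br_mixed). Qed.

Let radical_trivl i u x : u \in I i -> x \in I 1%N -> br x u \in I i.+1.
Proof. by move=> uI xR; rewrite (lie_anti br_lie) memvN radical_triv. Qed.

Lemma M_neq0 k : (k <= t)%N -> M k != 0%VS.
Proof.
move=> le_kt; apply/eqP => M0; apply: (chain_lt I_chain (ltnSn k) le_kt).
by rewrite -(MI k) M0 add0v.
Qed.

(** R sends [I k] into [I k.+1], so between these two ideals only the action of S matters. *)
Lemma ideal_submodule_add k (U : {vspace V}) : (0 < k)%N -> (U <= M k)%VS ->
  (forall s u, s \in S -> u \in U -> br s u \in U) -> is_ideal br (U + I k.+1)%VS.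
Proof.
move=> k_gt0 sUM SU x _ /memv_addP[u uU [v vI ->]].
have [s sS [r rR ->]] := splitSR x.
rewrite (bilinDr brb) (bilinDl brb) -addrA memv_add ?SU //; apply: memvD; last exact: idI.
by rewrite radical_trivl // (subvP (sMI k)) // (subvP sUM).
Qed.

(** Otherwise [R, I j] lies in [I j.+2], which makes [M j + I j.+2] an ideal; it neither contains
    nor lies in [I j.+1]. *)
Lemma radical_lower_central j : (0 < j)%N -> (I j.+1 <= bspan br (I 1%N) (I j))%VS.
Proof.
move=> j_gt0; have idB := ideal_bspan br_lie (@idI 1) (@idI j).
have [lt_tj|lt_jt] := leqP t j; first by rewrite It ?sub0v.
have [sB|//] := chain_comparable I_chain j.+1 idB.
have brRI x y : x \in I 1%N -> y \in I j -> br x y \in I j.+2.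
  by move=> xR yI; apply: (subvP sB); apply: memv_bspan.
have idW : is_ideal br (M j + I j.+2)%VS.
  move=> x _ /memv_addP[u uM [v vI ->]]; have [s sS [r rR ->]] := splitSR x.
  rewrite (bilinDr brb) (bilinDl brb) -addrA memv_add ?SM //; apply: memvD; last exact: idI.
  by rewrite brRI // (subvP (sMI j)).
have [sW|sW] := chain_comparable I_chain j idW.
  have /eqP[] := M_neq0 (ltnW lt_jt); apply/eqP; rewrite -subv0; apply/subvP=> u uM.
  rewrite memv0 (memMI uM) // (subvP sW) // (subvP (addvSl _ _)) //.
case: (chain_lt I_chain (ltnSn j.+1)) => //; apply/subvP=> v vI.
have /memv_addP[m mM [w wI vE]] : v \in (M j + I j.+2)%VS.
  by apply: (subvP sW); apply: (subvP (chain_succ I_chain j)).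
have m0 : m = 0.
  apply: (memMI mM); rewrite -[m](addrK w) -vE memvB //.
  exact: (subvP (chain_succ I_chain _)).
by rewrite vE m0 add0r.
Qed.

(** Induction on i: elements of [I i.+2] are sums of brackets of R with [I i.+1], and the Jacobi
    identity moves R outside. *)
Lemma filt_bracket i j u v : (0 < i)%N -> u \in I i -> v \in I j -> br u v \in I (i + j)%N.
Proof.
case: i => // i _; elim: i j u v => [|i IHi] j u v uI vI; first by rewrite add1n radical_trivl.
move: u {uI}(subvP (radical_lower_central (ltn0Sn i)) _ uI).
apply: (bspan_ind brb) => [|a x y xI yI|r w rR wI].
- by rewrite (bilin0l brb) mem0v.
- by rewrite (bilinDl brb) (bilinZl brb) memvD ?memvZ.
have -> : br (br r w) v = br r (br w v) + br (br r v) w.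
  by rewrite (lie_jacobi br_lie) subrK.
rewrite memvD //; first by rewrite addSn radical_trivl ?IHi.
by rewrite (lie_anti br_lie) memvN addSnnS IHi // radical_trivl.
Qed.

Lemma sum_pr j v : v \in I j -> v = \sum_(j <= k < t.+1) pr k v.
Proof. exact: (sum_component I0 It MI0 MI). Qed.

Lemma pr_equivariant k s v : s \in S -> pr k (br s v) = br s (pr k v).
Proof.
move=> sS; pose f : 'End(V) := linfun (br s).
have fE u : f u = br s u := linear_lfunE (brb.2 s) u.
rewrite -!fE; apply: (component_equivariant I0 MI0 MI) => j u; rewrite fE; first exact: SM.
exact: idI.
Qed.

(** The truncation of l at t - i in condition (iii) loses nothing, because the missing brackets lie
    in [I (i + l)] = 0. Each double sum of (iii) is thus an iterated bracket. *)
Lemma radical_bracket_sum i a u x : (0 < i)%N -> (i + a <= t)%N -> u \in M i -> x \in I a ->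
  \sum_(a <= l < (t - i).+1) \sum_(i + l <= r < t.+1) pr r (br u (pr l x)) = br u x.
Proof.
move=> i_gt0 le_iat uM xI; have uI := subvP (sMI i) _ uM.
have pI l : pr l x \in I l by apply: (subvP (sMI l)); apply: mem_component.
rewrite [in RHS](sum_pr xI) (bilin_sumr brb).
have le1 : (a <= (t - i).+1)%N by lia.
have le2 : ((t - i).+1 <= t.+1)%N by lia.
rewrite [RHS](big_cat_nat le1 le2) /= [X in _ = _ + X]big_nat.
rewrite [X in _ = _ + X]big1 ?addr0 => [|l /andP[le_l _]].
  by apply: eq_bigr => l _; rewrite -sum_pr // filt_bracket.
apply/eqP; rewrite -memv0 -(@It (i + l)%N); last by lia.
exact: filt_bracket.
Qed.

(** An ideal U of S gives the ideal U + R of g, and R is maximal; an abelian S would put [g, g]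
    inside R, against perfectness. *)
Lemma simple_on_S : simple_on S br.
Proof.
have Scl x y : x \in S -> y \in S -> br x y \in S by move=> xS; apply: SM.
split.
- have [_ brxx jac] := br_lie; split=> //.
  by split=> *; rewrite ?(bilinDl brb, bilinZl brb) ?(bilinDr brb, bilinZr brb).
- apply: NNPP => nS; case/eqP: R_proper; apply/eqP; rewrite eqEsubv subvf -br_perfect.
  apply/(bspanP brb) => x y _ _.
  have [s sS [r rR ->]] := splitSR x; have [s' s'S [r' r'R ->]] := splitSR y.
  rewrite (bilinDr brb) !(bilinDl brb); have -> : br s s' = 0.
    by apply/eqP; apply/negP => /negP ss'; apply: nS; exists s, s'.
  rewrite add0r; apply: memvD; first exact: ideal_r.
  by apply: memvD; apply: idI.
- move=> U sUS SU; have idW : is_ideal br (U + I 1%N)%VS.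
    move=> x _ /memv_addP[u uU [v vI ->]]; have [s sS [r rR ->]] := splitSR x.
    rewrite (bilinDr brb) (bilinDl brb) -addrA memv_add ?SU //; apply: memvD; last exact: idI.
    by rewrite ideal_r.
  have [UE|UE] := R_max idW (addvSr _ _); [left|right].
    apply/eqP; rewrite -subv0; apply/subvP=> u uU; rewrite memv0.
    by rewrite (@memMI 0%N u) ?(subvP sUS) // -UE (subvP (addvSl _ _)).
  apply: subv_anti; rewrite sUS; apply/subvP=> s sS.
  have : s \in (U + I 1%N)%VS by rewrite UE memvf.
  case/memv_addP=> u uU [r rR sE].
  have r0 : r = 0.
    apply: (@memMI 0%N) => //; rewrite -[r](addKr u) -sE.
    by apply: memvD; rewrite ?memvN //; apply: (subvP sUS).
  by rewrite sE r0 addr0.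
Qed.

Lemma irreducible_M i : (0 < i <= t)%N -> irreducible_rep S (M i) br.
Proof.
case/andP=> i_gt0 le_it; split=> [|U sUM SU]; first exact: M_neq0.
have idW := ideal_submodule_add i_gt0 sUM SU.
have sWI : (U + I i.+1 <= I i)%VS.
  by rewrite subv_add (chain_succ I_chain) (subv_trans sUM).
have [UE|UE] := chain_between I_chain idW (addvSr _ _) sWI; [left|right].
  apply/eqP; rewrite -subv0; apply/subvP=> u uU; rewrite memv0.
  by rewrite (@memMI i u) ?(subvP sUM) // -UE (subvP (addvSl _ _)).
apply: subv_anti; rewrite sUM; apply/subvP=> m mM.
have : m \in (U + I i.+1)%VS by rewrite UE (subvP (sMI i)).
case/memv_addP=> u uU [r rR mE].
have r0 : r = 0.
  apply: (@memMI i) => //; rewrite -[r](addKr u) -mE.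
  by apply: memvD; rewrite ?memvN //; apply: (subvP sUM).
by rewrite mE r0 addr0.
Qed.

(** The kernel is an ideal of the simple algebra S. Were it all of S, then [S + I 2] would be an
    ideal incomparable with [I 1]. *)
Lemma faithful_M1 : faithful_rep S (M 1%N) br.
Proof.
have [||U UP] := @exists_vspace K V (fun s => s \in S /\ forall u, u \in M 1%N -> br s u = 0).
- by split=> [|u _]; rewrite ?mem0v // (bilin0l brb).
- move=> a x y [xS x0] [yS y0]; split=> [|u uM]; first by rewrite memvD ?memvZ.
  by rewrite (bilinDl brb) (bilinZl brb) x0 // y0 // scaler0 addr0.
have [_ _ simpS] := simple_on_S.
have [||U0|US] := simpS U.
- by apply/subvP=> x /UP[].
- move=> x y xS /UP[yS y0]; apply/UP; split=> [|u uM]; first exact: SM.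
  have -> : br (br x y) u = br x (br y u) + br (br x u) y.
    by rewrite (lie_jacobi br_lie) subrK.
  by rewrite (y0 _ uM) (bilin0r brb) add0r (lie_anti br_lie) y0 ?oppr0 // SM.
- by move=> s sS s0; apply/eqP; rewrite -memv0 -U0; apply/UP.
have S0 s u : s \in S -> u \in M 1%N -> br s u = 0.
  by rewrite -US => /UP[_ sM] uM; apply: sM.
have idW : is_ideal br (S + I 2)%VS.
  move=> x _ /memv_addP[u uU [v vI ->]]; have [s sS [r rR ->]] := splitSR x.
  rewrite (bilinDr brb) (bilinDl brb) -addrA memv_add ?SM //; apply: memvD; last exact: idI.
  move: rR; rewrite -(MI 1) => /memv_addP[m mM [w wI ->]].
  by rewrite (bilinDl brb) (lie_anti br_lie m) S0 // oppr0 add0r ideal_r.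
have [sW|sW] := chain_comparable I_chain 0%N idW.
  have /eqP[] := M_neq0 (leq0n t); apply/eqP; rewrite -subv0; apply/subvP=> u uS.
  by rewrite memv0 (@memMI 0%N u) // (subvP sW) // (subvP (addvSl _ _)).
case: (chain_lt I_chain (ltnSn 1)) => //; apply/subvP=> v vI.
have : v \in (S + I 2)%VS by apply: (subvP sW); rewrite I0 memvf.
case/memv_addP=> s sS [w wI vE].
have s0 : s = 0.
  apply: (@memMI 0%N) => //; rewrite -[s](addrK w) -vE memvB //.
  exact: (subvP (chain_succ I_chain 1)).
by rewrite vE s0 add0r.
Qed.

Lemma chain_form : of_chain_form t S M br (fun=> br) (fun _ _ k u v => pr k (br u v)) br.
Proof.
have bil A B : bilin_on A B br.
  by split=> *; rewrite ?(bilinDl brb, bilinZl brb) ?(bilinDr brb, bilinZr brb).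
split; split.
- exact: t_gt0.
- exact: simple_on_S.
- move=> i it; split; last exact: irreducible_M.
  split=> // [s u|s s' u _ _ _]; first exact: SM.
  by rewrite [in RHS](lie_jacobi br_lie s) [br (br s u) s'](lie_anti br_lie) opprK addrK.
- exact: faithful_M1.
- move=> i j k _; split=> [u v _ _||s u v sS _ _]; first exact: mem_component.
    split=> *; rewrite ?(bilinDl brb, bilinZl brb) ?(bilinDr brb, bilinZr brb);
    by rewrite linearD linearZ.
  rewrite -pr_equivariant // (lie_jacobi br_lie s) linearB /=; congr (_ + _).
  by rewrite (lie_anti br_lie u) linearN.
- by move=> i k _ u v _ _; rewrite -linearN -(lie_anti br_lie).
(* If the leading component of the bracket vanished on M 1 and M j, the bracket of R with [I j]
   would fall into [I j.+2], against [radical_lower_central]. *)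
- move=> j /andP[j_gt0 lt_jt]; apply: NNPP => nex.
  have lt_jt' : (j.+1 <= t)%N by lia.
  apply: (chain_lt I_chain (ltnSn j.+1) lt_jt').
  apply: subv_trans (radical_lower_central j_gt0) _; apply/(bspanP brb) => x y xR yI.
  move: xR yI; rewrite -{1}(MI 1) -{1}(MI j).
  move=> /memv_addP[u uM [x' x'I ->]] /memv_addP[v vM [y' y'I ->]].
  have uI := subvP (sMI 1) _ uM; have vI := subvP (sMI j) _ vM.
  have x'R := subvP (chain_succ I_chain 1) _ x'I.
  rewrite (bilinDl brb) memvD //; last first.
    rewrite -[j.+2]/(2 + j)%N filt_bracket // memvD //.
    exact: (subvP (chain_succ I_chain j)).
  rewrite (bilinDr brb) memvD //; last by rewrite radical_trivl.
  apply: (component_next MI0 MI); first by rewrite radical_trivl.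
  by apply/eqP/negPn/negP => H; apply: nex; exists u, v; split.
- move=> i j k /and4P[i_gt0 le_ij le_jk le_t] u v w uM vM wM.
  have uI := subvP (sMI i) _ uM; have vI := subvP (sMI j) _ vM; have wI := subvP (sMI k) _ wM.
  (* For components of an anticommutative bracket both branches of [phat] agree, so (iii) becomes
     the Jacobi identity. *)
  have phatE l r x : phat (fun _ _ k u v => pr k (br u v)) k l r w x = pr r (br w x).
    by rewrite /phat; case: leqP => // _; rewrite (lie_anti br_lie x) linearN opprK.
  under [X in _ + X]eq_bigr => l _ do under eq_bigr => r _ do rewrite phatE.
  rewrite !radical_bracket_sum ?filt_bracket //; try lia.
  rewrite (lie_jacobi br_lie u v w) (lie_anti br_lie w) (lie_anti br_lie v (br u w)).
  by rewrite opprK subrK subrr.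
- exact: (filt_direct I0 It MI0 MI).
- by split=> // x y; apply: lie_anti.
- by [].
- by [].
- move=> i j u v i_gt0 /andP[le_ij _] uM vM; apply: sum_pr.
  by apply: filt_bracket => //; [apply: (subvP (sMI i)) | apply: (subvP (sMI j))].
Qed.

End Decomposed.
End ChainForm.

Theorem mixed_chain_form (K : fieldType) (charK0 : [pchar K] =i pred0) t (V : vectType K) br :
  lie_bracket br -> mixed br -> ideal_lattice_chain br (t + 2) ->
  exists (S : {vspace V}) (M : nat -> {vspace V}) (bS : V -> V -> V)
         (rho : nat -> V -> V -> V) (p : nat -> nat -> nat -> V -> V -> V),
    of_chain_form t S M bS rho p br.
Proof.
move=> br_lie br_mixed /(exists_ideal_chain br_lie)[I I_chain].
have [M [MI0 MI MS]] := chain_decomposition charK0 br_lie I_chain br_mixed.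
exists (M 0%N), M, br, (fun=> br), (fun _ _ k u v => component I M k (br u v)).
exact: chain_form.
Qed.

(** * Ideals of the constructed Lie algebra *)

Section ChainFormIdeals.
Variables (K : fieldType) (charK0 : [pchar K] =i pred0).
Variables (t : nat) (V : vectType K) (S : {vspace V}) (M : nat -> {vspace V})
  (bS : V -> V -> V) (rho : nat -> V -> V -> V) (p : nat -> nat -> nat -> V -> V -> V)
  (br : V -> V -> V).
Hypothesis form : of_chain_form t S M bS rho p br.

Let T := tail_sum t M.

Let t_gt0 : (0 < t)%N. Proof. by case: form => -[]. Qed.
Let simpS : simple_on S bS. Proof. by case: form => -[]. Qed.
Let repM i : (1 <= i <= t)%N -> rep_on S bS (M i) (rho i) /\ irreducible_rep S (M i) (rho i).
Proof. by case: form => -[_ _ H _ _] _ _; apply: H. Qed.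
Let faithM : faithful_rep S (M 1%N) (rho 1%N). Proof. by case: form => -[]. Qed.
Let homp i j k : [&& 1 <= i, i <= j, j <= k, k <= t & i + j <= k]%N ->
  module_hom2 S (M i) (M j) (M k) (rho i) (rho j) (rho k) (p i j k).
Proof. by case: form => -[_ _ _ _ H] _ _; apply: H. Qed.

Let brb : bilin br.
Proof.
case: form => _ _ [_ [[brl brr] _] _ _ _].
by split=> [y|x] a u v; [apply: brl | apply: brr]; apply: memvf.
Qed.
Let anti x y : br x y = - br y x. Proof. by case: form => _ _ [_ [_ H] _ _ _]. Qed.
Let brS s s' : s \in S -> s' \in S -> br s s' = bS s s'.
Proof. by case: form => _ _ [_ _ H _ _]; apply: H. Qed.
Let brM i s u : (1 <= i <= t)%N -> s \in S -> u \in M i -> br s u = rho i s u.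
Proof. by case: form => _ _ [_ _ _ H _]; apply: H. Qed.
Let brMM i j u v : (1 <= i)%N -> (i <= j <= t)%N -> u \in M i -> v \in M j ->
  br u v = \sum_(i + j <= k < t.+1) p i j k u v.
Proof. by case: form => _ _ [_ _ _ _ H]; apply: H. Qed.

Let SM s i u : (1 <= i <= t)%N -> s \in S -> u \in M i -> br s u \in M i.
Proof. by move=> it sS uM; rewrite (brM it) //; have [[H _ _] _] := repM it; apply: H. Qed.

Let SS s s' : s \in S -> s' \in S -> br s s' \in S.
Proof. by move=> sS s'S; rewrite brS //; have [[H _ _ _] _ _] := simpS; apply: H. Qed.

Let full : (S + T 1)%VS = fullv. Proof. by case: form => _ _ [[]]. Qed.

Let splitSR x : exists2 s, s \in S & exists2 r, r \in T 1%N & x = s + r.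
Proof.
have : x \in (S + T 1%N)%VS by rewrite full memvf.
by case/memv_addP=> s sS [r rR ->]; exists s => //; exists r.
Qed.

Let T_gt k : (t < k)%N -> T k = 0%VS. Proof. by move=> lt_tk; rewrite /T /tail_sum big_geq. Qed.
Let T_rec k : (k <= t)%N -> T k = (M k + T k.+1)%VS.
Proof. by move=> le_kt; rewrite /T /tail_sum big_ltn. Qed.

Let T_le i j : (i <= j)%N -> (T j <= T i)%VS.
Proof.
move=> /subnK <-; elim: (j - i)%N => [|k IHk] //=; apply: subv_trans IHk; rewrite addSn.
have [lt_t|le_t] := ltnP t (k + i)%N; last by rewrite (T_rec le_t) addvSr.
by rewrite !T_gt // ltnW.
Qed.

Let sMT k : (k <= t)%N -> (M k <= T k)%VS. Proof. by move=> /T_rec->; apply: addvSl. Qed.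

Lemma tail_sum_sub k (U : {vspace V}) :
  (forall i, (k <= i <= t)%N -> (M i <= U)%VS) -> (T k <= U)%VS.
Proof.
move=> MU; rewrite /T /tail_sum big_nat; elim/big_ind: _ => [|A B sA sB|i ik].
- exact: sub0v.
- by rewrite subv_add sA.
- by apply: MU; rewrite -ltnS.
Qed.

Let p_mem i j k u v : (1 <= i)%N -> (i <= j)%N -> (k <= t)%N -> (i + j <= k)%N ->
  u \in M i -> v \in M j -> p i j k u v \in M k.
Proof.
by move=> i1 ij kt ijk uM vM; have [|H _ _] := @homp i j k; [lia | apply: H].
Qed.

Let MM_le i j u v : (1 <= i)%N -> (i <= j <= t)%N -> u \in M i -> v \in M j ->
  br u v \in T (i + j)%N.
Proof.
move=> i1 ijt uM vM; rewrite (brMM i1 ijt) // big_nat; apply: memv_suml => k /andP[le_k lt_k].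
by apply: (subvP (T_le le_k)); apply: (subvP (sMT _)) => //; apply: p_mem => //; lia.
Qed.

Let MM i j u v : (1 <= i <= t)%N -> (1 <= j <= t)%N -> u \in M i -> v \in M j ->
  br u v \in T (i + j)%N.
Proof.
move=> it jt uM vM; have [le_ij|lt_ji] := leqP i j; first by apply: MM_le => //; lia.
by rewrite anti memvN addnC; apply: MM_le => //; lia.
Qed.

Let TT i j x y : (1 <= i)%N -> (1 <= j)%N -> x \in T i -> y \in T j -> br x y \in T (i + j)%N.
Proof.
move=> i1 j1 xT yT.
have [||U UP] := @exists_vspace K V (fun x => forall y, y \in T j -> br x y \in T (i + j)%N).
- by move=> z _; rewrite (bilin0l brb) mem0v.
- by move=> a u v uT vT z zT; rewrite (bilinDl brb) (bilinZl brb) memvD ?memvZ ?uT ?vT.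
suff /subvP sTU : (T i <= U)%VS by have /UP := sTU x xT; apply.
apply: tail_sum_sub => k ik; apply/subvP=> u uM; apply/UP => {x y xT yT}.
have [||W WP] := @exists_vspace K V (fun y => br u y \in T (i + j)%N).
- by rewrite (bilin0r brb) mem0v.
- by move=> a x y; rewrite (bilinDr brb) (bilinZr brb) => xT yT; rewrite memvD ?memvZ.
suff /subvP sTW : (T j <= W)%VS by move=> y /sTW/WP.
apply: tail_sum_sub => l jl; apply/subvP=> v vM; apply/WP.
have le_ij : (i + j <= k + l)%N by lia.
by apply: (subvP (T_le le_ij)); apply: MM => //; lia.
Qed.

Let ST k s x : (1 <= k)%N -> s \in S -> x \in T k -> br s x \in T k.
Proof.
move=> k1 sS xT.
have [||U UP] := @exists_vspace K V (fun x => br s x \in T k).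
- by rewrite (bilin0r brb) mem0v.
- by move=> a u v; rewrite (bilinDr brb) (bilinZr brb) => uT vT; rewrite memvD ?memvZ.
suff /subvP sTU : (T k <= U)%VS by apply/UP/sTU.
apply: tail_sum_sub => i ki; apply/subvP=> u uM; apply/UP.
have [le_ki le_it] := andP ki; apply: (subvP (T_le le_ki)); apply: (subvP (sMT le_it)).
by apply: SM => //; lia.
Qed.

(** Skew-symmetry gives 2 [x, x] = 0, and 2 is nonzero in K. *)
Let brxx x : br x x = 0.
Proof.
have /eqP := anti x x; rewrite -addr_eq0 -mulr2n -scaler_nat scaler_eq0.
by rewrite (proj1 (pcharf0P K) charK0) => /eqP.
Qed.

Let jac x y z := br x (br y z) + br y (br z x) + br z (br x y).

Let jacC x y z : jac x y z = jac y z x.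
Proof. by rewrite /jac addrC addrA addrC addrA. Qed.

Let jac_swap x y z : jac y x z = - jac x y z.
Proof.
rewrite /jac (anti x z) (anti z y) (anti y x) !(bilinNr brb) -!opprD; congr (- _).
by rewrite [X in X + _]addrC.
Qed.

Lemma homogeneous_ind (P : V -> Prop) : P 0 -> (forall a u v, P u -> P v -> P (a *: u + v)) ->
  (forall s, s \in S -> P s) -> (forall i u, (1 <= i <= t)%N -> u \in M i -> P u) ->
  forall x, P x.
Proof.
move=> P0 PP PS PM x; have [U UP] := exists_vspace P0 PP.
apply/UP; have : x \in (S + T 1)%VS by rewrite full memvf.
apply: subvP; rewrite subv_add; apply/andP; split; first by apply/subvP=> s /PS/UP.
by apply: tail_sum_sub => i it; apply/subvP=> u uM; apply/UP/(PM i).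
Qed.

Let jac_SSS s s' s'' : s \in S -> s' \in S -> s'' \in S -> jac s s' s'' = 0.
Proof.
move=> sS s'S s''S; have [[_ _ _ H] _ _] := simpS.
have E a b c : a \in S -> b \in S -> c \in S -> br a (br b c) = bS a (bS b c).
  by move=> aS bS' cS; rewrite (brS aS (SS bS' cS)) (brS bS' cS).
by rewrite /jac !E // H.
Qed.

Let jac_SSM i s s' u : (1 <= i <= t)%N -> s \in S -> s' \in S -> u \in M i -> jac s s' u = 0.
Proof.
move=> it sS s'S uM; have [[_ _ H] _] := repM it.
have := H s s' u sS s'S uM; rewrite -brS // -!(brM it) ?SS ?SM //.
- move=> E; rewrite /jac (anti u (br s s')) E (anti u s) (bilinNr brb).
  by rewrite opprB addrA subrK subrr.
Qed.

Let jac_SMM i j s u v : (1 <= i)%N -> (i <= j <= t)%N -> s \in S -> u \in M i -> v \in M j ->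
  jac s u v = 0.
Proof.
move=> i1 ijt sS uM vM; have it : (1 <= i <= t)%N by lia.
have jt : (1 <= j <= t)%N by lia.
suff E : br s (br u v) = br (br s u) v + br u (br s v).
  by rewrite /jac E (anti v (br s u)) (anti v s) (bilinNr brb) addrK subrr.
rewrite (brMM i1 ijt uM vM) (brMM i1 ijt (SM it sS uM) vM) (brMM i1 ijt uM (SM jt sS vM)).
rewrite (bilin_sumr brb) -big_split !big_nat; apply: eq_bigr => k /andP[le_k lt_k] /=.
have [|_ _ H] := @homp i j k; first by lia.
rewrite (@brM k) ?p_mem //; try lia.
by rewrite (brM it sS uM) (brM jt sS vM) H.
Qed.

Let br_br i j k u v w : (1 <= i)%N -> (1 <= j <= k)%N -> (k <= t)%N -> (i <= j + k)%N ->
  (i <= t)%N ->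
  u \in M i -> v \in M j -> w \in M k ->
  br u (br v w) = \sum_(j + k <= l < (t - i).+1) \sum_(i + l <= r < t.+1) p i l r u (p j k l v w).
Proof.
move=> i1 jk kt ijk it uM vM wM; rewrite (brMM _ _ vM wM); try lia.
rewrite (bilin_sumr brb).
transitivity (\sum_(j + k <= l < t.+1) \sum_(i + l <= r < t.+1) p i l r u (p j k l v w)).
  rewrite !big_nat; apply: eq_bigr => l /andP[le_l lt_l]; rewrite (@brMM i l) //; try lia.
  by apply: p_mem => //; lia.
have [le1|lt1] := leqP (j + k) (t - i).+1; last first.
  rewrite [RHS]big_geq 1?ltnW // big_nat big1 // => l /andP[le_l _].
  by rewrite big_geq //; lia.
have le2 : ((t - i).+1 <= t.+1)%N by lia.
rewrite (big_cat_nat le1 le2) /= [X in _ + X]big_nat [X in _ + X]big1 ?addr0 // => l /andP[le_l _].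
by rewrite big_geq //; lia.
Qed.

(** The inner degree l starts at i + j and may lie on either side of k, whence the two branches and
    the sign in [phat]. *)
Let br_br_hat i j k u v w : (1 <= i <= j)%N -> (j <= k <= t)%N ->
  u \in M i -> v \in M j -> w \in M k ->
  br w (br u v) = \sum_(i + j <= l < (t - k).+1)
    \sum_(k + l <= r < t.+1) phat p k l r w (p i j l u v).
Proof.
move=> ij jk uM vM wM; rewrite (brMM _ _ uM vM); try lia.
rewrite (bilin_sumr brb).
have le2 : ((t - k).+1 <= t.+1)%N by lia.
have pM l : (i + j <= l < t.+1)%N -> p i j l u v \in M l by move=> lt_l; apply: p_mem => //; lia.
transitivity (\sum_(i + j <= l < t.+1) \sum_(k + l <= r < t.+1) phat p k l r w (p i j l u v)).
  rewrite !big_nat; apply: eq_bigr => l lt_l; rewrite /phat.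
  have [le_kl|lt_lk] := leqP k l.
    by rewrite (@brMM k l) ?pM //; lia.
  by rewrite anti (@brMM l k) ?pM //; [rewrite sumrN addnC | lia..].
have [le1|lt1] := leqP (i + j) (t - k).+1; last first.
  rewrite [RHS]big_geq 1?ltnW // big_nat big1 // => l /andP[le_l _].
  by rewrite big_geq //; lia.
rewrite (big_cat_nat le1 le2) /= [X in _ + X]big_nat [X in _ + X]big1 ?addr0 // => l /andP[le_l _].
by rewrite big_geq //; lia.
Qed.

Let jac_MMM i j k u v w : (1 <= i)%N -> (i <= j)%N -> (j <= k)%N -> (k <= t)%N ->
  u \in M i -> v \in M j -> w \in M k -> jac u v w = 0.
Proof.
move=> i1 ij jk kt uM vM wM.
have uT : u \in T i by apply: (subvP (sMT _)) => //; lia.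
have vT : v \in T j by apply: (subvP (sMT _)) => //; lia.
have wT : w \in T k by apply: (subvP (sMT _)) => //; lia.
have [le_t|lt_t] := leqP (i + j + k)%N t.
  have := form; case=> _ [_ _ H] _; have := H i j k _ u v w uM vM wM.
  rewrite -br_br -?br_br -?br_br_hat //; try lia.
  move=> E; rewrite /jac (anti w u) (bilinNr brb); apply: E; lia.
(* Beyond total degree t condition (iii) says nothing, but all three terms lie in a zero tail. *)
have T0 x : x \in T (i + j + k)%N -> x = 0 by rewrite T_gt // memv0 => /eqP.
have TT3 a b c x y z : (1 <= a)%N -> (1 <= b)%N -> (1 <= c)%N -> (a + (b + c) = i + j + k)%N ->
    x \in T a -> y \in T b -> z \in T c -> br x (br y z) = 0.
  by move=> a1 b1 c1 E xT yT zT; apply: T0; rewrite -E; apply: TT => //; [lia | apply: TT].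
have j1 := leq_trans i1 ij; have k1 := leq_trans j1 jk.
rewrite /jac (TT3 i j k u) ?(TT3 j k i v) ?(TT3 k i j w) ?addr0 //; lia.
Qed.

(* Homogeneous elements of S (degree 0) and of the M i. *)
Let N i := if i is 0%N then S else M i.

Let jac_sorted i j k u v w : (i <= j)%N -> (j <= k)%N -> (k <= t)%N ->
  u \in N i -> v \in N j -> w \in N k -> jac u v w = 0.
Proof.
case: i => [|i]; case: j => [|j]; case: k => [|k] //= ij jk kt uN vN wN.
- exact: jac_SSS.
- by apply: (@jac_SSM k.+1).
- by apply: (@jac_SMM j.+1 k.+1) => //; lia.
- by apply: (@jac_MMM i.+1 j.+1 k.+1).
Qed.

(** The Jacobi sum is invariant under cyclic shifts and changes sign under a transposition, so
    sorted degrees suffice. *)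
Let jac_hom i j k u v w : (i <= t)%N -> (j <= t)%N -> (k <= t)%N ->
  u \in N i -> v \in N j -> w \in N k -> jac u v w = 0.
Proof.
move=> it jt kt uN vN wN.
have sw x y z : jac x y z = 0 -> jac y x z = 0 by move=> H; rewrite jac_swap H oppr0.
have [ij|/ltnW ij] := leqP i j; have [jk|/ltnW jk] := leqP j k; have [ik|/ltnW ik] := leqP i k.
- exact: (@jac_sorted i j k).
- exact: (@jac_sorted i j k).
- by rewrite jacC jacC; apply: sw; apply: (@jac_sorted i k j).
- by rewrite jacC jacC; apply: (@jac_sorted k i j).
- by apply: sw; apply: (@jac_sorted j i k).
- by rewrite jacC; apply: (@jac_sorted j k i).
- by apply: sw; rewrite jacC jacC; apply: (@jac_sorted k j i).
- by apply: sw; rewrite jacC jacC; apply: (@jac_sorted k j i).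
Qed.

Lemma chain_form_lie : lie_bracket br.
Proof.
split=> [|//|].
  by split=> *; rewrite ?(bilinDl brb, bilinZl brb) ?(bilinDr brb, bilinZr brb).
suff H x y z : jac x y z = 0 by exact: H.
have jac0 y' z' : jac 0 y' z' = 0.
  by rewrite /jac !(bilin0l brb, bilin0r brb) !addr0.
have jacD a x1 x2 y' z' : jac x1 y' z' = 0 -> jac x2 y' z' = 0 -> jac (a *: x1 + x2) y' z' = 0.
  have -> : jac (a *: x1 + x2) y' z' = a *: jac x1 y' z' + jac x2 y' z'.
    rewrite /jac !(bilinDl brb, bilinDr brb, bilinZl brb, bilinZr brb).
    by vring.
  by move=> -> ->; rewrite scaler0 addr0.
have hom (P : V -> Prop) : P 0 -> (forall a u v, P u -> P v -> P (a *: u + v)) ->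
  (forall i u, (i <= t)%N -> u \in N i -> P u) -> forall x, P x.
  move=> P0 PP PN; apply: homogeneous_ind => // [s sS|i u it uM]; first exact: (PN 0%N).
  by apply: (PN i); [lia | case: i it uM].
move: x; apply: (hom (fun x => jac x y z = 0)) => // [a u v|i u it uN]; first exact: jacD.
rewrite jacC; move: y; apply: (hom (fun y => jac y z u = 0)) => // [a x y|j v jt vN].
  exact: jacD.
rewrite jacC; move: z; apply: (hom (fun z => jac z u v = 0)) => // [a x y|k w kt wN].
  exact: jacD.
by rewrite jacC; apply: (@jac_hom i j k).
Qed.

(** Subadditivity bounds the dimension of every tail from above. Directness of the whole sum gives
    equality at the first tail, and cancelling [\dim (M k)] passes it on to the next. *)
Let dimT k : (1 <= k)%N -> \dim (T k) = (\sum_(k <= i < t.+1) \dim (M i))%N.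
Proof.
have le_dim l : (\dim (T l) <= \sum_(l <= i < t.+1) \dim (M i))%N.
  have [m] := ubnP (t.+1 - l)%N; elim: m l => // m IHm l lt_m.
  have [lt_tl|le_lt] := ltnP t l; first by rewrite T_gt // dimv0.
  rewrite T_rec // big_ltn //; apply: leq_trans (leq_add (leqnn _) (IHm l.+1 _)); last by lia.
  by rewrite -dimv_sum_cap leq_addr.
move=> k1; apply/eqP; rewrite eqn_leq le_dim /=; elim: k k1 => // -[|k] IHk _.
  have [_ _ [[_ dS] _ _ _ _]] := form; move: dS; rewrite directvE /= => /eqP dS.
  by rewrite -(leq_add2l (\dim S)) -dS -/(T 1) -dimv_sum_cap leq_addr.
have := IHk isT; have [lt_t|le_t] := leqP k.+2 t.+1; last first.
  by rewrite [in X in _ -> X]big_geq // ltnW.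
have lek : (k.+1 <= t)%N by lia.
rewrite big_ltn // T_rec // => H; rewrite -(leq_add2l (\dim (M k.+1))); apply: leq_trans H _.
by rewrite -dimv_sum_cap leq_addr.
Qed.

Lemma chain_form_proper k : (1 <= k <= t)%N -> vproper (T k.+1) (T k).
Proof.
move=> kt; have [k1 le_kt] := andP kt; rewrite /vproper T_le //=.
apply/eqP => E; have := congr1 (fun U => \dim U) E; rewrite !dimT // [in RHS]big_ltn //.
have [_ [M0 _]] := repM kt; have dM : (0 < \dim (M k))%N by rewrite lt0n dimv_eq0.
by move=> dE; move: dM; rewrite -(ltn_add2r (\sum_(k.+1 <= i < t.+1) \dim (M i))) -dE ltnn.
Qed.

Lemma chain_form_radical_proper : vproper (T 1) fullv.
Proof.
rewrite /vproper subvf; apply/eqP => E.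
have [_ _ [[_ dS] _ _ _ _]] := form; move: dS; rewrite directvE /= => /eqP.
rewrite -/(tail_sum t M 1) -/T -dimT // full -E => dE.
have S0 : S = 0%VS by apply/eqP; rewrite -dimv_eq0 -(eqn_add2r (\dim (T 1))) -dE.
have [_ [s [s' [sS s'S /eqP H]]] _] := simpS; case: H.
by apply/eqP; rewrite -memv0 -S0 -brS ?SS.
Qed.

Let stable_M i (U : {vspace V}) : (1 <= i <= t)%N -> (U <= M i)%VS -> U != 0%VS ->
  (forall s u, s \in S -> u \in U -> br s u \in U) -> U = M i.
Proof.
move=> it sUM U0 SU; have [_ [_ H]] := repM it.
case: (H U sUM) => // [s u sS uU|UE]; last by rewrite UE eqxx in U0.
by rewrite -(brM it) ?SU // (subvP sUM).
Qed.

Let lie := chain_form_lie.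

(** The intersection of the two sides is an S-submodule of the irreducible [M j.+1]. It contains the
    values of [p 1 j j.+1], which differ from brackets by terms of degree at least j + 2. *)
Let M_succ j : (1 <= j)%N -> (j < t)%N -> (M j.+1 <= bspan br (M 1%N) (M j) + T j.+2)%VS.
Proof.
move=> j1 jt; set B := bspan _ _ _.
suff <- : (M j.+1 :&: (B + T j.+2))%VS = M j.+1 by apply: capvSr.
apply: stable_M; rewrite ?capvSl //.
  have [_ [_ H _] _] := form; have [|u [v [uM vM p0]]] := H j; first by lia.
  apply: contraNneq p0 => E; rewrite -memv0 -E memv_cap p_mem //=; try lia.
  have := brMM (isT : (1 <= 1)%N) (_ : (1 <= j <= t)%N) uM vM.
  rewrite add1n big_ltn //= => brE.
  have -> : p 1%N j j.+1 u v = br u v - \sum_(j.+2 <= k < t.+1) p 1%N j k u v.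
    by rewrite brE ?addrK //; lia.
  rewrite memv_add ?memv_bspan // memvN big_nat; apply: memv_suml => k /andP[le_k lt_k].
  apply: (subvP (T_le le_k)); apply: (subvP (sMT _)) => //; apply: p_mem => //; lia.
move=> s x sS; rewrite !memv_cap => /andP[xM /memv_addP[b bB [r rT xE]]].
rewrite SM //=.
rewrite xE (bilinDr brb) memv_add ?ST // => {x xE xM r rT}.
move: b bB; apply: (bspan_ind brb) => [|a x y xB yB|x y xM yM].
- by rewrite (bilin0r brb) mem0v.
- by rewrite (bilinDr brb) (bilinZr brb) memvD ?memvZ.
rewrite (lie_jacobi lie) memvB //; first by apply: memv_bspan => //; apply: SM.
rewrite anti memvN; apply: memv_bspan => //; apply: SM => //; lia.
Qed.

Lemma ideal_contains_tail k (U : {vspace V}) : is_ideal br U -> (1 <= k)%N ->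
  (T k <= U + T k.+1)%VS -> (T k <= U)%VS.
Proof.
move=> idU k1 sT.
suff H j : (k < j)%N -> (T k <= U + T j)%VS.
  have [lt_tk|le_kt] := ltnP t k; first by rewrite T_gt ?sub0v.
  by have := H t.+1; rewrite (@T_gt t.+1) // addv0; apply.
elim: j => // j IHj; rewrite ltnS leq_eqVlt => /predU1P[<- //|lt_kj].
apply: subv_trans (IHj lt_kj) _; rewrite subv_add addvSl /=.
have [lt_tj|le_jt] := ltnP t j; first by rewrite T_gt ?sub0v.
rewrite T_rec // subv_add addvSr andbT.
case: j => // j in IHj lt_kj le_jt *; apply: subv_trans (M_succ _ _) _ => //; first by lia.
(* An element of [M j] lies in [U + T j.+1]; bracketing with [M 1] keeps the first part in U and
   moves the second into [T j.+2]. *)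
rewrite subv_add addvSr andbT; apply/(bspanP brb) => m x mM xM.
have : x \in (U + T j.+1)%VS.
  apply: (subvP (IHj lt_kj)); apply: (subvP (T_le (lt_kj : (k <= j)%N))).
  by apply: (subvP (sMT _)) => //; lia.
case/memv_addP=> u uU [r rT ->]; rewrite (bilinDr brb) memv_add ?idU //.
by rewrite -[j.+2]/(1 + j.+1)%N TT // (subvP (sMT t_gt0)).
Qed.

(** The image of U in S along the radical is a nonzero ideal, hence S. Since [M 1] is irreducible
    and faithful, [S, M 1] = M 1, so U contains [M 1] modulo [T 2], and then the whole radical by
    propagation. *)
Lemma ideal_not_in_radical (U : {vspace V}) : is_ideal br U -> ~~ (U <= T 1)%VS -> U = fullv.
Proof.
move=> idU /subvPn[x xU xT].
have sSU : (S <= U + T 1)%VS.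
  suff <- : (S :&: (U + T 1))%VS = S by apply: capvSr.
  have [_ _ H] := simpS; case: (H (S :&: (U + T 1))%VS (capvSl _ _)) => //.
    move=> s y sS; rewrite !memv_cap => /andP[yS /memv_addP[u uU [r rT yE]]].
    rewrite -brS // SS //= yE (bilinDr brb) memv_add ?idU //.
    exact: ST.
  move=> E; case/negP: xT; have [s sS [r rT xE]] := splitSR x.
  suff s0 : s = 0 by rewrite xE s0 add0r.
  apply/eqP; rewrite -memv0 -E memv_cap sS /= -[s](addrK r) -xE.
  by rewrite memv_add // memvN.
have it : (1 <= 1 <= t)%N by rewrite t_gt0.
have M1 : bspan br S (M 1%N) = M 1%N.
  apply: stable_M => //.
  - by apply/(bspanP brb) => s u sS uM; apply: SM.
  - apply/eqP => B0; have [_ [s [s' [sS s'S /eqP H]]] _] := simpS; apply: H.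
    have S0 z : z \in S -> z = 0.
      move=> zS; apply: faithM => // u uM; rewrite -(brM it) //; apply/eqP.
      by rewrite -memv0 -B0 memv_bspan.
    by rewrite -brS // (S0 s) // (bilin0l brb).
  - move=> s x' sS; move: x'; apply: (bspan_ind brb) => [|a u v uB vB|u v uS vM].
    + by rewrite (bilin0r brb) mem0v.
    + by rewrite (bilinDr brb) (bilinZr brb) memvD ?memvZ.
    + by rewrite (lie_jacobi lie) memvB ?(anti (br s v)) ?memvN ?memv_bspan ?SS ?SM.
have sTU : (T 1 <= U)%VS.
  apply: ideal_contains_tail => //; rewrite T_rec // subv_add addvSr andbT -M1.
  apply/(bspanP brb) => s m sS mM.
  have /memv_addP[u uU [r rT ->]] := subvP sSU s sS.
  rewrite (bilinDl brb) memv_add //; first by rewrite anti memvN idU.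
  by rewrite -[2%N]/(1 + 1)%N TT // (subvP (sMT t_gt0)).
apply/eqP; rewrite eqEsubv subvf -full subv_add sTU andbT.
by apply: subv_trans sSU _; rewrite subv_add subvv.
Qed.

(** Take the last tail [T k] containing U. If it is nonzero, the part of [M k] met by U modulo
    [T k.+1] is a nonzero submodule, hence all of [M k], and propagation applies. *)
Lemma ideal_in_radical (U : {vspace V}) : is_ideal br U -> (U <= T 1)%VS ->
  exists2 k, (1 <= k <= t.+1)%N & U = T k.
Proof.
move=> idU sU1.
have [k [k1 le_kt sUT nUT]] : exists k, [/\ (1 <= k)%N, (k <= t.+1)%N, (U <= T k)%VS &
    (k <= t)%N -> ~~ (U <= T k.+1)%VS].
  have [m] := ubnP t; elim: m => // m IHm lt_m.
  apply: NNPP => nex.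
  have sU j : (1 <= j)%N -> (j <= t.+1)%N -> (U <= T j)%VS.
    elim: j => // -[|j] IHj _ le_j //; apply/negPn/negP => nU.
    by apply: nex; exists j.+1; split=> //; [lia | apply: IHj; lia].
  by apply: nex; exists t.+1; split=> //; [apply: sU | rewrite ltnn].
exists k; first by rewrite k1.
have [lt_tk|le_k] := ltnP t k.
  by apply/eqP; move: sUT; rewrite T_gt // subv0.
apply: subv_anti; rewrite sUT /=; apply: ideal_contains_tail => //.
rewrite {1}T_rec // subv_add addvSr andbT.
have kt : (1 <= k <= t)%N by rewrite k1.
suff <- : (M k :&: (U + T k.+1))%VS = M k by apply: capvSr.
apply: stable_M => //; first exact: capvSl.
  have /subvPn[u uU uT] := nUT le_k; apply: contraNneq uT => E.
  have : u \in (M k + T k.+1)%VS by rewrite -T_rec // (subvP sUT).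
  case/memv_addP=> m mM [r rT uE]; suff m0 : m = 0 by rewrite uE m0 add0r.
  apply/eqP; rewrite -memv0 -E memv_cap mM /= -[m](addrK r) -uE.
  by rewrite memv_add // memvN.
move=> s y sS; rewrite !memv_cap => /andP[yM /memv_addP[u uU [r rT yE]]].
by rewrite SM //= yE (bilinDr brb) memv_add ?idU // ST.
Qed.

Lemma tail_ideal k : (1 <= k)%N -> is_ideal br (T k).
Proof.
move=> k1 x y yT; have [s sS [r rT ->]] := splitSR x.
rewrite (bilinDl brb); apply: memvD; first exact: ST.
apply: (subvP (T_le (leqnSn k))).
by rewrite -add1n TT.
Qed.

Lemma chain_form_ideals (U : {vspace V}) : is_ideal br U <->
  (U = fullv \/ exists2 k, (1 <= k <= t.+1)%N & U = tail_sum t M k).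
Proof.
split=> [idU|[->|[k /andP[k1 _] ->]]]; last exact: tail_ideal.
  have [sU|nU] := boolP (U <= T 1)%VS; first by right; apply: ideal_in_radical.
  by left; apply: ideal_not_in_radical.
by move=> x y _; apply: memvf.
Qed.

End ChainFormIdeals.

Theorem theorem3p3 (K : fieldType) (charK0 : [pchar K] =i pred0) :
  (forall (t : nat) (V : vectType K) (S : {vspace V}) (M : nat -> {vspace V})
          (bS : V -> V -> V) (rho : nat -> V -> V -> V)
          (p : nat -> nat -> nat -> V -> V -> V) (br : V -> V -> V),
     of_chain_form t S M bS rho p br ->
     [/\ lie_bracket br,
         (forall U : {vspace V}, is_ideal br U <->
            (U = fullv \/ exists2 k, (1 <= k <= t.+1)%N & U = tail_sum t M k)),
         vproper (tail_sum t M 1) fullv &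
         (forall k, (1 <= k <= t)%N ->
            vproper (tail_sum t M k.+1) (tail_sum t M k))]) /\
  (forall (t : nat) (V : vectType K) (br : V -> V -> V),
     lie_bracket br -> mixed br -> ideal_lattice_chain br (t + 2) ->
     exists (S : {vspace V}) (M : nat -> {vspace V}) (bS : V -> V -> V)
            (rho : nat -> V -> V -> V) (p : nat -> nat -> nat -> V -> V -> V),
       of_chain_form t S M bS rho p br).
Proof.
split=> [t V S M bS rho p br form|t V br br_lie br_mixed br_chain].
  split=> [|U||k kt]; first exact: chain_form_lie form.
  - exact: chain_form_ideals form U.
  - exact: chain_form_radical_proper form.
  - exact: chain_form_proper form k kt.
exact: mixed_chain_form.
Qed.
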